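(* Let $0<\alpha<1$ and let $T$ be a $\gamma$-Schrödinger-Calderón-Zygmund operator, $\gamma\ge 0$, with smoothness (regularity) exponent $\delta>0$, such that $\alpha+\gamma<\min\{1,\delta\}$. Then $T$ is bounded from $BMO^\alpha_{\mathcal L}$ into $BMO^{\alpha+\gamma}_{\mathcal L}$ if and only if there exists a constant $C$ such that $$\left(\frac{\rho(x)}{s}\right)^\alpha\frac{1}{|B|^{1+\frac{\gamma}{n}}}\int_B|T1(y)-(T1)_B|\,dy\le C$$ for every ball $B=B(x,s)$ with $x\in\mathbb R^n$ and $0<s\le\frac12\rho(x)$.
   Context: Setting. $n\ge 3$ and $\mathcal L=-\Delta+V$ on $\mathbb R^n$, where $V\ge 0$ is a locally integrable, not identically zero function satisfying a reverse Hölder inequality $V\in RH_q$ for some $q\ge n/2$: there is a constant $C$ with $\left(\frac1{|B|}\int_B V^q\right)^{1/q}\le \frac{C}{|B|}\int_B V$ for all balls $B\subset\mathbb R^n$. The critical radii function is $\rho(x)=\sup\{r>0:\ r^{-(n-2)}\int_{B(x,r)}V(y)\,dy\le 1\}$; it satisfies $0<\rho(x)<\infty$ for all $x\in\mathbb R^n$. For a ball $B$, $f_B=\frac1{|B|}\int_B f$. Spaces. For $0\le\beta\le1$, a locally integrable function $f$ belongs to $BMO^\beta_{\mathcal L}$ if there is $C>0$ such that (i) $\frac1{|B|}\int_B|f-f_B|\le C|B|^{\beta/n}$ for every ball $B\subset\mathbb R^n$, and (ii) $\frac1{|B|}\int_B|f|\le C|B|^{\beta/n}$ for every ball $B=B(x_0,r_0)$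 with $r_0\ge\rho(x_0)$. The norm $\|f\|_{BMO^\beta_{\mathcal L}}$ is the minimum such $C$. Operators. Let $0\le\gamma<n$, $1<p_1\le p_2<\infty$, $\frac1{p_2}=\frac1{p_1}-\frac\gamma n$. A bounded linear operator $T:L^{p_1}(\mathbb R^n)\to L^{p_2}(\mathbb R^n)$ is a $\gamma$-Schrödinger-Calderón-Zygmund operator with regularity (smoothness) exponent $\delta>0$ if there is a kernel $K$ with $Tf(x)=\int_{\mathbb R^n}K(x,y)f(y)\,dy$ for every $f\in L^{p_1}(\mathbb R^n)$ with compact support and a.e. $x\notin\operatorname{supp}(f)$, such that: (1) for every $N>0$ there is a constant $C_N$ with $|K(x,y)|\le \frac{C_N}{|x-y|^{n-\gamma}}\left(1+\frac{|x-y|}{\rho(x)}\right)^{-N}$ for all $x\ne y$; (2) there is a constant $C$ with $|K(x,y)-K(x,z)|+|K(y,x)-K(z,x)|\le C\frac{|y-z|^\delta}{|x-y|^{n-\gamma+\delta}}$ whenever $|x-y|>2|y-z|$. Action on $BMO^\beta_{\mathcal L}$. For $f\in BMO^\beta_{\mathcal L}$, $0\le\beta\le1$ (in particular for $f\equiv1\in BMO^0_{\mathcal L}$), $x_0\in\mathbb R^n$ and $R\ge\rho(x_0)$, one defines $$Tf(x)=T(f\chi_{B(x_0,R)})(x)+\int_{B(x_0,R)^c}K(x,y)f(y)\,dy,\quad\text{a.e. }x\in B(x_0,R);$$ the integral converges absolutely and the definition is independent (a.e.) of the choice of the ball $B(x_0,R)$. *)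

(* Defs.v *)
From HB Require Import structures.
From mathcomp Require Import all_boot all_order all_algebra.
From mathcomp Require Import all_classical all_reals all_analysis.

Set Implicit Arguments.
Unset Strict Implicit.
Unset Printing Implicit Defensive.
Import Order.TTheory GRing.Theory Num.Theory.
Import numFieldNormedType.Exports.

Local Open Scope classical_set_scope.
Local Open Scope ring_scope.

(* R^n is the type n.-tuple R with the product sigma-algebra that the library
   puts on tuples (generated by the coordinates), i.e. the Borel sets. *)
Notation Rn R n := (n.-tuple (measurableTypeR R)).

Section lebesgue_measure_Rn.
Context {R : realType}.

Definition tcons n (z : measurableTypeR R * Rn R n) : Rn R n.+1 :=
  [the n.+1.-tuple _ of z.1 :: z.2].

Definition tuncons n (x : Rn R n.+1) : measurableTypeR R * Rn R n :=
  (thead x, [tuple of behead x]).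

Lemma tunconsK n : cancel (@tuncons n) (@tcons n).
Proof. by move=> x; rewrite /tcons /tuncons/= [RHS]tuple_eta; apply: val_inj. Qed.

Lemma tconsK n : cancel (@tcons n) (@tuncons n).
Proof. by move=> [a t]; rewrite /tcons /tuncons/=; congr pair; apply: val_inj. Qed.

Lemma measurable_tcons n : measurable_fun [set: _] (@tcons n).
Proof. exact: measurable_cons. Qed.

Lemma measurable_tuncons n : measurable_fun [set: _] (@tuncons n).
Proof.
apply/measurable_fun_pairP; split.
  exact: measurable_tnth.
exact: measurable_behead.
Qed.

HB.instance Definition _ n :=
  isMeasurableFun.Build _ _ _ _ (@tcons n) (@measurable_tcons n).

Section cons_measure.
Variables (n : nat) (m : {sigma_finite_measure set (Rn R n) -> \bar R}).

Definition cons_measure : set (Rn R n.+1) -> \bar R :=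
  pushforward (lebesgue_measure \x m)%E (@tcons n).

Let cons_measure0 : cons_measure set0 = 0%E.
Proof. exact: measure0. Qed.

Let cons_measure_ge0 A : (0 <= cons_measure A)%E.
Proof. exact: measure_ge0. Qed.

Let cons_measure_sigma_additive : semi_sigma_additive cons_measure.
Proof. exact: measure_semi_sigma_additive. Qed.

HB.instance Definition _ := isMeasure.Build _ _ _ cons_measure
  cons_measure0 cons_measure_ge0 cons_measure_sigma_additive.

Let cons_measure_sigma_finite : sigma_finite [set: _] cons_measure.
Proof.
have /sigma_finiteP[F [TF ndF Foo]] := sigma_finiteT (@lebesgue_measure R).
have /sigma_finiteP[G [TG ndG Goo]] := sigma_finiteT m.
exists (fun k => @tuncons n @^-1` (F k `*` G k)).
  rewrite -preimage_bigcup (_ : \bigcup_k _ = setT) ?preimage_setT//.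
  apply/seteqP; split=> // -[x y] _.
  have [j _ Fx] : (\bigcup_i F i) x by rewrite -TF.
  have [k _ Gy] : (\bigcup_i G i) y by rewrite -TG.
  exists (maxn j k) => //; split=> /=.
    by move: x Fx; exact/subsetPset/ndF/leq_maxl.
  by move: y Gy; exact/subsetPset/ndG/leq_maxr.
move=> k; have [mF Fk] := Foo k; have [mG Gk] := Goo k; split.
  rewrite -[X in measurable X]setTI; apply: measurable_tuncons => //.
  exact: measurableX.
rewrite /cons_measure /pushforward -comp_preimage.
rewrite (_ : _ \o _ = id); last by apply/funext => z /=; rewrite tconsK.
by rewrite preimage_id product_measure1E// lte_mul_pinfty// ge0_fin_numE.
Qed.

HB.instance Definition _ :=
  Measure_isSigmaFinite.Build _ _ _ cons_measure cons_measure_sigma_finite.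

End cons_measure.

Let dirac_nil_sigma_finite :
  sigma_finite [set: Rn R 0] (dirac ([tuple] : Rn R 0) : set _ -> \bar R).
Proof.
by apply: fin_num_fun_sigma_finite; rewrite ?measure0// => A _;
  exact: fin_num_measure.
Qed.

HB.instance Definition _ := Measure_isSigmaFinite.Build _ _ _
  (dirac ([tuple] : Rn R 0) : set _ -> \bar R) dirac_nil_sigma_finite.

Fixpoint lebesgue_measure_Rn n : {sigma_finite_measure set (Rn R n) -> \bar R} :=
  match n with
  | 0 => [the {sigma_finite_measure set _ -> \bar R} of dirac ([tuple] : Rn R 0)]
  | n'.+1 => [the {sigma_finite_measure set _ -> \bar R} of
      cons_measure (lebesgue_measure_Rn n')]
  end.

Lemma measurable_box n (a b : Rn R n) :
  measurable [set x : Rn R n | forall i, tnth a i <= tnth x i <= tnth b i].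
Proof.
rewrite (_ : [set _ | _] = \bigcap_(i in [set: 'I_n])
    ((fun x : Rn R n => tnth x i) @^-1` `[tnth a i, tnth b i]%classic)).
  apply: fin_bigcap_measurable => //.
  by move=> i _; rewrite -[X in measurable X]setTI; exact: measurable_tnth.
apply/seteqP; split=> x /= h i; first by move=> _; rewrite /= in_itv/=.
by have := h i I; rewrite /= in_itv/=.
Qed.

Lemma lebesgue_measure_Rn_box n (a b : Rn R n) :
  (forall i, tnth a i <= tnth b i) ->
  lebesgue_measure_Rn n [set x | forall i, tnth a i <= tnth x i <= tnth b i] =
  (\prod_(i < n) (tnth b i - tnth a i))%:E.
Proof.
elim: n a b => [|n IH] a b ab.
  by rewrite big_ord0 /= diracE mem_set// => -[].
have tuncons2 (x : Rn R n.+1) i : tnth (tuncons x).2 i = tnth x (lift ord0 i).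
  by rewrite [in RHS](tuple_eta x) tnthS.
have tcons0 (z : measurableTypeR R * Rn R n) : tnth (tcons z) ord0 = z.1 by [].
have tconsS (z : measurableTypeR R * Rn R n) i :
  tnth (tcons z) (lift ord0 i) = tnth z.2 i by rewrite tnthS.
rewrite big_ord_recl /= /cons_measure /pushforward.
rewrite (_ : _ @^-1` _ = `[tnth a ord0, tnth b ord0]%classic `*`
  [set x : Rn R n | forall i,
    tnth (tuncons a).2 i <= tnth x i <= tnth (tuncons b).2 i]); last first.
  apply/seteqP; split=> [z /= h|z /= [+ h] i].
    split=> [|i]; first by have := h ord0; rewrite tcons0 in_itv.
    by have := h (lift ord0 i); rewrite tconsS !tuncons2.
  rewrite in_itv/= => h0; case: (unliftP ord0 i) => [j ->|->].
    by have := h j; rewrite tconsS !tuncons2.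
  by rewrite tcons0.
rewrite product_measure1E//; last exact: measurable_box.
rewrite IH => [|i]; last by rewrite !tuncons2.
rewrite EFinM; congr (_ * _)%E.
  rewrite [LHS]lebesgue_measure_itv/= lte_fin lt_neqAle ab andbT; case: eqVneq => [->|_]; last by rewrite EFinB.
  by rewrite subrr.
by congr (_%:E); apply: eq_bigr => i _; rewrite !tuncons2.
Qed.

End lebesgue_measure_Rn.

Section schrodinger_spaces_and_operators.
Context {R : realType} {n : nat}.
Local Notation E := (Rn R n).
Local Notation mu := (lebesgue_measure_Rn n).

Definition edist (x y : E) : R :=
  Num.sqrt (\sum_(i < n) (tnth x i - tnth y i : R) ^+ 2).

Definition eball (x : E) (r : R) : set E := [set y | edist x y < r].

Definition vol (A : set E) : R := fine (mu A).

Definition avg (f : E -> R) (A : set E) : R :=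
  (vol A)^-1 * \int[mu]_(y in A) f y.

(* In R^n, integrability on all compact sets and on all balls agree. *)
Definition loc_integrable (f : E -> R) : Prop :=
  measurable_fun setT f /\
  forall (x : E) (r : R), 0 < r -> mu.-integrable (eball x r) (EFin \o f).

(* The left-hand side is computed in \bar R, so that the inequality forces
   V ^ q to be integrable on balls. *)
Definition reverse_hoelder (q : R) (V : E -> R) : Prop :=
  exists C : R, forall (x : E) (r : R), 0 < r ->
    ((((vol (eball x r))^-1)%:E *
       \int[mu]_(y in eball x r) (V y `^ q)%:E) `^ q^-1
     <= (C * avg V (eball x r))%:E)%E.

Section potential.
Variable V : E -> R.

Definition critical_radius (x : E) : R :=
  sup [set r : R | 0 < r /\
    (r ^+ (n - 2)%N)^-1 * (\int[mu]_(y in eball x r) V y) <= 1].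
Local Notation rho := critical_radius.

Definition BMO_bound (beta : R) (f : E -> R) (C : R) : Prop :=
  [/\ 0 < C,
      forall (x : E) (r : R), 0 < r ->
        avg (fun y => `|f y - avg f (eball x r)|) (eball x r)
          <= C * vol (eball x r) `^ (beta / n%:R)
    & forall (x : E) (r : R), rho x <= r ->
        avg (fun y => `|f y|) (eball x r)
          <= C * vol (eball x r) `^ (beta / n%:R)].

Definition BMO (beta : R) : set (E -> R) :=
  [set f | loc_integrable f /\ exists C, BMO_bound beta f C].

Definition BMO_norm (beta : R) (f : E -> R) : R :=
  inf [set C | BMO_bound beta f C].

Definition bounded_BMO (beta beta' : R) (S : (E -> R) -> (E -> R)) : Prop :=
  exists C : R, forall f, BMO beta f ->
    BMO beta' (S f) /\ BMO_norm beta' (S f) <= C * BMO_norm beta f.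

(* T acts on representatives.  Linearity and boundedness make it send
   a.e. equal functions of L^p1 to a.e. equal functions, so that T induces
   an operator between the spaces of classes. *)
Definition bounded_linear_Lp (p1 p2 : R) (T : (E -> R) -> (E -> R)) : Prop :=
  [/\ forall f, f \in Lfun mu p1%:E -> T f \in Lfun mu p2%:E,
      forall (a : R) f g, f \in Lfun mu p1%:E -> g \in Lfun mu p1%:E ->
        {ae mu, forall x, T (fun y => a * f y + g y) x = a * T f x + T g x}
    & exists C : R, forall f, f \in Lfun mu p1%:E ->
        ('N[mu]_p2%:E [EFin \o T f] <= C%:E * 'N[mu]_p1%:E [EFin \o f])%E].

(* The support of a class of a.e. equal functions: the complement of the
   largest open set on which f vanishes a.e.  It is closed, hence compact
   as soon as it is bounded. *)
Definition ess_support (f : E -> R) : set E :=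
  [set x | forall r : R, 0 < r -> ~ {ae mu, forall y, eball x r y -> f y = 0}].

Definition compactly_supported (f : E -> R) : Prop :=
  exists (x : E) (r : R), ess_support f `<=` eball x r.

Definition represented_by (p1 : R) (T : (E -> R) -> (E -> R))
    (K : E -> E -> R) : Prop :=
  forall f, f \in Lfun mu p1%:E -> compactly_supported f ->
    {ae mu, forall x, ~ ess_support f x -> T f x = \int[mu]_y (K x y * f y)}.

Definition kernel_size (gamma : R) (K : E -> E -> R) : Prop :=
  forall N : R, 0 < N -> exists C : R, forall x y : E, x != y ->
    `|K x y| <= C / edist x y `^ (n%:R - gamma)
                * (1 + edist x y / rho x) `^ (- N).

Definition kernel_smoothness (gamma delta : R) (K : E -> E -> R) : Prop :=
  exists C : R, forall x y z, edist x y > 2 * edist y z ->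
    `|K x y - K x z| + `|K y x - K z x|
      <= C * (edist y z `^ delta / edist x y `^ (n%:R - gamma + delta)).

Definition SCZ_operator (gamma delta p1 p2 : R) (T : (E -> R) -> (E -> R))
    (K : E -> E -> R) : Prop :=
  [/\ bounded_linear_Lp p1 p2 T, represented_by p1 T K,
      kernel_size gamma K & kernel_smoothness gamma delta K].

Definition is_extension (T : (E -> R) -> (E -> R)) (K : E -> E -> R)
    (f g : E -> R) : Prop :=
  measurable_fun setT g /\
  forall (x0 : E) (r : R), rho x0 <= r ->
    {ae mu, forall x, eball x0 r x ->
      g x = T (f \* \1_(eball x0 r)) x +
            \int[mu]_(y in ~` eball x0 r) (K x y * f y)}.

(* The function T f for f in BMO^beta: is_extension determines it up to a
   null set, and a representative is chosen; 0 is a dummy default. *)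
Definition extend (T : (E -> R) -> (E -> R)) (K : E -> E -> R)
    (f : E -> R) : E -> R :=
  xget (cst 0) [set g | is_extension T K f g].

End potential.
End schrodinger_spaces_and_operators.

(* Main.v *)
Require Import Defs.
From mathcomp Require Import all_boot all_order all_algebra.
From mathcomp Require Import all_classical all_reals all_analysis.
From mathcomp Require Import measurable_realfun.
From mathcomp Require Import ring lra.

(** Why the criterion holds. Let [f] be in BMO^alpha and let [B] be a ball of centre [x]
    and radius [s]. The kernel of [T] is integrable at infinity against functions of
    growth less than [1 - gamma], so that [T f] makes sense, and it is local in the
    following way. For a constant [c] close to [f] on [B], such as its average, the
    function [T f - c T 1] behaves like [T (f - c)]: the part of [f - c] near [B] is handled
    by the boundedness of [T] from [L^p1] to [L^p2], and the far part is constant on [B] up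
    to an error controlled by the smoothness of the kernel, as
    [alpha + gamma < delta]. Hence [T f] is [c T 1] plus a constant, with an error of mean
    size at most a constant times [s `^ (alpha + gamma)] ([extension_osc]). On balls of
    radius at least the critical radius [rho x] no cancellation is needed, and the decay of
    the kernel gives the size of [T f] directly ([extension_size]).

    If the T1 condition holds and [s <= rho x / 2], then the average [c] of [f] is at most
    of order [rho x `^ alpha], and the condition says precisely that [c T 1]
    oscillates by at most [s `^ (alpha + gamma)]; larger balls are covered by the size
    estimate ([T1_condition_bounded]). Conversely, a function of BMO^alpha whose averages on
    small balls are at least of order [rho x `^ alpha] turns the boundedness of [T] into
    the T1 condition ([bounded_T1_condition]). One function does this for all balls: the
    power [alpha] of the largest 1-Lipschitz minorant of [rho] ([rho_lip]).

    Two ingredients are not formal. The first is that [rho] is finite and positive, and that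
    [rho x] is at most a constant times [r] when [x] is within [r] of a point [x0] with
    [rho x0 <= r] ([critical_radius_compare]); in particular [rho_lip] is
    comparable to [rho]. Both follow from the growth of [psi V x r], the
    normalized mass of [V] on a ball, as [r] increases ([psi_growth]), for which a hole
    filling argument is applied to the reverse Hoelder inequality ([qmass_hole]). The
    second is that bounds for the mean oscillation of [f] on all balls are
    pointwise bounds a.e. ([campanato]), from which the cutoffs of [f] are bounded and so
    belong to [L^p1]. *)

Set Implicit Arguments.
Unset Strict Implicit.
Unset Printing Implicit Defensive.
Import Order.TTheory GRing.Theory Num.Theory.
Import numFieldNormedType.Exports.

Local Open Scope classical_set_scope.
Local Open Scope ring_scope.

(* Otherwise [edist] would denote the extended distance of a metric space. *)
Local Notation edist := Defs.edist.

(** * Euclidean geometry of tuples *)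

Lemma le_of_eq d (T : porderType d) (a b : T) : a = b -> (a <= b)%O.
Proof. by move=> ->. Qed.

Section geometry.
Context {R : realType} {n : nat}.
Local Notation E := (Rn R n).
Implicit Types (x y z : E) (r s : R).

Lemma edist_ge0 x y : 0 <= edist x y.
Proof. exact: sqrtr_ge0. Qed.

Lemma edistC x y : edist x y = edist y x.
Proof.
by congr Num.sqrt; apply: eq_bigr => i _; rewrite -[LHS]sqrrN opprB.
Qed.

Lemma edistxx x : edist x x = 0.
Proof.
rewrite /edist big1 ?sqrtr0// => i _.
by rewrite subrr expr0n.
Qed.

Lemma sqr_edist x y : edist x y ^+ 2 = \sum_(i < n) (tnth x i - tnth y i : R) ^+ 2.
Proof. by rewrite sqr_sqrtr// sumr_ge0// => i _; exact: sqr_ge0. Qed.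

(** Lagrange's identity: the difference of the two sides is half the sum of the
    squares of the 2 x 2 minors. *)
Lemma sum_sqr_cauchy (a b : 'I_n -> R) :
  (\sum_i a i * b i) ^+ 2 <= (\sum_i a i ^+ 2) * (\sum_i b i ^+ 2).
Proof.
have : 0 <= \sum_i \sum_j (a i * b j - a j * b i) ^+ 2.
  by apply: sumr_ge0 => i _; apply: sumr_ge0 => j _; exact: sqr_ge0.
set A := \sum_i a i ^+ 2; set B := \sum_i b i ^+ 2; set C := \sum_i a i * b i.
suff -> : \sum_i \sum_j (a i * b j - a j * b i) ^+ 2 =
  A * B + B * A - (C * C + C * C) by lra.
rewrite /A /B /C !big_distrlr/= -!big_split/= -sumrB; apply: eq_bigr => i _.
by rewrite -!big_split/= -sumrB; apply: eq_bigr => j _; ring.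
Qed.

Lemma edist_triangle x y z : edist x z <= edist x y + edist y z.
Proof.
rewrite -(@ler_pXn2r _ 2)// ?nnegrE ?addr_ge0 ?edist_ge0//.
rewrite sqrrD !sqr_edist.
pose a i : R := tnth x i - tnth y i.
pose b i : R := tnth y i - tnth z i.
have -> : \sum_(i < n) (tnth x i - tnth z i : R) ^+ 2 =
  \sum_i a i ^+ 2 + (\sum_i a i * b i) *+ 2 + \sum_i b i ^+ 2.
  rewrite -sumrMnl -!big_split/=; apply: eq_bigr => i _.
  rewrite /a /b. ring.
rewrite lerD2r lerD2l lerMn2r/=.
have [|/ltW ab0] := leP (\sum_i a i * b i) 0.
  by move=> /le_trans -> //; rewrite mulr_ge0 ?edist_ge0.
rewrite -(@ler_pXn2r _ 2)// ?nnegrE ?mulr_ge0 ?edist_ge0//.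
by rewrite exprMn !sqr_edist sum_sqr_cauchy.
Qed.

Lemma coord_le_edist x y i : `|tnth x i - tnth y i : R| <= edist x y.
Proof.
rewrite -(@ler_pXn2r _ 2)// ?nnegrE ?edist_ge0//.
rewrite sqr_edist (bigD1 i)//= real_normK ?num_real// lerDl sumr_ge0// => j _.
exact: sqr_ge0.
Qed.

Lemma edist_le_coord x y (e : R) : 0 <= e ->
  (forall i, `|tnth x i - tnth y i : R| <= e) -> edist x y <= n%:R * e.
Proof.
move=> e0 xye; rewrite -(@ler_pXn2r _ 2)// ?nnegrE ?mulr_ge0 ?edist_ge0//.
rewrite sqr_edist; apply: (@le_trans _ _ (\sum_(i < n) e ^+ 2)).
  apply: ler_sum => i _.
  by rewrite -[leLHS]real_normK ?num_real// ler_pXn2r ?nnegrE.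
rewrite sumr_const card_ord -[leLHS]mulr_natl exprMn.
apply: ler_wpM2r; first exact: sqr_ge0.
by rewrite -natrX ler_nat; case: (n) => // m; rewrite expnS leq_pmulr.
Qed.

Lemma edist_eq0 x y : edist x y = 0 -> x = y.
Proof.
move=> xy0; apply: eq_from_tnth => i; apply/eqP.
by have := coord_le_edist x y i; rewrite xy0 normr_le0 subr_eq0.
Qed.

Lemma edist_gt0 x y : (0 < edist x y) = (x != y).
Proof.
rewrite lt0r edist_ge0 andbT; congr negb.
by apply/eqP/eqP => [/edist_eq0//|->]; rewrite edistxx.
Qed.

Lemma eballS x y r s : edist x y + r <= s -> eball y r `<=` eball x s.
Proof.
move=> xyr z; rewrite /eball/= => yz.
by rewrite (le_lt_trans (edist_triangle x y z))// (lt_le_trans _ xyr)// ltrD2l.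
Qed.

Lemma eball_le x r s : r <= s -> eball x r `<=` eball x s.
Proof. by move=> rs; apply: eballS; rewrite edistxx add0r. Qed.

Lemma measurable_edist x : measurable_fun setT (edist x).
Proof.
rewrite (_ : edist x = (fun a : R => a `^ 2^-1) \o
    (fun y : E => \sum_(i < n) (tnth x i - tnth y i : R) ^+ 2)).
  apply: measurableT_comp; first exact: measurable_powR.

  apply: measurable_sum => i.
  apply: measurable_funX; apply: measurable_funB => //.
  exact: measurable_tnth.
apply/funext => y /=; rewrite powR12_sqrt// sumr_ge0// => i _; exact: sqr_ge0.
Qed.

Lemma measurable_eball x r : measurable (eball x r).
Proof.
rewrite -[eball _ _]setTI (_ : eball x r = (fun y => edist x y < r) @^-1` [set true]).
  by apply: measurable_fun_ltr => //; exact: measurable_edist.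
by apply/seteqP; split.
Qed.

End geometry.

(** * Open sets and volumes of balls *)

Section eopen.
Context {R : realType} {n : nat}.
Local Notation E := (Rn R n).
Implicit Types (x y z : E) (r s : R) (U : set E).

(** The sigma-algebra on tuples is generated by the coordinates; openness for [edist] has
    to be related to it ([measurable_eopen]). *)
Definition eopen U := forall x, U x -> exists2 r : R, 0 < r & eball x r `<=` U.

Lemma rat_tuple_dense x (e : R) : 0 < e ->
  exists c : n.-tuple rat, edist x [tuple ratr (tnth c i) | i < n] < e.
Proof.
move=> e0; pose d := e / n.+1%:R.
have d0 : 0 < d by rewrite divr_gt0.
have /choice[c cP] (i : 'I_n) : exists p : rat, ratr p \in `]tnth x i, tnth x i + d[.
  have /rat_in_itvoo[p] : tnth x i < tnth x i + d by rewrite ltrDl.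
  by exists p.
exists [tuple c i | i < n]; apply: (@le_lt_trans _ _ (n%:R * d)).
  apply: edist_le_coord => [|i]; first exact: ltW.
  have := cP i; rewrite !tnth_mktuple in_itv/= => /andP[h1 h2].
  by rewrite ler_norml; apply/andP; split; lra.
by rewrite /d mulrCA gtr_pMr// ltr_pdivrMr// mul1r ltr_nat.
Qed.

(** An open set is the countable union of the balls with rational centre and
    radius that it contains. *)
Lemma measurable_eopen U : eopen U -> measurable U.
Proof.
move=> oU.
pose B (p : n.-tuple rat * rat) : set E :=
  eball [tuple ratr (tnth p.1 i) | i < n] (ratr p.2).
pose F p : set E := if `[< B p `<=` U >] then B p else set0.
have -> : U = \bigcup_p F p.
  apply/seteqP; split => [x Ux|x [p _]]; last first.
    by rewrite /F; case: asboolP => // h; exact: h.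
  have [r r0 rU] := oU x Ux.
  have /rat_in_itvoo[e] : 0 < r / 2 by rewrite divr_gt0.
  rewrite in_itv/= => /andP[e0 er].
  have [c xc] := rat_tuple_dense x e0.
  exists (c, e) => //; rewrite /F; case: asboolP; first by rewrite /B/= /eball/= edistC.
  case; apply: (subset_trans _ rU); apply: eballS => /=; lra.
apply: countable_bigcupT_measurable; first exact: countableP.
move=> p; rewrite /F; case: ifP => // _; exact: measurable_eball.
Qed.

Definition econtinuous_on U (f : E -> R) := forall x (e : R), U x -> 0 < e ->
  exists2 d : R, 0 < d & forall y, edist x y < d -> `|f x - f y| < e.

Lemma econtinuous_measurable U (f : E -> R) : eopen U -> econtinuous_on U f ->
  measurable_fun U f.
Proof.
move=> oU cf mU; apply: (measurability _ (RGenOInfty.measurableE R)) => //.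
move=> _ [_ [a ->] <-]; apply: measurable_eopen => x [Ux] /=.
rewrite in_itv/= andbT => ax.
have [r r0 rU] := oU x Ux.
have [|d d0 df] := cf x (f x - a) Ux; first by rewrite subr_gt0.
exists (Num.min r d); first by rewrite lt_min r0.
move=> y; rewrite /eball/= lt_min => /andP[xr xd]; split; first exact: rU.
rewrite /= in_itv/= andbT; have := df y xd.
by rewrite ltr_norml => /andP[_]; lra.
Qed.

End eopen.

Section ball_measure.
Context {R : realType} {n : nat}.
Local Notation E := (Rn R n).
Local Notation mu := (@lebesgue_measure_Rn R n).
Implicit Types (x y z : E) (r s : R).

Definition cube x (h : R) : set E :=
  [set y | forall i, tnth x i - h <= tnth y i <= tnth x i + h].

(** A ball is compared with an inscribed and a circumscribed cube,
    which determines its volume up to constants depending on [n]. *)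
Lemma mu_cube x (h : R) : 0 <= h -> mu (cube x h) = ((h *+ 2) ^+ n)%:E.
Proof.
move=> h0.
pose a : E := [tuple (tnth x i - h : R) | i < n].
pose b : E := [tuple (tnth x i + h : R) | i < n].
have -> : cube x h = [set y : E | forall i, tnth a i <= tnth y i <= tnth b i].
  by apply/seteqP; split => y /= + i => /(_ i); rewrite !tnth_mktuple.
rewrite lebesgue_measure_Rn_box => [|i]; last by rewrite !tnth_mktuple; lra.
congr (_%:E); rewrite (eq_bigr (fun=> h *+ 2)).
  by rewrite prodr_const card_ord.
move=> i _; rewrite !tnth_mktuple; ring.
Qed.

Lemma measurable_cube x (h : R) : measurable (cube x h).
Proof.
pose a : E := [tuple (tnth x i - h : R) | i < n].
pose b : E := [tuple (tnth x i + h : R) | i < n].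
have -> : cube x h = [set y : E | forall i, tnth a i <= tnth y i <= tnth b i].
  by apply/seteqP; split => y /= + i => /(_ i); rewrite !tnth_mktuple.
exact: measurable_box.
Qed.

Lemma mu_eball_le x r : 0 <= r -> (mu (eball x r) <= ((2 * r) ^+ n)%:E)%E.
Proof.
move=> r0; rewrite mulr_natl -(mu_cube x r0); apply: le_measure.
- by rewrite inE; exact: measurable_eball.
- by rewrite inE; exact: measurable_cube.
- move=> y xy i; have := le_lt_trans (coord_le_edist x y i) xy.
  by rewrite ltr_norml => /andP[? ?]; apply/andP; split; lra.
Qed.

Lemma mu_eball_ge x r : 0 < r -> (((r / n.+1%:R) ^+ n)%:E <= mu (eball x r))%E.
Proof.
move=> r0; pose h : R := r / n.+1%:R / 2.
have h0 : 0 < h by rewrite !divr_gt0.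
rewrite (_ : r / _ = h *+ 2); last by rewrite /h mulr2n -splitr.
rewrite -(mu_cube x (ltW h0)); apply: le_measure.
- by rewrite inE; exact: measurable_cube.
- by rewrite inE; exact: measurable_eball.
- move=> y xy; rewrite /eball/=; apply: (@le_lt_trans _ _ (n%:R * h)).
    apply: edist_le_coord => [|i]; first exact: ltW.
    by have /andP[? ?] := xy i; rewrite ler_norml; apply/andP; split; lra.
  apply: (@le_lt_trans _ _ (r / 2)); last by lra.
  rewrite /h (_ : n%:R * _ = r / 2 * (n%:R / n.+1%:R)); last by ring.
  by rewrite ler_piMr ?divr_ge0 ?ltW// ltr_pdivrMr// mul1r ltr_nat.
Qed.

Lemma mu_eball_fin x r : mu (eball x r) \is a fin_num.
Proof.
rewrite ge0_fin_numE//; have [r0|/ltW r0] := leP 0 r.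
  by rewrite (le_lt_trans (mu_eball_le x r0))// ltry.
rewrite (le_lt_trans (@le_measure _ _ _ mu _ (eball x 0) _ _ _)) ?inE//; try exact: measurable_eball.
  exact: eball_le.
by rewrite (le_lt_trans (mu_eball_le x (lexx 0)))// ltry.
Qed.

Lemma volE x r : mu (eball x r) = (vol (eball x r))%:E.
Proof. by rewrite /vol fineK// mu_eball_fin. Qed.

Lemma vol_le x r : 0 <= r -> vol (eball x r) <= (2 * r) ^+ n.
Proof. by move=> r0; rewrite -lee_fin -volE mu_eball_le. Qed.

Lemma vol_ge x r : 0 < r -> (r / n.+1%:R) ^+ n <= vol (eball x r).
Proof. by move=> r0; rewrite -lee_fin -volE mu_eball_ge. Qed.

Lemma vol_gt0 x r : 0 < r -> 0 < vol (eball x r).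
Proof.
move=> r0; apply: lt_le_trans (vol_ge x r0).
by rewrite exprn_gt0// divr_gt0.
Qed.

Lemma vol_ratio x y r s : 0 < r -> 0 <= s ->
  vol (eball y s) <= (2 * n.+1%:R * (s / r)) ^+ n * vol (eball x r).
Proof.
move=> r0 s0; apply: le_trans (vol_le y s0) _.
apply: le_trans (ler_wpM2l _ (vol_ge x r0)); last by rewrite exprn_ge0// !mulr_ge0// invr_ge0 ltW.
rewrite -exprMn; apply: le_of_eq; congr (_ ^+ _).
by field; rewrite (gt_eqF r0)/= ?natr1 ?nat1r pnatr_eq0.
Qed.

End ball_measure.

(** * Averages over balls *)

Section ae_tools.
Context {R : realType} {n : nat}.
Local Notation E := (Rn R n).
Local Notation mu := (@lebesgue_measure_Rn R n).
Implicit Types (x y z : E) (r s c : R) (f g : E -> R) (A B D : set E).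

Lemma ge0_fine_le (I : \bar R) c : (0 <= I)%E -> (I <= c%:E)%E -> fine I <= c.
Proof.
move=> I0 Ic; have fI : I \is a fin_num by rewrite ge0_fin_numE// (le_lt_trans Ic) ?ltry.
by rewrite -lee_fin fineK.
Qed.

Lemma ae_le_integrable D f g : measurable D -> measurable_fun D f ->
  mu.-integrable D (EFin \o g) -> {ae mu, forall y, D y -> `|f y| <= g y} ->
  mu.-integrable D (EFin \o f).
Proof.
move=> mD mf /integrableP[mg gi] fg; apply/integrableP; split.
  exact/measurable_EFinP.
apply: le_lt_trans gi; apply: ae_ge0_le_integral => //.
- by apply: measurableT_comp => //; exact/measurable_EFinP.
- exact: measurableT_comp.
- apply: filterS fg => y /[apply] fg /=.
  by rewrite lee_fin (le_trans fg)// ler_norm.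
Qed.

Lemma integrable_finite_cst D c : measurable D -> (mu D < +oo)%E ->
  mu.-integrable D (EFin \o (fun=> c)).
Proof.
move=> mD Dfin; apply/integrableP; split; first exact/measurable_EFinP.
rewrite /= integral_cst//.
by rewrite lte_mul_pinfty.
Qed.

Lemma ae_bounded_integrable D f c : measurable D -> (mu D < +oo)%E ->
  measurable_fun D f -> {ae mu, forall y, D y -> `|f y| <= c} ->
  mu.-integrable D (EFin \o f).
Proof.
move=> mD Dfin mf fc; apply: (ae_le_integrable mD mf _ fc).
exact: integrable_finite_cst.
Qed.

Lemma measurable_dist f c : measurable_fun setT f ->
  measurable_fun setT (fun y => `|f y - c|).
Proof. by move=> mf; apply: measurableT_comp => //; exact: measurable_funB. Qed.

Lemma mu_eball_lty x r : (mu (eball x r) < +oo)%E.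
Proof. by rewrite -ge0_fin_numE// mu_eball_fin. Qed.

Lemma integrable_add D f g : measurable D ->
  mu.-integrable D (EFin \o f) -> mu.-integrable D (EFin \o g) ->
  mu.-integrable D (EFin \o (fun y => f y + g y)).
Proof. by move=> mD fi gi; have := integrableD mD fi gi. Qed.

Lemma integrable_sub D f g : measurable D ->
  mu.-integrable D (EFin \o f) -> mu.-integrable D (EFin \o g) ->
  mu.-integrable D (EFin \o (fun y => f y - g y)).
Proof. by move=> mD fi gi; have := integrableB mD fi gi. Qed.

Lemma integrable_scale D f c : measurable D -> mu.-integrable D (EFin \o f) ->
  mu.-integrable D (EFin \o (fun y => c * f y)).
Proof. by move=> mD fi; have := integrableZl mD c fi. Qed.

Lemma integrable_dist D f c : measurable D -> (mu D < +oo)%E ->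
  mu.-integrable D (EFin \o f) ->
  mu.-integrable D (EFin \o (fun y => `|f y - c|)).
Proof.
move=> mD Dfin fi.
have /integrable_norm : mu.-integrable D (EFin \o (fun y => f y - c)).
  by apply: integrable_sub => //; exact: integrable_finite_cst.
exact.
Qed.

Lemma ge0_Rintegral_le_cst D f c : measurable D -> (mu D < +oo)%E ->
  measurable_fun D f -> (forall y, D y -> 0 <= f y) ->
  {ae mu, forall y, D y -> f y <= c} -> 0 <= c ->
  \int[mu]_(y in D) f y <= c * vol D.
Proof.
move=> mD Dfin mf f0 fc c0; apply: ge0_fine_le; first exact: integral_ge0.
rewrite EFinM /vol fineK ?ge0_fin_numE//.
rewrite -integral_cst//; apply: ae_ge0_le_integral => //.
exact/measurable_EFinP.
Qed.

End ae_tools.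

Section averages.
Context {R : realType} {n : nat}.
Local Notation E := (Rn R n).
Local Notation mu := (@lebesgue_measure_Rn R n).
Implicit Types (x y z : E) (r s c : R) (f g : E -> R).

Let mB x r := @measurable_eball R n x r.
Let fB x r := @mu_eball_lty R n x r.

Lemma avg_cst x r c : 0 < r -> avg (fun=> c) (eball x r) = c.
Proof.
move=> r0; rewrite /avg Rintegral_cst; last exact: mB.
by rewrite mulrCA -/(vol _) mulVf ?mulr1// gt_eqF// vol_gt0.
Qed.

Lemma avg_dist_le x r f c : 0 < r -> mu.-integrable (eball x r) (EFin \o f) ->
  `|avg f (eball x r) - c| <= avg (fun y => `|f y - c|) (eball x r).
Proof.
move=> r0 fi; have ci : mu.-integrable (eball x r) (EFin \o (fun=> c)).
  exact: integrable_finite_cst.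
rewrite -[X in _ - X](avg_cst x c r0) /avg -mulrBr -RintegralB//.
rewrite normrM ger0_norm; last by rewrite invr_ge0 ltW// vol_gt0.
apply: ler_wpM2l; first by rewrite invr_ge0 ltW// vol_gt0.
apply: le_normr_Rintegral => //.
exact: integrable_sub.
Qed.

Lemma avg_le x r f g : 0 < r -> mu.-integrable (eball x r) (EFin \o f) ->
  mu.-integrable (eball x r) (EFin \o g) ->
  (forall y, eball x r y -> f y <= g y) ->
  avg f (eball x r) <= avg g (eball x r).
Proof.
move=> r0 fi gi fg; apply: ler_wpM2l; first by rewrite invr_ge0 ltW// vol_gt0.
exact: le_Rintegral.
Qed.

Lemma avg_osc_le x r f c : 0 < r -> mu.-integrable (eball x r) (EFin \o f) ->
  avg (fun y => `|f y - avg f (eball x r)|) (eball x r) <=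
  2 * avg (fun y => `|f y - c|) (eball x r).
Proof.
move=> r0 fi; pose B := eball x r; set a := avg f _; have mBx : measurable B := mB x r; have fBx : (mu B < +oo)%E := fB x r.
have ac : `|a - c| <= avg (fun y => `|f y - c|) B by exact: avg_dist_le.
have i1 : mu.-integrable B (EFin \o (fun y => `|f y - c|)) by exact: (integrable_dist _ mBx).
have i2 : mu.-integrable B (EFin \o (fun=> `|a - c|)) by exact: integrable_finite_cst.
apply: (@le_trans _ _ (avg (fun y => `|f y - c| + `|a - c|) B)).
  apply: avg_le => //.
  - exact: (integrable_dist _ mBx).
  - exact: integrable_add.
  - by move=> y _; rewrite (distrC a c) ler_distD.
rewrite /avg RintegralD// mulrDr -/(avg _ _).
have -> : (vol B)^-1 * \int[mu]_(y in B) `|a - c| = `|a - c| by exact: avg_cst.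
by rewrite mulr_natl mulr2n lerD2l.
Qed.

Lemma avg_subset_le x y r s f : 0 < r -> 0 < s -> eball x r `<=` eball y s ->
  mu.-integrable (eball y s) (EFin \o f) -> (forall z, 0 <= f z) ->
  avg f (eball x r) <= (2 * n.+1%:R * (s / r)) ^+ n * avg f (eball y s).
Proof.
move=> r0 s0 xy fi f0.
have I : \int[mu]_(z in eball x r) f z <= \int[mu]_(z in eball y s) f z.
  apply: fine_le.
  - by apply: integrable_fin_num => //; exact: integrableS fi.
  - exact: integrable_fin_num.
  - apply: ge0_subset_integral => //.
    + by case/integrableP : fi.
    + by move=> z _; rewrite lee_fin.
rewrite /avg [leRHS]mulrA; apply: (@le_trans _ _ ((vol (eball x r))^-1 *
    \int[mu]_(z in eball y s) f z)).
  by rewrite ler_wpM2l// invr_ge0 ltW// vol_gt0.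
apply: ler_wpM2r; first exact: Rintegral_ge0.
rewrite ler_pdivlMr ?vol_gt0// mulrC ler_pdivrMr ?vol_gt0//.
exact/vol_ratio/ltW.
Qed.

End averages.

(** * Dyadic decompositions and integral inequalities *)

Section dyadic.
Context {R : realType}.

Lemma dyadic_cover (s d : R) : 0 < s -> exists k, d < 2 ^+ k * s.
Proof.
move=> s0; exists (Num.bound (d / s)); rewrite -ltr_pdivrMr//.
exact: upper_nthrootP.
Qed.

(** Any [d >= s > 0] lies in exactly one of the shells between consecutive
    [2 ^+ k * s]; this turns estimates on balls into estimates on complements of
    balls. *)
Lemma dyadic_shell (s d : R) : 0 < s -> s <= d ->
  exists k, 2 ^+ k * s <= d < 2 ^+ k.+1 * s.
Proof.
move=> s0 sd; have ex := dyadic_cover d s0.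
case: (ex_minnP ex) => -[|k] dk kmin; first by rewrite expr0 mul1r ltNge sd in dk.
exists k; rewrite dk andbT leNgt; apply/negP => /kmin.
by rewrite ltnn.
Qed.

Lemma powR_ler (a b c : R) : 0 <= c -> 0 <= a -> a <= b -> a `^ c <= b `^ c.
Proof.
move=> c0 a0 ab; apply: ge0_ler_powR => //; rewrite nnegrE//.
exact: le_trans ab.
Qed.

Lemma powRDp (a b c : R) : 0 < a -> a `^ (b + c) = a `^ b * a `^ c.
Proof. by move=> a0; rewrite powRD// (gt_eqF a0) implybT. Qed.

Lemma powR_exprn (a b : R) k : 0 <= a -> (a ^+ k) `^ b = (a `^ b) ^+ k.
Proof. by move=> a0; rewrite -powR_mulrn// powRAC powR_mulrn// powR_ge0. Qed.

Lemma ler_powRN (a b c : R) : 0 <= c -> 0 < a -> a <= b -> b `^ (- c) <= a `^ (- c).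
Proof.
move=> c0 a0 ab; rewrite !powRN lef_pV2 ?posrE ?powR_gt0//.
  by apply: powR_ler => //; exact: ltW.
exact: lt_le_trans ab.
Qed.

Lemma two_powRN_lt1 (e : R) : 0 < e -> 2 `^ (- e) < 1.
Proof.
move=> e0; rewrite powRN invf_lt1 ?powR_gt0//.
by rewrite -[ltLHS](powRr0 2) /powR pnatr_eq0/= ltr_expR mul0r mulr_gt0// ln_gt0// ltr1n.
Qed.

End dyadic.

Section integral_estimates.
Context {R : realType} {n : nat}.
Local Notation E := (Rn R n).
Local Notation mu := (@lebesgue_measure_Rn R n).
Implicit Types (x y z : E) (r s c p : R) (f g u : E -> R) (A B D : set E).

(** On the [k]-th dyadic shell the integrand is at most [(2 ^+ k * s) `^ (- (n + e))],
    and the shell has volume at most a constant times [(2 ^+ k * s) ^+ n]: the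
    contributions form a geometric series of ratio [2 `^ (- e)]. *)
Lemma tail_integral (e : R) : 0 < e -> exists2 C, 0 < C & forall x s, 0 < s ->
  (\int[mu]_(y in ~` eball x s) (edist x y `^ (- (n%:R + e)))%:E
    <= (C * s `^ (- e))%:E)%E.
Proof.
move=> e0; pose z : R := 2 `^ (- e).
have z0 : 0 < z by rewrite powR_gt0.
have z1 : z < 1 by exact: two_powRN_lt1.
exists (4 ^+ n * (1 - z)^-1).
  by rewrite mulr_gt0 ?exprn_gt0// invr_gt0 subr_gt0.
move=> x s s0; have ne0 : 0 <= n%:R + e by rewrite addr_ge0// ltW.
pose a k : R := 2 ^+ k * s.
have a0 k : 0 < a k by rewrite mulr_gt0// exprn_gt0.
pose g k y : R := a k `^ (- (n%:R + e)) * \1_(eball x (a k.+1)) y.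
have g0 k y : (0 <= (g k y)%:E)%E by rewrite lee_fin mulr_ge0 ?powR_ge0.
have mg k : measurable_fun setT (fun y => (g k y)%:E).
  apply/measurable_EFinP; apply: measurable_funM => //.
  by apply: measurable_indic; exact: measurable_eball.
have mD : measurable (~` eball x s) by apply: measurableC; exact: measurable_eball.
apply: (@le_trans _ _ (\int[mu]_(y in ~` eball x s) \sum_(k <oo) (g k y)%:E)%E).
  apply: ge0_le_integral => //.
  - by move=> y _; rewrite lee_fin powR_ge0.
  - apply/measurable_EFinP; apply: measurable_funTS.
    apply: (measurableT_comp (measurable_powR _)).
    exact: measurable_edist.
  - by apply: ge0_emeasurable_sum => // k _; exact: measurable_funTS.
  - move=> y; rewrite /setC/= /eball/= => /negP; rewrite -leNgt => sy.
    have [k /andP[k1 k2]] := dyadic_shell s0 sy.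
    apply: (@le_trans _ _ (g k y)%:E); last first.
      apply: (le_trans _ (nneseries_lim_ge k.+1 _)) => //.
      by rewrite big_nat_recr//= leeDr// sume_ge0.
    rewrite lee_fin /g indicE mem_set ?mulr1//.
    exact: ler_powRN.
rewrite integral_nneseries//; last by move=> k; exact: measurable_funTS.
apply: lime_le.
  by apply: is_cvg_nneseries => k _ _; exact: integral_ge0.
apply: nearW => N.
apply: (@le_trans _ _ (\sum_(0 <= k < N) (4 ^+ n * s `^ (- e) * z ^+ k)%:E)%E).
  apply: lee_sum => k _.
  apply: (@le_trans _ _ (\int[mu]_y (g k y)%:E)%E).
    exact: ge0_subset_integral.
  rewrite /g; under eq_integral do rewrite EFinM.
  rewrite ge0_integralZl_EFin//; last 2 first.
  - by apply/measurable_EFinP/measurable_indic; exact: measurable_eball.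
  - by rewrite powR_ge0.
  rewrite integral_indic//; last exact: measurable_eball.
  rewrite setIT; apply: (@le_trans _ _ ((a k `^ (- (n%:R + e)))%:E * ((2 * a k.+1) ^+ n)%:E)%E).
    by rewrite lee_wpmul2l ?lee_fin ?powR_ge0// mu_eball_le// ltW.
  rewrite -EFinM lee_fin opprD powRDp//.
  rewrite (_ : 2 * a k.+1 = 4 * a k); last by rewrite /a exprS; ring.
  have -> : a k `^ (- n%:R) = (a k ^+ n)^-1 by rewrite powRN powR_mulrn// ltW.
  have -> : a k `^ (- e) = z ^+ k * s `^ (- e).
    by rewrite powRM ?exprn_ge0 ?ltW// powR_exprn.
  rewrite (exprMn n 4%:R (a k)); apply: le_of_eq; field.
  by rewrite expf_neq0// gt_eqF.
rewrite sumEFin lee_fin.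
rewrite (mulrAC (4 ^+ n)); apply: (@geometric_le_lim R N (4 ^+ n * s `^ (- e)) z) => //.
  by rewrite mulr_ge0 ?exprn_ge0 ?powR_ge0.
by rewrite ger0_norm// ltW.
Qed.

(** Hoelder's inequality against the indicator of [A]. *)
Lemma hoelder_set A u p : measurable A -> measurable_fun setT u -> 1 < p ->
  (\int[mu]_(y in A) `|u y|%:E <=
   mu A `^ (1 - p^-1) * (\int[mu]_(y in A) (`|u y| `^ p)%:E) `^ p^-1)%E.
Proof.
move=> mA mui p1; have p0 : 0 < p by exact: lt_trans p1.
pose q := (1 - p^-1)^-1.
have q0 : 0 < q by rewrite invr_gt0 subr_gt0 invf_lt1.
have m1 : measurable_fun setT (\1_A : E -> R) by exact: measurable_indic.
have := @hoelder _ _ _ mu (u \* \1_A) (\1_A) p q (measurable_funM mui m1) m1 p0 q0.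
rewrite {1}/q invrK addrC subrK => /(_ erefl).
rewrite Lnorm1 muleC => h.
rewrite integral_mkcond; apply: le_trans (le_trans _ h) _.
  apply: le_of_eq; apply: eq_integral => y _.
  rewrite patchE /= indicE; case: ifPn => _; first by rewrite !mulr1.
  by rewrite !mulr0 normr0.
rewrite unlock /q !invrK.
apply: le_of_eq; congr (poweR _ _ * poweR _ _)%E.
  have -> : mu A = (\int[mu]_y (\1_A y)%:E)%E by rewrite integral_indic// setIT.
  apply: eq_integral => y _ /=.
  rewrite indicE; case: (y \in A); first by rewrite normr1 powR1.
  by rewrite normr0 powR0// invr_neq0// gt_eqF// subr_gt0 invf_lt1.
rewrite [RHS]integral_mkcond; apply: eq_integral => y _.
rewrite patchE /= indicE; case: ifPn => _; first by rewrite mulr1.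
by rewrite mulr0 normr0 powR0// gt_eqF.
Qed.

Lemma Lnorm_bounded_le p g M x r : 0 < p -> 0 <= M -> measurable_fun setT g ->
  {ae mu, forall y, `|g y| <= M} -> (forall y, ~ eball x r y -> g y = 0) ->
  ('N[mu]_p%:E[EFin \o g] <= (M * vol (eball x r) `^ p^-1)%:E)%E.
Proof.
move=> p0 M0 mg gM g0; rewrite unlock.
have mB := @measurable_eball R n x r.
have mgp : measurable_fun setT (fun y => (`|g y| `^ p)%:E).
  apply/measurable_EFinP; apply: (measurableT_comp (measurable_powR _)).
  exact: measurableT_comp.
have I0 : (\int[mu]_y (`|(EFin \o g) y| `^ p) <= (M `^ p * vol (eball x r))%:E)%E.
  apply: (@le_trans _ _ (\int[mu]_y (M `^ p * \1_(eball x r) y)%:E)%E).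
    apply: ae_ge0_le_integral => //.
    - by move=> y _; rewrite poweR_ge0.
    - by move=> y _; rewrite lee_fin mulr_ge0// powR_ge0.
    - by apply/measurable_EFinP; apply: measurable_funM.
    - apply: filterS gM => y gM _ /=; rewrite lee_fin indicE.
      have [yB|yB] := boolP (y \in eball x r).
        by rewrite mulr1; apply: powR_ler => //; exact: ltW.
      rewrite g0 ?normr0 ?powR0 ?gt_eqF//; last by move=> yB'; rewrite mem_set in yB.
      by rewrite mulr0.
  under eq_integral do rewrite EFinM.
  rewrite ge0_integralZl_EFin ?powR_ge0//; last by apply/measurable_EFinP.
  by rewrite integral_indic// setIT EFinM -volE.
apply: (@le_trans _ _ ((M `^ p * vol (eball x r))%:E `^ p^-1)%E).
  apply: gt0_ler_poweR => //; first by rewrite invr_ge0 ltW.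
  - by rewrite in_itv/= leey andbT integral_ge0// => y _; rewrite poweR_ge0.
  - by rewrite in_itv/= leey andbT lee_fin mulr_ge0 ?powR_ge0// fine_ge0.
rewrite poweR_EFin powRM ?powR_ge0 ?fine_ge0// -powRrM mulfV ?gt_eqF// powRr1//.
Qed.

End integral_estimates.

(** * Growth of the potential under a reverse Hoelder inequality *)

Section potential.
Context {R : realType} {n : nat}.
Local Notation E := (Rn R n).
Local Notation mu := (@lebesgue_measure_Rn R n).
Variables (V : E -> R) (q : R).
Hypotheses (V_ge0 : forall x, 0 <= V x) (V_loc : loc_integrable V).
Hypotheses (n_ge3 : (3 <= n)%N) (q_ge : n%:R / 2 <= q) (V_RH : reverse_hoelder q V).
Implicit Types (x y z : E) (r s t c : R) (A B D : set E).

Let n_gt0 : (0 < n)%N. Proof. exact: leq_trans n_ge3. Qed.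
Let q_gt1 : 1 < q.
Proof.
apply: lt_le_trans q_ge; rewrite ltr_pdivlMr// mul1r.
by rewrite ltr_nat.
Qed.
Let q_gt0 : 0 < q. Proof. exact: lt_trans q_gt1. Qed.
Let mV : measurable_fun setT V. Proof. by case: V_loc. Qed.
Let mVq : measurable_fun setT (fun y => (V y `^ q)%:E).
Proof.
by apply/measurable_EFinP; apply: (measurableT_comp (measurable_powR _)).
Qed.
Let mB x r := @measurable_eball R n x r.
Let theta := 1 - q^-1.
Let theta_gt0 : 0 < theta. Proof. by rewrite subr_gt0 invf_lt1. Qed.

Definition mass D : R := \int[mu]_(y in D) V y.
Definition qmass D : R := \int[mu]_(y in D) (V y `^ q).

Lemma mass_ge0 D : 0 <= mass D.
Proof. exact: Rintegral_ge0. Qed.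

Lemma qmass_ge0 D : 0 <= qmass D.
Proof. by apply: Rintegral_ge0 => y _; exact: powR_ge0. Qed.

Lemma qmass_lty x r : 0 < r -> (\int[mu]_(y in eball x r) (V y `^ q)%:E < +oo)%E.
Proof.
move=> r0; have [C RH] := V_RH; have := RH x r r0.
move=> /le_lt_trans /(_ (ltry _)) /lty_poweRy.
rewrite invr_neq0 ?gt_eqF// => /(_ isT) h.
rewrite ltNge; apply/negP; rewrite leye_eq => /eqP I.
move: h; rewrite I mulry gtr0_sg ?mul1e//.
by rewrite invr_gt0 vol_gt0.
Qed.

Lemma integrable_Vq x r : 0 < r ->
  mu.-integrable (eball x r) (EFin \o (fun y => V y `^ q)).
Proof.
move=> r0; apply/integrableP; split; first exact: measurable_funTS.
under eq_integral do rewrite /= ger0_norm ?powR_ge0//.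
exact: qmass_lty.
Qed.

(** With [theta = 1 - 1 / q], Hoelder bounds the mass of [V] by its [L^q] norm, on
    any bounded set; the reverse Hoelder hypothesis gives the converse inequality on balls. *)
Lemma mass_hoelder D x r : measurable D -> D `<=` eball x r -> 0 < r ->
  mass D <= vol D `^ theta * qmass D `^ q^-1.
Proof.
move=> mD Dx r0; have := hoelder_set mD mV q_gt1.
have E1 : (\int[mu]_(y in D) `|V y|%:E = \int[mu]_(y in D) (V y)%:E)%E.
  by apply: eq_integral => y _; rewrite ger0_norm.
have E2 : (\int[mu]_(y in D) (`|V y| `^ q)%:E = (qmass D)%:E)%E.
  rewrite /qmass /Rintegral fineK; last first.
    by apply: integrable_fin_num => //; by apply: integrableS (integrable_Vq x r0).
  by apply: eq_integral => y _; rewrite ger0_norm.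
have E3 : (mu D = (vol D)%:E)%E.
  rewrite /vol fineK// ge0_fin_numE//; apply: le_lt_trans (mu_eball_lty x r).
  by apply: le_measure => //; rewrite inE.
rewrite E1 E2 E3 !poweR_EFin -EFinM => h.
by apply: ge0_fine_le h; apply: integral_ge0 => y _; rewrite lee_fin.
Qed.

Lemma mass_reverse_hoelder : exists2 C, 1 <= C & forall x r, 0 < r ->
  vol (eball x r) `^ theta * qmass (eball x r) `^ q^-1 <= C * mass (eball x r).
Proof.
have [C0 RH] := V_RH; exists (Num.max C0 1); first by rewrite le_max lexx orbT.
move=> x r r0; have := RH x r r0; set v := vol _; set B := eball x r.
have v0 : 0 < v by exact: vol_gt0.
have -> : (\int[mu]_(y in B) (V y `^ q)%:E = (qmass B)%:E)%E.
  rewrite /qmass /Rintegral fineK//.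
  by have := integrable_fin_num (mB x r) (integrable_Vq x r0).
rewrite -EFinM poweR_EFin lee_fin powRM ?qmass_ge0 ?invr_ge0 ?(ltW v0)// => h.
have -> : v `^ theta = v * v^-1 `^ q^-1.
  by rewrite /theta powRDp// powRr1 ?ltW// -(powR_inv1 (ltW v0)) -powRrM mulN1r.
rewrite -mulrA; apply: le_trans (ler_wpM2l (ltW v0) h) _.
rewrite /avg -/v -/(mass B) (_ : v * _ = C0 * mass B); last first.
  by field; rewrite gt_eqF.
by apply: ler_wpM2r; rewrite ?mass_ge0// le_max lexx.
Qed.

Lemma qmass_le D D' x r : measurable D -> measurable D' -> D `<=` D' ->
  D' `<=` eball x r -> 0 < r -> qmass D <= qmass D'.
Proof.
move=> mD mD' DD' D'x r0; have iD' := integrableS (mB x r) mD' D'x (integrable_Vq x r0).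
apply: fine_le.
- by apply: integrable_fin_num => //; exact: integrableS iD'.
- exact: integrable_fin_num.
- apply: ge0_subset_integral => //; first exact: measurable_funTS.
  by move=> y _; rewrite lee_fin powR_ge0.
Qed.

(** Hole filling. Let [B] be a ball and [B'] its dilation by [A]. Hoelder splits the
    mass of [B'] into a part bounded by [vol B `^ theta] times the norm on [B'], and a
    part bounded by [vol B' `^ theta] times the norm on the shell. The
    reverse inequality bounds the norm on [B'] by this mass over [vol B' `^ theta]; for
    [A] large the first part is absorbed, and the norm on [B'] is controlled by the norm
    on the shell, that is, a fixed fraction of the integral of [V `^ q] over [B'] lies
    outside [B]. No room is lost in the exponent, so that [q = n / 2] is allowed. *)
Lemma qmass_hole : exists A : R, exists2 k : R, 1 <= A /\ 0 < k < 1 &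
  forall x r, 0 < r -> qmass (eball x r) <= k * qmass (eball x (A * r)).
Proof.
have [C C1 RH] := mass_reverse_hoelder.
have C0 : 0 < C by exact: lt_le_trans C1.
pose N : R := n.+1%:R.
(* chosen so that (vol B / vol B') `^ theta <= (2 * C)^-1, see vr below *)
pose A := 2 * N * (2 * C) `^ (n%:R * theta)^-1.
have N1 : 1 <= N by rewrite ler1n.
have C2 : 1 <= 2 * C by lra.
have nt0 : 0 < n%:R * theta by rewrite mulr_gt0// ltr0n.
have P1 : 1 <= (2 * C) `^ (n%:R * theta)^-1.
  rewrite -[leLHS](powRr0 (2 * C)); apply: ler_powR => //.
  by rewrite invr_ge0 ltW.
have A1 : 1 <= A by rewrite /A; nra.
have A0 : 0 < A by exact: lt_le_trans A1.
pose e := (2 * C) `^ (- q).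
have e0 : 0 < e by rewrite powR_gt0//; lra.
have e1 : e < 1.
  rewrite /e powRN invf_lt1 ?powR_gt0//; last lra.
  have : 1 `^ q < (2 * C) `^ q by apply: gt0_ltr_powR; rewrite ?nnegrE//; lra.
  by rewrite powR1.
exists A, (1 - e); first by split => //; apply/andP; split; lra.
move=> x r r0; have Ar0 : 0 < A * r by rewrite mulr_gt0.
set B := eball x r; set B' := eball x (A * r).
have BB' : B `<=` B' by apply: eball_le; rewrite ler_peMl// ltW.
have mD : measurable (B' `\` B) by apply: measurableD; exact: mB.
have iB' : mu.-integrable B' (EFin \o (fun y => V y `^ q)) by exact: integrable_Vq.
have iVB' : mu.-integrable B' (EFin \o V) by case: V_loc => _; exact.
have disj : [disjoint B & B' `\` B].
  by apply/disj_setPS => y [By [_]].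
have qsplit : qmass B' = qmass B + qmass (B' `\` B).
  rewrite /qmass -Rintegral_setU ?setDUK//; exact: mB.
have vsplit : mass B' = mass B + mass (B' `\` B).
  rewrite /mass -Rintegral_setU ?setDUK//; exact: mB.
have v0 : 0 < vol B by exact: vol_gt0.
have v'0 : 0 < vol B' by exact: vol_gt0.
have vD : vol (B' `\` B) <= vol B'.
  apply: fine_le; [|exact: mu_eball_fin|].
    rewrite ge0_fin_numE//; apply: le_lt_trans (mu_eball_lty x (A * r)).
    by apply: le_measure; rewrite ?inE//; exact: mB.
  by apply: le_measure; rewrite ?inE//; exact: mB.
have q0 := qmass_ge0; have i0 : 0 <= q^-1 by rewrite invr_ge0 ltW.
have h1 : mass B <= vol B `^ theta * qmass B' `^ q^-1.
  apply: le_trans (mass_hoelder (mB x r) (@subset_refl _ _) r0) _.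
  apply: ler_wpM2l; first exact: powR_ge0.
  apply: powR_ler; [exact: i0|exact: q0|].
  by rewrite qsplit lerDl q0.
have h2 : mass (B' `\` B) <= vol B' `^ theta * qmass (B' `\` B) `^ q^-1.
  apply: le_trans (mass_hoelder mD (@subDsetl _ _ _) Ar0) _.
  apply: ler_wpM2r; first exact: powR_ge0.
  by apply: powR_ler; [exact: ltW|exact: fine_ge0|exact: vD].
have h3 := RH x (A * r) Ar0.
set w' := qmass B' `^ q^-1 in h1 h3 *.
have vr : vol B `^ theta <= (2 * C)^-1 * vol B' `^ theta.
  have := @vol_ratio R n x x (A * r) r Ar0 (ltW r0).
  rewrite -/B -/B' => /(powR_ler (ltW theta_gt0) (ltW v0)) /le_trans; apply.
  rewrite -/N (_ : 2 * N * _ = (2 * C) `^ (- (n%:R * theta)^-1)); last first.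
    rewrite powRN /A; field.
    by rewrite !gt_eqF//= ?powR_gt0//; lra.
  rewrite powRM ?exprn_ge0 ?powR_ge0 ?fine_ge0// -powR_mulrn ?powR_ge0// -!powRrM.
  rewrite [X in _ `^ X * _](_ : _ = -1); last first.
    by field; rewrite !gt_eqF// ltr0n.
  by rewrite powR_inv1//; lra.
have h4 : w' <= 2 * C * qmass (B' `\` B) `^ q^-1.
  have vt0 : 0 < vol B' `^ theta by rewrite powR_gt0.
  set vt := vol B' `^ theta in vt0 h2 h3 vr *.
  set d := qmass (B' `\` B) `^ q^-1 in h2 *.
  have w0 : 0 <= w' by exact: powR_ge0.
  rewrite -(ler_pM2l vt0).
  have h5 : mass B' <= (2 * C)^-1 * vt * w' + vt * d.
    rewrite vsplit; apply: lerD; last exact: h2.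
    by apply: le_trans h1 _; apply: ler_wpM2r; [exact: w0|exact: vr].
  have : C * mass B' <= C * ((2 * C)^-1 * vt * w' + vt * d) by rewrite ler_pM2l.
  have -> : C * ((2 * C)^-1 * vt * w' + vt * d) = vt * w' / 2 + C * (vt * d).
    by field; rewrite gt_eqF.
  lra.
move: (q0 B') (q0 (B' `\` B)) qsplit h4; rewrite /w'.
move: (qmass B) (qmass B') (qmass (B' `\` B)) => b b' d b'0 d0 b'E h4.
have h5 : b' <= (2 * C) `^ q * d.
  have := powR_ler (ltW q_gt0) (powR_ge0 _ _) h4.
  rewrite powRM ?powR_ge0//; last lra.
  by rewrite -!powRrM mulVf ?gt_eqF// !powRr1.
have : e * b' <= d.
  rewrite /e powRN mulrC ler_pdivrMr ?powR_gt0//; last lra.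
  by rewrite mulrC.
by rewrite b'E; lra.
Qed.

(** Up to constants, [psi x r] is [r `^ (2 - n / q)] times the [L^q] norm of [V] on the
    ball, by [mass_hoelder] and [mass_reverse_hoelder]; the power is nonnegative because
    [q >= n / 2], so that [psi] inherits the growth of the norm. It is compared with 1 in
    the definition of the critical radius. *)
Definition psi x r : R := (r ^+ (n - 2)%N)^-1 * mass (eball x r).

(** This is [2 - n / q]. *)
Let sigma := n%:R * theta - (n - 2)%:R.

Let sigma_ge0 : 0 <= sigma.
Proof.
rewrite /sigma /theta natrB; last exact: ltnW.
suff : n%:R / q <= 2 by rewrite mulrBr; lra.
by rewrite ler_pdivrMr// mulrC -ler_pdivrMr.
Qed.

Lemma psi_qmass : exists l, exists2 U, 0 < l /\ 0 < U & forall x r, 0 < r ->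
  l * (r `^ sigma * qmass (eball x r) `^ q^-1) <= psi x r <=
  U * (r `^ sigma * qmass (eball x r) `^ q^-1).
Proof.
have [C C1 RH] := mass_reverse_hoelder.
have C0 : 0 < C by exact: lt_le_trans C1.
have N0 : (0 : R) < n.+1%:R by rewrite ltr0n.
exists (C^-1 * (n.+1%:R^-1 `^ (n%:R * theta))), (2 `^ (n%:R * theta)).
  by rewrite mulr_gt0 ?powR_gt0 ?invr_gt0.
move=> x r r0; set B := eball x r; set w := qmass B `^ q^-1.
have w0 : 0 <= w by exact: powR_ge0.
have rn0 : 0 < r ^+ (n - 2)%N by rewrite exprn_gt0.
have rE : r `^ (n%:R * theta) = r ^+ (n - 2)%N * r `^ sigma.
  by rewrite -powR_mulrn ?ltW// -powRDp// /sigma addrC subrK.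
have pE (a : R) : 0 <= a -> (a ^+ n) `^ theta = a `^ (n%:R * theta).
  by move=> a0; rewrite -powR_mulrn// -powRrM.
have v0 := vol_gt0 x r0; rewrite /psi ler_pdivlMl// ler_pdivrMl//; apply/andP; split.
  have : vol B `^ theta * w <= C * mass B by exact: RH.
  rewrite -ler_pdivrMl//; apply: le_trans.
  rewrite -!mulrA mulrCA ler_pM2l ?invr_gt0// !mulrA ler_wpM2r//.
  have := powR_ler (ltW theta_gt0) _ (vol_ge x r0).
  rewrite exprn_ge0; last by rewrite divr_ge0// ltW.
  move=> /(_ isT); apply: le_trans.
  rewrite pE; last by rewrite divr_ge0// ltW.
  rewrite powRM ?invr_ge0 ?(ltW r0) ?(ltW N0)// rE.
  by apply: le_of_eq; ring.
apply: le_trans (mass_hoelder (mB x r) (@subset_refl _ _) r0) _.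
rewrite -/w !mulrA ler_wpM2r//.
have := powR_ler (ltW theta_gt0) (ltW v0) (vol_le x (ltW r0)).
move=> /le_trans; apply; rewrite pE; last by rewrite mulr_ge0// ltW.
rewrite powRM ?(ltW r0)// rE.
by apply: le_of_eq; ring.
Qed.

(** Iterating [qmass_hole]: each dilation by [A] multiplies the [L^q] norm by at least
    [tau^-1 > 1], and the comparison of [psi_qmass] costs only a fixed factor. *)
Lemma psi_growth (M : R) : exists2 L : R, 1 <= L & forall x r t, 0 < r -> L * r <= t ->
  M * psi x r <= psi x t.
Proof.
have [l [U [l0 U0] psiE]] := psi_qmass.
have [A [k [A1 /andP[k0 k1]] hole]] := qmass_hole.
have A0 : 0 < A by exact: lt_le_trans A1.
have iter x r j : 0 < r -> qmass (eball x r) <= k ^+ j * qmass (eball x (A ^+ j * r)).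
  move=> r0; elim: j => [|j IH]; first by rewrite !expr0 !mul1r.
  apply: le_trans IH _; rewrite exprSr -mulrA ler_pM2l ?exprn_gt0//.
  rewrite exprS -mulrA; apply: hole.
  by rewrite mulr_gt0// exprn_gt0.
have i0 : 0 < q^-1 by rewrite invr_gt0.
pose tau := k `^ q^-1.
have tau0 : 0 < tau by rewrite powR_gt0.
have tau1 : tau < 1.
  have : k `^ q^-1 < 1 `^ q^-1 by apply: gt0_ltr_powR; rewrite ?nnegrE//; lra.
  by rewrite powR1.
have [j jP] : exists j, tau ^+ j * (`|M| * U) <= l.
  have : geometric 1 tau @ \oo --> 0 by apply: cvg_geometric; rewrite gtr0_norm.
  pose e := l / (`|M| * U + 1).
  have MU0 : 0 <= `|M| * U by rewrite mulr_ge0// ltW.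
  have e0 : 0 < e by rewrite divr_gt0// ltr_wpDl.
  move=> /cvgr0Pnorm_lt /(_ e e0)[j _ /(_ j (leqnn _))] /=.
  rewrite mul1r gtr0_norm ?exprn_gt0// /e ltr_pdivlMr ?ltr_wpDl// => h.
  exists j; apply: le_trans (ltW h); rewrite ler_pM2l ?exprn_gt0//.
  by rewrite lerDl.
exists (A ^+ j); first exact: exprn_ege1.
move=> x r t r0 rt.
have t0 : 0 < t by apply: lt_le_trans rt; rewrite mulr_gt0// exprn_gt0.
have rt' : r <= t by apply: le_trans rt; apply: ler_peMl (ltW r0) (exprn_ege1 j A1).
have /andP[_ psir] := psiE x r r0.
have /andP[psit _] := psiE x t t0.
have psi0 : 0 <= psi x r by rewrite mulr_ge0 ?mass_ge0// invr_ge0 exprn_ge0// ltW.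
have : qmass (eball x r) `^ q^-1 <= tau ^+ j * qmass (eball x t) `^ q^-1.
  rewrite /tau -powR_exprn ?(ltW k0)// -powRM ?exprn_ge0 ?qmass_ge0 ?(ltW k0)//.
  apply: powR_ler; rewrite ?(ltW i0) ?qmass_ge0//.
  apply: le_trans (iter x r j r0) _; rewrite ler_pM2l ?exprn_gt0//.
  by apply: (qmass_le (mB _ _) (mB _ _) _ (@subset_refl _ _) t0); exact: eball_le.
have ss : r `^ sigma <= t `^ sigma by apply: powR_ler => //; exact: ltW.
have s0 : 0 <= r `^ sigma by exact: powR_ge0.
have := powR_ge0 (qmass (eball x r)) q^-1.
have := powR_ge0 (qmass (eball x t)) q^-1.
move: (psi x r) (psi x t) psi0 psir psit => p p'.
move: (_ `^ q^-1) (_ `^ q^-1) => w' w p0 pw pw' w'0 w0 ww.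
move: (r `^ _) (t `^ _) s0 ss pw pw' => rs ts s0 ss pw pw'.
apply: le_trans pw'; apply: (@le_trans _ _ (`|M| * p)).
  by rewrite ler_wpM2r// ler_norm.
apply: (le_trans (ler_wpM2l (normr_ge0 M) pw)).
apply: (@le_trans _ _ (`|M| * (U * (ts * (tau ^+ j * w'))))).
  apply: ler_wpM2l => //; apply: ler_wpM2l; first exact: ltW.
  exact: ler_pM.
rewrite [leLHS](_ : _ = tau ^+ j * (`|M| * U) * (ts * w')); last by ring.
by apply: (ler_wpM2r _ jP); apply: mulr_ge0 w'0; exact: le_trans ss.
Qed.

End potential.

(** * The critical radius *)

Lemma half_radius (R : realFieldType) (L r t : R) : 1 <= L -> 0 < r -> 4 * L * r < t ->
  r <= t - t / 2 /\ L * (2 * r) <= t / 2.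
Proof.
move=> L1 r0 rt; have Lr : r <= L * r by rewrite ler_peMl// ltW.
by split; lra.
Qed.

Section critical_radius.
Context {R : realType} {n : nat}.
Local Notation E := (Rn R n).
Local Notation mu := (@lebesgue_measure_Rn R n).
Variables (V : E -> R) (q : R).
Hypotheses (V_ge0 : forall x, 0 <= V x) (V_loc : loc_integrable V).
Hypothesis V_neq0 : ~ {ae mu, forall x, V x = 0}.
Hypotheses (n_ge3 : (3 <= n)%N) (q_ge : n%:R / 2 <= q) (V_RH : reverse_hoelder q V).
Implicit Types (x y z : E) (r s t c : R).
Local Notation rho := (critical_radius V).

Let psi_growth := psi_growth V_ge0 V_loc n_ge3 q_ge V_RH.

Lemma psi_ge0 x r : 0 < r -> 0 <= psi V x r.
Proof. by move=> r0; rewrite mulr_ge0 ?mass_ge0// invr_ge0 exprn_ge0// ltW. Qed.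

Lemma mass_mono x y r s : eball x r `<=` eball y s -> 0 < s ->
  mass V (eball x r) <= mass V (eball y s).
Proof.
move=> xy s0; have iV : mu.-integrable (eball y s) (EFin \o V) by case: V_loc => _; exact.
have [mx my] := (@measurable_eball R n x r, @measurable_eball R n y s).
apply: fine_le.
- by apply: integrable_fin_num => //; exact: integrableS iV.
- exact: integrable_fin_num.
- apply: ge0_subset_integral => //; last by move=> z _; rewrite lee_fin.
  by case/integrableP : iV.
Qed.

Lemma psi_mono x y r s : eball x r `<=` eball y s -> 0 < r -> 0 < s ->
  psi V x r <= (s / r) ^+ (n - 2)%N * psi V y s.
Proof.
move=> xy r0 s0; rewrite /psi expr_div_n.
rewrite [leRHS](_ : _ = (r ^+ (n - 2)%N)^-1 * mass V (eball y s)); last first.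
  by field; rewrite !expf_neq0 ?gt_eqF.
by rewrite ler_wpM2l ?mass_mono// invr_ge0 exprn_ge0// ltW.
Qed.

(** Otherwise [V] would vanish a.e. on every ball centred at [x]. *)
Lemma psi_gt0 x : exists2 r, 0 < r & 0 < psi V x r.
Proof.
apply: contrapT => /forall2NP h; apply: V_neq0.
have /ae_foralln : forall k : nat, {ae mu, forall y, eball x k.+1%:R y -> V y = 0}.
  move=> k; have [//|] := h k.+1%:R => psi0.
  have k0 : (0 : R) < k.+1%:R by [].
  have iV : mu.-integrable (eball x k.+1%:R) (EFin \o V) by case: V_loc => _; exact.
  have mB := @measurable_eball R n x k.+1%:R.
  have m0 : mass V (eball x k.+1%:R) = 0.
    apply/eqP; rewrite eq_le mass_ge0// andbT leNgt; apply/negP => mgt0.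
    by apply: psi0; rewrite mulr_gt0// invr_gt0 exprn_gt0.
  have /(ae_eq_integral_abs mu mB) : measurable_fun (eball x k.+1%:R) (EFin \o V).
    by case/integrableP : iV.
  have I0 : (\int[mu]_(y in eball x k.+1%:R) `|(EFin \o V) y|)%E = 0%E.
    transitivity (\int[mu]_(y in eball x k.+1%:R) (V y)%:E)%E.
      by apply: eq_integral => y _ /=; rewrite ger0_norm.
    by rewrite -[LHS]fineK ?(integrable_fin_num mB iV)// -[fine _]/(mass V _) m0.
  by move=> /iffLR /(_ I0); apply: filterS => y /= + By => /(_ By)[].
apply: filterS => y hy; have [k xy] := dyadic_cover (edist x y) (ltr01 : 0 < (1 : R)).
apply: (hy (2 ^ k)%N); rewrite /eball/=; apply: lt_le_trans xy _.
by rewrite mulr1 -natrX ler_nat.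
Qed.

Let S x := [set r : R | 0 < r /\ psi V x r <= 1].

Lemma critical_radiusE x : rho x = sup (S x).
Proof. by []. Qed.

Lemma S_has_sup x : has_sup (S x).
Proof.
split.
  pose p := psi V x 1; have p0 : 0 <= p by exact: psi_ge0.
  have [L L1 gr] := psi_growth (p + 1).
  have L0 : 0 < L by exact: lt_le_trans L1.
  exists L^-1; split; first by rewrite invr_gt0.
  have := gr x L^-1 1; rewrite invr_gt0 mulfV ?gt_eqF// => /(_ L0 (lexx _)).
  rewrite -/p; have [pl|pl] := leP (psi V x L^-1) 1 => //; nra.
have [r r0 psir] := psi_gt0 x.
have [L L1 gr] := psi_growth (2 / psi V x r).
exists (L * r) => t [t0 psit]; rewrite leNgt; apply/negP => /ltW /(gr x r t r0).
by rewrite divfK ?gt_eqF//; lra.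
Qed.

Lemma critical_radius_gt0 x : 0 < rho x.
Proof.
have [[r rS] ub] := S_has_sup x.
rewrite critical_radiusE; have [r0 _] := rS.
exact: lt_le_trans r0 (ub_le_sup ub rS).
Qed.

Lemma psi_gt1 x t : rho x < t -> 1 < psi V x t.
Proof.
move=> xt; rewrite ltNge; apply/negP => psit.
have tS : S x t by split=> //; exact: lt_trans (critical_radius_gt0 x) xt.
have := ub_le_sup (S_has_sup x).2 tS.
by rewrite -critical_radiusE leNgt xt.
Qed.

(** If the critical radius at [x] were much larger than [r], then [psi x t <= 1] for some
    [t] much larger than [r]. The ball of radius [t / 2] about [x0] lies in the ball of
    radius [t] about [x], so [psi x0 (t / 2)] would be bounded by a power of 2, although
    [psi x0 (2 * r) > 1] and [psi x0] grows. *)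
Lemma critical_radius_compare : exists2 C : R, 1 <= C & forall x0 x r,
  rho x0 <= r -> edist x x0 <= r -> rho x <= C * r.
Proof.
have [L L1 gr] := psi_growth (2 ^+ (n - 2)).
exists (4 * L); first by rewrite mulr_ege1// ler1n.
move=> x0 x r x0r xx0; rewrite leNgt; apply/negP => xr.
have r0 : 0 < r := lt_le_trans (critical_radius_gt0 x0) x0r.
have [t [t0 psit] rt] := sup_gt (S_has_sup x).1 xr.
have t20 : 0 < t / 2 by rewrite divr_gt0.
have [rt2 Lt] := half_radius L1 r0 rt.
have h1 : psi V x0 (t / 2) <= (t / (t / 2)) ^+ (n - 2)%N * psi V x t.
  apply: (psi_mono _ t20 t0).
  by apply: eballS; rewrite -lerBrDr; apply: (le_trans xx0 rt2).
have r20 : 0 < 2 * r by rewrite mulr_gt0.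
have h2 : 1 < psi V x0 (2 * r).
  by apply: psi_gt1; apply: le_lt_trans x0r _; rewrite ltr_pMl// ltr1n.
have h3 := gr x0 (2 * r) (t / 2) r20 Lt.
have t2E : t / (t / 2) = 2 by field; rewrite gt_eqF.
have := le_trans h3 h1; rewrite t2E ler_pM2l ?exprn_gt0// => h.
by have := lt_le_trans h2 (le_trans h psit); rewrite ltxx.
Qed.

End critical_radius.

(** * Pointwise bounds from mean oscillation bounds *)

Lemma triangle_arith (R : realDomainType) (a b u v t C2 C3 : R) :
  (1 + (C2 + C3)) * t < `|a - b| -> `|u - v| <= C2 * t -> `|b - v| <= C3 * t ->
  t < `|a - u|.
Proof.
move=> h1 h2 h3; have : `|a - b| <= `|a - u| + `|u - v| + `|v - b|.
  by rewrite -addrA (le_trans (ler_distD u _ _))// lerD2l ler_distD.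
rewrite (distrC v b); lra.
Qed.

Section campanato.
Context {R : realType} {n : nat}.
Local Notation E := (Rn R n).
Local Notation mu := (@lebesgue_measure_Rn R n).
Implicit Types (x y z : E) (r s t c M : R) (f g : E -> R) (A B D : set E).

(** Mean oscillation bounded by a power of the radius, rather than of the volume. *)
Definition osc_bound (alpha : R) f M := forall x r, 0 < r ->
  avg (fun y => `|f y - avg f (eball x r)|) (eball x r) <= M * r `^ alpha.

Let N : R := n.+1%:R.
Let N1 : 1 <= N. Proof. by rewrite ler1n. Qed.

Lemma avg_close (alpha M : R) f x y r s : loc_integrable f -> osc_bound alpha f M ->
  0 < r -> 0 < s -> eball x r `<=` eball y s ->
  `|avg f (eball x r) - avg f (eball y s)| <= (2 * N * (s / r)) ^+ n * (M * s `^ alpha).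
Proof.
move=> [mf fi] H r0 s0 xy; have fs := fi y s s0; have fr := fi x r r0.
set c := avg f (eball y s).
apply: le_trans (avg_dist_le _ r0 fr) _.
apply: le_trans (avg_subset_le r0 s0 xy _ _) _ => //.
  apply: integrable_dist => //; [exact: measurable_eball|exact: mu_eball_lty].
apply: ler_wpM2l; last exact: H.
by rewrite exprn_ge0// mulr_ge0// ?divr_ge0 ?(ltW r0) ?(ltW s0)// mulr_ge0// (le_trans _ N1).
Qed.

(** Consecutive dyadic averages differ by a geometric sequence, whose last term
    dominates as [alpha > 0]. *)
Lemma avg_chain (alpha : R) : 0 < alpha -> exists2 C, 0 < C &
  forall f M, 0 <= M -> loc_integrable f -> osc_bound alpha f M -> forall x s j, 0 < s ->
  `|avg f (eball x s) - avg f (eball x (2 ^+ j * s))| <= C * (M * (2 ^+ j * s) `^ alpha).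
Proof.
move=> a0; pose z : R := 2 `^ (- alpha).
have z0 : 0 < z by rewrite powR_gt0.
have z1 : z < 1 by exact: two_powRN_lt1.
have N0 : 0 < N by exact: lt_le_trans N1.
pose C := (2 * N * 2) ^+ n.
have C0 : 0 < C by rewrite exprn_gt0// !mulr_gt0.
exists (C * (1 - z)^-1); first by rewrite mulr_gt0// invr_gt0 subr_gt0.
move=> f M M0 lf H x s j s0.
apply: (@le_trans _ _ (M * (2 ^+ j * s) `^ alpha * series (geometric C z) j)); last first.
  rewrite [leRHS]mulrC ler_wpM2l ?mulr_ge0 ?powR_ge0//.
  by apply: geometric_le_lim => //; [exact: ltW|rewrite gtr0_norm].
elim: j => [|j IH].
  by rewrite expr0 mul1r subrr normr0 seriesEord/= big_ord0 mulr0.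
have j0 k : 0 < 2 ^+ k * s by rewrite mulr_gt0// exprn_gt0.
apply: le_trans (ler_distD (avg f (eball x (2 ^+ j * s))) _ _) _.
have h : `|avg f (eball x (2 ^+ j * s)) - avg f (eball x (2 ^+ j.+1 * s))| <=
    C * (M * (2 ^+ j.+1 * s) `^ alpha).
  have sub : eball x (2 ^+ j * s) `<=` eball x (2 ^+ j.+1 * s).
    by apply: eball_le; rewrite ler_pM2r// exprS ler_peMl ?exprn_ge0// ler1n.
  apply: le_trans (avg_close lf H (j0 j) (j0 j.+1) sub) _.
  rewrite (_ : 2 ^+ j.+1 * s / _ = 2)//; rewrite exprS; field.
  by rewrite expf_neq0 ?gt_eqF.
apply: le_trans (lerD IH h) _.
have -> : (2 ^+ j * s) `^ alpha = z * (2 ^+ j.+1 * s) `^ alpha.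
  rewrite exprS -mulrA (@powRM R 2 (2 ^+ j * s) alpha)// ?(ltW (j0 _))//.
  by rewrite mulrA /z -powRDp// addNr powRr0 mul1r.
have -> : series (geometric C z) j.+1 = C + z * series (geometric C z) j.
  rewrite !seriesEord/= big_ord_recl/= expr0 mulr1 mulr_sumr; congr (_ + _).
  by apply: eq_bigr => i _; rewrite exprS mulrCA.
by apply: le_of_eq; ring.
Qed.

Lemma measure_bigsetU_le I (l : seq I) (A : I -> set E) :
  (forall i, measurable (A i)) ->
  (mu (\big[setU/set0]_(i <- l) A i) <= \sum_(i <- l) mu (A i))%E.
Proof.
move=> mA; elim: l => [|i l IH]; first by rewrite !big_nil measure0.
rewrite !big_cons; apply: le_trans (measureU2 _ (mA i) _) _.
  by apply: bigsetU_measurable => j _.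
exact: leeD2l.
Qed.

Lemma chebyshev_ball (g : E -> R) x r t c : 0 < r -> 0 < t -> measurable_fun setT g ->
  mu.-integrable (eball x r) (EFin \o g) -> avg (fun y => `|g y|) (eball x r) <= c ->
  (mu (eball x r `&` [set y | (t < `|g y|)%R]) <= ((2 * r) ^+ n * c / t)%:E)%E.
Proof.
move=> r0 t0 mg gi gc; have mB := @measurable_eball R n x r.
have mg' : measurable_fun (eball x r) (EFin \o g) by case/integrableP : gi.
have h : (t%:E * mu (eball x r `&` [set y | (t%:E <= `|(EFin \o g) y|)]) <=
    \int[mu]_(y in eball x r) `|(EFin \o g) y|)%E.
  exact: (le_integral_comp_abse mu mB (@measurable_id _ _ setT) _ _ mg' t0).
have c0 : 0 <= c.
  apply: le_trans gc; rewrite mulr_ge0 ?invr_ge0 ?fine_ge0//.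
  by apply: integral_ge0.
have I : (\int[mu]_(y in eball x r) `|(EFin \o g) y| <= ((2 * r) ^+ n * c)%:E)%E.
  have gi' := integrable_norm gi.
  rewrite -[leLHS]fineK; last by apply: (integrable_fin_num mB gi').
  rewrite lee_fin -/(Rintegral mu (eball x r) (fun y => `|g y|)).
  move: gc; rewrite /avg mulrC ler_pdivrMr ?vol_gt0// => /le_trans; apply.
  by rewrite mulrC ler_wpM2r// vol_le// ltW.
have mS : measurable (eball x r `&` [set y | t < `|g y|]).
  apply: measurableI => //; rewrite -[X in measurable X]setTI.
  rewrite (_ : [set y | _] = (fun y => t < `|g y|) @^-1` [set true]); last by apply/seteqP; split.
  apply: measurable_fun_ltr => //; exact: measurableT_comp.
rewrite EFinM lee_pdivlMr// muleC; apply: le_trans (le_trans h I).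
rewrite lee_pmul2l// ?lte_fin//; apply: le_measure; rewrite ?inE//.
  apply: measurableI => //; rewrite -[X in measurable X]setTI.
  rewrite (_ : [set y | _] = (fun y => t <= `|g y|) @^-1` [set true]); last first.
    by apply/seteqP; split => y /=; rewrite lee_fin.
  apply: measurable_fun_ler => //; exact: measurableT_comp.
by move=> y [yB /ltW ty]; split => //=.
Qed.

(** A grid of mesh [2 * r / 2 ^ J.+1] in the circumscribed cube: the number of balls
    is comparable to the ratio of the volumes, which is what makes the sum of the
    measures in [campanato_ball] bounded independently of [J]. *)
Lemma grid_cover x r J : 0 < r ->
  exists c : {ffun 'I_n -> 'I_(2 ^ J.+1)} -> E,
    (forall i, edist (c i) x <= n%:R * r) /\
    forall y, eball x r y -> exists i, eball (c i) (N * r / 2 ^+ J) y.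
Proof.
move=> r0; pose m : R := (2 ^ J.+1)%:R.
have m0 : 0 < m by rewrite ltr0n expn_gt0.
have rm0 : 0 < 2 * r / m by rewrite divr_gt0// mulr_gt0.
pose c (i : {ffun 'I_n -> 'I_(2 ^ J.+1)}) : E :=
  [tuple (tnth x j - r + 2 * r / m * (i j)%:R : R) | j < n].
exists c; split => [i|y xy].
  apply: edist_le_coord => [|j]; first exact: ltW.
  rewrite tnth_mktuple.
  have i0 : 0 <= 2 * r / m * (i j)%:R by rewrite mulr_ge0// ltW.
  have im : 2 * r / m * (i j)%:R <= 2 * r.
    rewrite mulrAC ler_pdivrMr// ler_pM2l ?mulr_gt0//.
    by rewrite ler_nat ltnW.
  by rewrite ler_norml; apply/andP; split; lra.
have mJ : m = 2 * 2 ^+ J by rewrite /m natrX exprS.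
have J0 : (0 : R) < 2 ^+ J by rewrite exprn_gt0.
pose a j : R := (tnth y j - tnth x j + r) / (2 * r / m).
have aE j : tnth y j = tnth x j - r + 2 * r / m * a j.
  by rewrite /a; field; rewrite !gt_eqF.
have a0 j : 0 <= a j.
  have := le_lt_trans (coord_le_edist x y j) xy.
  rewrite ltr_norml => /andP[? ?]; rewrite divr_ge0//; last exact: ltW.
  lra.
have am j : a j < m.
  have := le_lt_trans (coord_le_edist x y j) xy.
  rewrite ltr_norml => /andP[? ?]; rewrite /a ltr_pdivrMr// mulrC divfK ?gt_eqF//.
  lra.
have tm j : (Num.truncn (a j) < 2 ^ J.+1)%N.
  have /andP[h _] := truncn_itv (a0 j).
  by rewrite -(ltr_nat R); exact: le_lt_trans h (am j).
exists [ffun j => Ordinal (tm j)]; rewrite /eball/=.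
apply: (@le_lt_trans _ _ (n%:R * (2 * r / m))).
  apply: edist_le_coord => [|j]; first exact: ltW.
  rewrite tnth_mktuple ffunE aE /= opprD addrACA subrr add0r -mulrBr.
  have /andP[h1 h2] := truncn_itv (a0 j).
  rewrite normrM gtr0_norm// ler_piMr ?(ltW rm0)// ler_norml.
  by rewrite -natr1 in h2; apply/andP; split; lra.
rewrite mJ (_ : 2 * r / _ = r / 2 ^+ J); last by field; rewrite gt_eqF.
by rewrite mulrA ltr_pM2r ?invr_gt0// ltr_pM2r// /N ltr_nat.
Qed.

Lemma geometric_null (a : \bar R) (c z : R) : 0 < z -> z < 1 ->
  (forall J, (a <= (c * z ^+ J)%:E)%E) -> (a <= 0)%E.
Proof.
move=> z0 z1 h; apply/lee_addgt0Pr => e e0; rewrite add0e.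
have : geometric `|c| z @ \oo --> 0 by apply: cvg_geometric; rewrite gtr0_norm.
move=> /cvgr0Pnorm_lt /(_ e e0)[j _ /(_ j (leqnn _))] /= hj.
apply: le_trans (h j) _; rewrite lee_fin; apply: le_trans (ltW hj).
by apply: le_trans (ler_norm _) _; rewrite !normrM normr_id.
Qed.

(** A bound for the mean oscillations becomes a pointwise one by a covering argument.
    Cover the ball by about [2 ^ (n * J)] balls of radius [s] comparable to
    [r / 2 ^ J]. By [avg_chain] their averages are all within [C * (M * r `^ alpha)] of
    the average over the large ball. A point where [f] is farther than that from the large
    average is far from the average over a small ball containing it; by Chebyshev the
    measure of these points is at most a constant times [2 ^ (- alpha * J)], for
    every [J]. *)
Lemma campanato_ball (alpha : R) : 0 < alpha -> exists2 C, 0 < C &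
  forall f M, 0 < M -> loc_integrable f -> osc_bound alpha f M -> forall x r, 0 < r ->
  {ae mu, forall y, eball x r y -> `|f y - avg f (eball x r)| <= C * (M * r `^ alpha)}.
Proof.
move=> a0; have [C1 C10 chain] := avg_chain a0.
have N0 : 0 < N by exact: lt_le_trans N1.
(* C1 * N `^ alpha: the chain from radius s to N * r; the last term: from the ball of
   radius N * r about a grid point to the given ball; 1: the threshold t in Chebyshev *)
pose C := 1 + (C1 * N `^ alpha + (2 * N * N) ^+ n * N `^ alpha).
have Na : 0 < N `^ alpha by rewrite powR_gt0.
have C0 : 0 < C.
  by rewrite /C ltr_wpDr// addr_ge0 ?mulr_ge0 ?exprn_ge0 ?mulr_ge0// ?(ltW C10) ?(ltW Na)// (ltW N0).
exists C => // f M M0 [mf fi] H x r r0; have lf : loc_integrable f by [].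
set fB := avg f (eball x r).
pose G := eball x r `&` [set y | C * (M * r `^ alpha) < `|f y - fB|].
have mG : measurable G.
  apply: measurableI; first exact: measurable_eball.
  rewrite -[X in measurable X]setTI.
  rewrite (_ : [set y | _] = (fun y => C * (M * r `^ alpha) < `|f y - fB|) @^-1` [set true]); last by apply/seteqP; split.
  apply: measurable_fun_ltr => //; apply: measurableT_comp => //.
  exact: measurable_funB.
exists G; split => //; last first.
  by move=> y /= /not_implyP[yB /negP]; rewrite -ltNge.
pose z : R := 2 `^ (- alpha).
have z0 : 0 < z by rewrite powR_gt0.
have z1 : z < 1 by exact: two_powRN_lt1.
apply/eqP; rewrite eq_le measure_ge0 andbT.
apply: (@geometric_null _ ((4 * N * r) ^+ n * N `^ alpha) z z0 z1) => J.
have [c [cx cov]] := grid_cover x J r0.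
have J0 : (0 : R) < 2 ^+ J by rewrite exprn_gt0.
pose s := N * r / 2 ^+ J.
have s0 : 0 < s by rewrite divr_gt0// mulr_gt0.
have JsE : 2 ^+ J * s = N * r by rewrite /s mulrCA mulfV ?mulr1// gt_eqF.
pose t := M * r `^ alpha.
have t0 : 0 < t by rewrite mulr_gt0// powR_gt0.
pose A i := eball (c i) s `&` [set y | (t < `|f y - avg f (eball (c i) s)|)%R].
have mA i : measurable (A i).
  apply: measurableI; first exact: measurable_eball.
  rewrite -[X in measurable X]setTI.
  rewrite (_ : [set y | _] = (fun y => t < `|f y - avg f (eball (c i) s)|) @^-1` [set true]); last by apply/seteqP; split.
  apply: measurable_fun_ltr => //; apply: measurableT_comp => //.
  exact: measurable_funB.
have muA i : (mu (A i) <= ((2 * s) ^+ n * (M * s `^ alpha) / t)%:E)%E.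
  apply: (@chebyshev_ball (fun y => f y - avg f (eball (c i) s))) => //.
  - exact: measurable_funB.
  - apply: integrable_sub; [exact: measurable_eball|exact: fi|].
    by apply: integrable_finite_cst; [exact: measurable_eball|exact: mu_eball_lty].
  - exact: H.
have GA : G `<=` \big[setU/set0]_i A i.
  move=> y [yB /= yC]; have [i iy] := cov y yB.
  rewrite -bigcup_seq; exists i; first by rewrite /= mem_index_enum.
  split => //=.
  have NrE : (N * r) `^ alpha = N `^ alpha * r `^ alpha by rewrite powRM// ltW.
  have h1 : `|avg f (eball (c i) s) - avg f (eball (c i) (N * r))| <= C1 * N `^ alpha * t.
    have := chain f M (ltW M0) lf H (c i) s J s0; rewrite JsE NrE => /le_trans; apply.
    by rewrite /t; apply: le_of_eq; ring.
  have Nr0 : 0 < N * r by rewrite mulr_gt0.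
  have sub : eball x r `<=` eball (c i) (N * r).
    by apply: eballS; rewrite /N -natr1 mulrDl mul1r lerD2r.
  have h2 : `|fB - avg f (eball (c i) (N * r))| <= (2 * N * N) ^+ n * N `^ alpha * t.
    have := avg_close lf H r0 Nr0 sub; rewrite NrE mulfK ?gt_eqF// => /le_trans; apply.
    by rewrite /t; apply: le_of_eq; ring.
  move: yC h1 h2; rewrite -/t /C.
  move: (C1 * _) ((_ ^+ n) * _) (avg f _) (avg f _) => C2 C3 u v.
  by apply: triangle_arith.
apply: (@le_trans _ _ (\sum_i ((2 * s) ^+ n * (M * s `^ alpha) / t)%:E)%E).
  apply: (@le_trans _ _ (mu (\big[setU/set0]_i A i))).
    apply: le_measure; rewrite ?inE//; exact: bigsetU_measurable.
  apply: le_trans (measure_bigsetU_le _ mA) _; exact: lee_sum.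
rewrite sumEFin lee_fin sumr_const card_ffun !card_ord.
have sE : s `^ alpha = N `^ alpha * r `^ alpha * z ^+ J.
  have zJ : (2 ^+ J) `^ alpha * z ^+ J = 1.
    by rewrite powR_exprn// -exprMn /z -powRDp// subrr powRr0 expr1n.
  have : (2 ^+ J) `^ alpha * s `^ alpha = N `^ alpha * r `^ alpha.
    by rewrite -!powRM ?JsE// ?(ltW J0) ?(ltW s0) ?(ltW N0) ?(ltW r0).
  by move=> <-; rewrite mulrAC zJ mul1r.
rewrite -[leLHS]mulr_natl sE natrX /t.
have -> : 4 * N * r = (2 ^ J.+1)%:R * (2 * s).
  by rewrite natrX exprS -mulrA -JsE; ring.
rewrite [in leRHS]exprMn; apply: le_of_eq.
have ra0 : 0 < r `^ alpha by rewrite powR_gt0.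
by field; rewrite !gt_eqF.
Qed.

Lemma dyadic_enclosing (s d : R) : 0 < s -> 0 <= d ->
  exists k, d < 2 ^+ k * s <= 2 * (s + d).
Proof.
move=> s0 d0; have [sd|ds] := leP s d; last first.
  by exists 0%N; rewrite expr0 mul1r ds/=; lra.
have [k /andP[k1 k2]] := dyadic_shell s0 sd; exists k.+1.
by rewrite k2/= exprS -mulrA ler_pM2l// (le_trans k1)// lerDr ltW.
Qed.

(** Apply [campanato_ball] on the balls of radius [2 ^+ k * s] and bring their averages
    back to the ball of radius [s] with [avg_chain]. *)
Lemma campanato (alpha : R) : 0 < alpha -> exists2 C, 0 < C &
  forall f M, 0 < M -> loc_integrable f -> osc_bound alpha f M -> forall x s, 0 < s ->
  {ae mu, forall y, `|f y - avg f (eball x s)| <= C * (M * (s + edist x y) `^ alpha)}.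
Proof.
move=> a0; have [C1 C10 chain] := avg_chain a0.
have [C2 C20 ball] := campanato_ball a0.
exists ((C1 + C2) * 2 `^ alpha); first by rewrite mulr_gt0 ?powR_gt0 ?addr_gt0.
move=> f M M0 lf H x s s0.
have j0 k : 0 < 2 ^+ k * s by rewrite mulr_gt0// exprn_gt0.
have /ae_foralln := fun k => ball f M M0 lf H x (2 ^+ k * s) (j0 k).
apply: filterS => y hy.
have [k /andP[yk ks]] := dyadic_enclosing s0 (edist_ge0 x y).
have h1 := hy k yk; have h2 := chain f M (ltW M0) lf H x s k s0.
have h3 : (2 ^+ k * s) `^ alpha <= 2 `^ alpha * (s + edist x y) `^ alpha.
  rewrite -powRM ?addr_ge0 ?edist_ge0 ?(ltW s0)//.
  exact: powR_ler (ltW a0) (ltW (j0 k)) ks.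
move: h1 h2 h3; move: (avg f _) (avg f _) ((2 ^+ k * s) `^ _) => u v p h1 h2 h3.
apply: le_trans (ler_distD v _ _) _; rewrite (distrC v).
apply: le_trans (lerD h1 h2) _.
rewrite -mulrDl (addrC C2) -mulrA ler_pM2l ?addr_gt0// mulrCA ler_pM2l//.
Qed.

End campanato.

(** * Integrals against the kernel *)

Section kernel.
Context {R : realType} {n : nat}.
Local Notation E := (Rn R n).
Local Notation mu := (@lebesgue_measure_Rn R n).
Variables (V : E -> R) (gamma delta : R) (K : E -> E -> R).
Local Notation rho := (critical_radius V).
Hypothesis rho_gt0 : forall x, 0 < rho x.
Hypothesis delta_gt0 : 0 < delta.
Hypotheses (K_size : kernel_size V gamma K) (K_smooth : kernel_smoothness gamma delta K).
Implicit Types (x y z : E) (r s t c M beta : R) (f g : E -> R) (A B D : set E).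

Let mB x r := @measurable_eball R n x r.
Let mC x r : measurable (~` eball x r). Proof. by apply: measurableC; exact: mB. Qed.

Lemma measurable_point x : measurable [set x].
Proof.
have -> : [set x] = ~` [set y | y != x].
  by apply/seteqP; split=> y /=; [move=> ->; rewrite eqxx|move/negP/negPn/eqP].
apply: measurableC; apply: measurable_eopen => y /= yx; exists (edist y x).
  by rewrite edist_gt0.
by move=> z; rewrite /eball/=; apply: contraTneq => ->; rewrite ltxx.
Qed.

(** By the smoothness condition, [K x] is continuous away from [x]. *)
Lemma measurable_kernel x : measurable_fun setT (K x).
Proof.
rewrite -(setvU [set x]); apply/measurable_funU; [by apply: measurableC; exact: measurable_point|exact: measurable_point|].
split; last first.
  move=> _ Y mY; have [xY|xY] := pselect (Y (K x x)).
    rewrite (_ : _ `&` _ = [set x]); first exact: measurable_point.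
    by apply/seteqP; split => [y []//|_ ->].
  rewrite (_ : _ `&` _ = set0) //.
  by apply/seteqP; split => [y [->]|].
apply: econtinuous_measurable.
  move=> y /= /eqP yx; exists (edist y x); first by rewrite edist_gt0.
  by move=> z; rewrite /eball/= => + zx; rewrite zx ltxx.
have [C KC] := K_smooth.
move=> y e /= /eqP; rewrite eq_sym => xy e0.
pose D := edist x y `^ (n%:R - gamma + delta).
have D0 : 0 < D by rewrite powR_gt0// edist_gt0.
pose a := e * D / (`|C| + 1).
have C0 : 0 < `|C| + 1 by rewrite ltr_wpDl.
have a0 : 0 < a by rewrite !mulr_gt0// invr_gt0.
exists (Num.min (edist x y / 2) (a `^ delta^-1)).
  by rewrite lt_min divr_gt0 ?edist_gt0// powR_gt0.
move=> z; rewrite lt_min => /andP[z1 z2].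
have /(KC x y z) : 2 * edist y z < edist x y by rewrite mulrC -ltr_pdivlMr.
have za : edist y z `^ delta < a.
  have := gt0_ltr_powR delta_gt0 (edist_ge0 y z) (powR_ge0 a _) z2.
  by rewrite -powRrM mulVf ?gt_eqF// powRr1// ltW.
rewrite -/D => h; apply: (@le_lt_trans _ _ (C * (edist y z `^ delta / D))).
  by apply: le_trans h; rewrite lerDl.
apply: (@le_lt_trans _ _ (`|C| * (edist y z `^ delta / D))).
  by rewrite ler_wpM2r ?ler_norm// divr_ge0 ?powR_ge0// ltW.
apply: (@le_lt_trans _ _ ((`|C| + 1) * (edist y z `^ delta / D))).
  by rewrite ler_wpM2r ?lerDl// divr_ge0 ?powR_ge0// ltW.
by rewrite mulrA ltr_pdivrMr// mulrC -ltr_pdivlMr.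
Qed.

(** The property shared by the functions of BMO^beta for [beta > 0] and, with
    [beta = 0], by the constant 1, and all that the extension of the operator needs. *)
Definition growth beta M f := measurable_fun setT f /\
  forall x r, rho x <= r -> {ae mu, forall y, `|f y| <= M * (r + edist x y) `^ beta}.

(** The size condition with [N = 2]: two powers of decay at infinity beat the growth
    [beta < 1 - gamma] of the functions. *)
Lemma kernel_bound : exists2 C, 0 <= C & forall x y, x != y ->
  `|K x y| <= C * rho x ^+ 2 * edist x y `^ (- (n%:R + (2 - gamma))).
Proof.
have [C0 KC] := K_size (ltr0Sn R 1).
exists `|C0| => // x y xy; apply: le_trans (KC x y xy) _.
have d0 : 0 < edist x y by rewrite edist_gt0.
have r0 := rho_gt0 x.
have -> : edist x y `^ (- (n%:R + (2 - gamma))) =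
    (edist x y `^ (n%:R - gamma))^-1 * (edist x y ^+ 2)^-1.
  by rewrite -powRN -powR_invn ?(ltW d0)// -powRDp//; congr (_ `^ _); ring.
have h : (1 + edist x y / rho x) `^ (- 2) <= rho x ^+ 2 * (edist x y ^+ 2)^-1.
  have dr0 : 0 < edist x y / rho x by rewrite divr_gt0.
  apply: (@le_trans _ _ ((edist x y / rho x) `^ (- 2))).
    by apply: ler_powRN => //; rewrite lerDr.
  rewrite powR_invn ?(ltW dr0)// exprMn exprVn invfM invrK mulrC.
  exact: lexx.
apply: (@le_trans _ _ (`|C0| / edist x y `^ (n%:R - gamma) * (1 + edist x y / rho x) `^ (- 2))).
  by rewrite ler_wpM2r ?powR_ge0// ler_wpM2r ?ler_norm// invr_ge0 powR_ge0.
apply: le_trans (ler_wpM2l _ h) _; first by rewrite divr_ge0// powR_ge0.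
by apply: le_of_eq; ring.
Qed.

(** Beyond distance [d] of [x], [rho x + edist x y] is at most [(1 + rho x / d) * edist x y],
    which reduces the integrand to the power treated in [tail_integral]. *)
Lemma size_integral beta : 0 <= beta -> beta + gamma < 1 ->
  exists2 C, 0 <= C & forall f M x d, 0 <= M -> growth beta M f -> 0 < d ->
  (\int[mu]_(y in ~` eball x d) `|K x y * f y|%:E <=
   (C * (M * rho x ^+ 2 * (1 + rho x / d) `^ beta * d `^ (- (2 - gamma - beta))))%:E)%E.
Proof.
move=> b0 bg; have [CK CK0 KC] := kernel_bound.
have e0 : 0 < 2 - gamma - beta by lra.
have [Ct Ct0 tail] := @tail_integral R n _ e0.
exists (CK * Ct); first by rewrite mulr_ge0// ltW.
move=> f M x d M0 [mf gf] d0; have r0 := rho_gt0 x.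
pose a := CK * rho x ^+ 2 * (M * (1 + rho x / d) `^ beta).
have a0 : 0 <= a by rewrite !mulr_ge0 ?powR_ge0 ?exprn_ge0 ?(ltW r0).
have mK := measurable_kernel x.
apply: (@le_trans _ _ (\int[mu]_(y in ~` eball x d)
    (a%:E * (edist x y `^ (- (n%:R + (2 - gamma - beta))))%:E))%E).
  apply: ae_ge0_le_integral => //.
  - apply/measurable_EFinP; apply: measurable_funTS; apply: measurableT_comp => //.
    exact: measurable_funM.
  - by move=> y _; rewrite mule_ge0// lee_fin powR_ge0.
  - apply: measurable_funTS; apply/measurable_EFinP; apply: measurable_funM => //.
    apply: (measurableT_comp (measurable_powR _)); exact: measurable_edist.
  - have := gf x (rho x) (lexx _); apply: filterS => y fy; rewrite /setC/= /eball/= => /negP.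
    rewrite -leNgt => dy; have xy0 : 0 < edist x y := lt_le_trans d0 dy.
    have xy : x != y by rewrite -edist_gt0.
    rewrite -EFinM lee_fin normrM.
    have fy' : `|f y| <= M * ((1 + rho x / d) `^ beta * edist x y `^ beta).
      apply: le_trans fy _; apply: ler_wpM2l => //.
      rewrite -powRM ?(ltW xy0)//; last by rewrite addr_ge0// divr_ge0 ?(ltW r0) ?(ltW d0).
      apply: powR_ler => //; first by rewrite addr_ge0 ?(ltW r0) ?(ltW xy0).
      rewrite mulrDl mul1r addrC lerD2l -mulrA ler_peMr ?(ltW r0)//.
      by rewrite mulrC ler_pdivlMr// mul1r.
    apply: le_trans (ler_pM (normr_ge0 _) (normr_ge0 _) (KC x y xy) fy') _.
    have -> : edist x y `^ (- (n%:R + (2 - gamma - beta))) =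
      edist x y `^ (- (n%:R + (2 - gamma))) * edist x y `^ beta.
      by rewrite -powRDp//; congr (_ `^ _); ring.
    by rewrite /a; apply: le_of_eq; ring.
rewrite ge0_integralZl_EFin//; last 2 first.
- by move=> y _; rewrite lee_fin powR_ge0.
- apply: measurable_funTS; apply/measurable_EFinP.
  apply: (measurableT_comp (measurable_powR _)); exact: measurable_edist.
apply: le_trans (lee_wpmul2l _ (tail x d d0)) _ => //.
rewrite -EFinM lee_fin /a; apply: le_of_eq; ring.
Qed.

Lemma size_integrable beta f M x d D : 0 <= beta -> beta + gamma < 1 -> 0 <= M ->
  growth beta M f -> 0 < d -> measurable D -> D `<=` ~` eball x d ->
  mu.-integrable D (EFin \o (fun y => K x y * f y)).
Proof.
move=> b0 bg M0 gf d0 mD Dd; have [C C0 size] := size_integral b0 bg.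
apply: (integrableS (mC x d) mD Dd); apply/integrableP; split.
  apply: measurable_funTS; apply/measurable_EFinP; apply: measurable_funM; last by case: gf.
  exact: measurable_kernel.
by apply: le_lt_trans (size f M x d M0 gf d0) _; rewrite ltry.
Qed.

(** As [rho x] is at most comparable to [r] on the ball by hypothesis, the powers of
    [rho x] in [size_integral] become powers of [r]. *)
Lemma size_bound (Cr : R) beta : 0 <= beta -> beta + gamma < 1 -> 1 <= Cr ->
  (forall x0 x r, rho x0 <= r -> edist x x0 <= r -> rho x <= Cr * r) ->
  exists2 C, 0 <= C & forall f M x0 x r, 0 <= M -> growth beta M f ->
    rho x0 <= r -> eball x0 r x ->
    (\int[mu]_(y in ~` eball x0 (4 * r)) `|K x y * f y|%:E <=
     (C * (M * r `^ (beta + gamma)))%:E)%E.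
Proof.
move=> b0 bg Cr1 compare; have [C C0 size] := size_integral b0 bg.
have Cr0 : 0 <= Cr by apply: le_trans Cr1.
have e0 : 0 <= 2 - gamma - beta by lra.
exists (C * (Cr ^+ 2 * (1 + Cr) `^ beta)).
  by rewrite mulr_ge0// mulr_ge0 ?powR_ge0 ?exprn_ge0.
move=> f M x0 x r M0 gf x0r xr; have r0 : 0 < r := lt_le_trans (rho_gt0 x0) x0r.
have xx0 : edist x x0 <= r by rewrite edistC ltW.
have rx := compare x0 x r x0r xx0; have rx0 := rho_gt0 x.
have sub : ~` eball x0 (4 * r) `<=` ~` eball x r.
  apply: subsetC; apply: eballS; apply: le_trans (lerD (ltW xr) (lexx r)) _.
  by rewrite -[leLHS]mulr2n -[leLHS]mulr_natl ler_pM2r// ler_nat.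
apply: (@le_trans _ _ (\int[mu]_(y in ~` eball x r) `|K x y * f y|%:E)%E).
  apply: ge0_subset_integral => //.
  apply: measurable_funTS; apply/measurable_EFinP; apply: measurableT_comp => //.
  by apply: measurable_funM; [exact: measurable_kernel|case: gf].
apply: le_trans (size f M x r M0 gf r0) _; rewrite lee_fin.
have -> : C * (Cr ^+ 2 * (1 + Cr) `^ beta) * (M * r `^ (beta + gamma)) =
    C * (M * (Cr * r) ^+ 2 * (1 + Cr) `^ beta * r `^ (- (2 - gamma - beta))).
  have -> : r `^ (beta + gamma) = r ^+ 2 * r `^ (- (2 - gamma - beta)).
    by rewrite -powR_mulrn ?(ltW r0)// -powRDp//; congr (_ `^ _); ring.
  by rewrite exprMn; ring.
apply: ler_wpM2l => //; apply: ler_wpM2r; first exact: powR_ge0.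
apply: ler_pM; rewrite ?powR_ge0 ?mulr_ge0 ?exprn_ge0 ?(ltW rx0)//.
  apply: ler_wpM2l => //; rewrite ler_pXn2r// nnegrE ?(ltW rx0)//.
  by rewrite mulr_ge0// ltW.
apply: powR_ler => //; first by rewrite addr_ge0// divr_ge0 ?(ltW rx0) ?(ltW r0).
by rewrite lerD2l ler_pdivrMr.
Qed.

(** Subtracting the kernel at the centre gains [(s / edist x0 y) `^ delta], which makes the
    growth of order [beta < delta - gamma] of [f - c] integrable at infinity. *)
Lemma smooth_integral beta : 0 <= beta -> beta + gamma < delta ->
  exists2 C, 0 <= C & forall f c M x0 x s, 0 <= M -> measurable_fun setT f -> 0 < s ->
    eball x0 s x -> {ae mu, forall y, `|f y - c| <= M * (s + edist x0 y) `^ beta} ->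
    (\int[mu]_(y in ~` eball x0 (4 * s)) `|(K x y - K x0 y) * (f y - c)|%:E <=
     (C * (M * s `^ (beta + gamma)))%:E)%E.
Proof.
move=> b0 bg; have [C0 KC] := K_smooth.
have e0 : 0 < delta - gamma - beta by lra.
have [Ct Ct0 tail] := @tail_integral R n _ e0.
exists (`|C0| * 2 `^ beta * Ct * 4 `^ (- (delta - gamma - beta))).
  by rewrite !mulr_ge0 ?powR_ge0 ?(ltW Ct0).
move=> f c M x0 x s M0 mf s0 xs fc.
pose a := `|C0| * s `^ delta * (M * 2 `^ beta).
have a0 : 0 <= a by rewrite !mulr_ge0 ?powR_ge0.
apply: (@le_trans _ _ (\int[mu]_(y in ~` eball x0 (4 * s))
    (a%:E * (edist x0 y `^ (- (n%:R + (delta - gamma - beta))))%:E))%E).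
  apply: ae_ge0_le_integral => //.
  - apply/measurable_EFinP; apply: measurable_funTS; apply: measurableT_comp => //.
    apply: measurable_funM; last exact: measurable_funB.
    by apply: measurable_funB; exact: measurable_kernel.
  - by move=> y _; rewrite mule_ge0// lee_fin powR_ge0.
  - apply: measurable_funTS; apply/measurable_EFinP; apply: measurable_funM => //.
    apply: (measurableT_comp (measurable_powR _)); exact: measurable_edist.
  - move: fc; apply: filterS => y fy; rewrite /setC/= /eball/= => /negP.
    rewrite -leNgt => sy; have y0 : 0 < edist x0 y by apply: lt_le_trans sy; rewrite mulr_gt0.
    have sd : s <= edist x0 y by apply: le_trans sy; rewrite ler_peMl ?(ltW s0)// ler1n.
    rewrite -EFinM lee_fin normrM.
    have hK : `|K x y - K x0 y| <= `|C0| * s `^ delta * edist x0 y `^ (- (n%:R - gamma + delta)).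
      have /KC : 2 * edist x0 x < edist y x0.
        rewrite (edistC y); apply: lt_le_trans sy.
        by have := xs; rewrite /eball/=; lra.
      rewrite (edistC y) => h; rewrite distrC.
      apply: (@le_trans _ _ (C0 * (edist x0 x `^ delta / edist x0 y `^ (n%:R - gamma + delta)))).
        by apply: le_trans h; rewrite lerDr.
      rewrite powRN -mulrA; apply: le_trans (ler_wpM2r _ (ler_norm C0)) _.
        by rewrite divr_ge0 ?powR_ge0.
      apply: ler_wpM2l => //; apply: ler_wpM2r; first by rewrite invr_ge0 powR_ge0.
      by apply: powR_ler; [exact: ltW|exact: edist_ge0|exact: ltW].
    have fy' : `|f y - c| <= M * (2 `^ beta * edist x0 y `^ beta).
      apply: le_trans fy _; apply: ler_wpM2l => //.
      rewrite -powRM ?(ltW y0)//; apply: powR_ler => //.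
        by rewrite addr_ge0 ?(ltW s0) ?(ltW y0).
      by rewrite mulr_natl mulr2n lerD2r.
    apply: le_trans (ler_pM (normr_ge0 _) (normr_ge0 _) hK fy') _.
    have -> : edist x0 y `^ (- (n%:R + (delta - gamma - beta))) =
      edist x0 y `^ (- (n%:R - gamma + delta)) * edist x0 y `^ beta.
      by rewrite -powRDp//; congr (_ `^ _); ring.
    by rewrite /a; apply: le_of_eq; ring.
rewrite ge0_integralZl_EFin//; last 2 first.
- by move=> y _; rewrite lee_fin powR_ge0.
- apply: measurable_funTS; apply/measurable_EFinP.
  apply: (measurableT_comp (measurable_powR _)); exact: measurable_edist.
have s40 : 0 < 4 * s by rewrite mulr_gt0.
apply: le_trans (lee_wpmul2l _ (tail x0 _ s40)) _ => //.
rewrite -EFinM lee_fin /a powRM ?(ltW s0)//.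
have -> : s `^ (beta + gamma) = s `^ delta * s `^ (- (delta - gamma - beta)).
  by rewrite -powRDp//; congr (_ `^ _); ring.
apply: le_of_eq; ring.
Qed.

End kernel.

(** * The operator on bounded functions supported in a ball *)

Section operator.
Context {R : realType} {n : nat}.
Local Notation E := (Rn R n).
Local Notation mu := (@lebesgue_measure_Rn R n).
Variables (V : E -> R) (gamma delta p1 p2 : R) (T : (E -> R) -> (E -> R)) (K : E -> E -> R).
Local Notation rho := (critical_radius V).
Hypothesis n_gt0 : (0 < n)%N.
Hypothesis rho_gt0 : forall x, 0 < rho x.
Hypotheses (gamma_ge0 : 0 <= gamma) (delta_gt0 : 0 < delta).
Hypotheses (p1_gt1 : 1 < p1) (p1_le : p1 <= p2) (p2E : p2^-1 = p1^-1 - gamma / n%:R).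
Hypothesis T_SCZ : SCZ_operator V gamma delta p1 p2 T K.
Implicit Types (x y z : E) (r s t c M beta : R) (f g h : E -> R) (A B D : set E).

Let mB x r := @measurable_eball R n x r.
Let mC x r : measurable (~` eball x r). Proof. by apply: measurableC; exact: mB. Qed.
Let p1_gt0 : 0 < p1. Proof. exact: lt_trans p1_gt1. Qed.
Let p2_gt1 : 1 < p2. Proof. exact: lt_le_trans p1_le. Qed.
Let p2_gt0 : 0 < p2. Proof. exact: lt_trans p2_gt1. Qed.
Let K_size : kernel_size V gamma K. Proof. by case: T_SCZ. Qed.
Let K_smooth : kernel_smoothness gamma delta K. Proof. by case: T_SCZ. Qed.
Let mK x : measurable_fun setT (K x).
Proof. exact: (measurable_kernel delta_gt0 K_smooth). Qed.

(** The functions on which the operator is evaluated: in every [L^p], and compactly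
    supported. *)
Definition bounded_in x r M g := [/\ measurable_fun setT g,
  {ae mu, forall y, `|g y| <= M} & forall y, ~ eball x r y -> g y = 0].

Lemma bounded_in_Lfun x r M g : 0 <= M -> bounded_in x r M g -> g \in Lfun mu p1%:E.
Proof.
move=> M0 [mg gM g0]; rewrite inE; apply/andP; split; rewrite inE//=.
by apply: le_lt_trans (Lnorm_bounded_le p1_gt0 M0 mg gM g0) _; rewrite ltry.
Qed.

Lemma measurable_T g : g \in Lfun mu p1%:E -> measurable_fun setT (T g).
Proof.
move=> gL; have [[TL _ _] _ _ _] := T_SCZ.
by have /sub_Lfun_mfun := TL g gL; rewrite inE.
Qed.

Lemma bounded_in_supp x r M g : bounded_in x r M g -> compactly_supported g.
Proof.
move=> [_ _ g0]; exists x, (r + 1) => y yg; apply: contrapT => yr.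
apply: (yg 1 ltr01); apply: aeW => z yz; apply: g0 => xz; apply: yr.
rewrite /eball/=; apply: le_lt_trans (edist_triangle x z y) _.
by rewrite ltrD// edistC.
Qed.

(** The points of an open ball where [g] vanishes are outside its essential support. *)
Lemma T_off_support x0 r0 M g z r : 0 <= M -> bounded_in x0 r0 M g ->
  (forall y, eball z r y -> g y = 0) ->
  {ae mu, forall x, eball z r x -> T g x = \int[mu]_y (K x y * g y)}.
Proof.
move=> M0 gb gz; have [_ rep _ _] := T_SCZ.
have := rep g (bounded_in_Lfun M0 gb) (bounded_in_supp gb).
apply: filterS => x h zx; apply: h => /(_ (r - edist z x)); apply.
  by rewrite subr_gt0.
apply: aeW => y xy; apply: gz; rewrite /eball/=.
by apply: le_lt_trans (edist_triangle z x y) _; rewrite -ltrBrDl.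
Qed.

Lemma T_lin (a : R) g1 g2 h : g1 \in Lfun mu p1%:E -> g2 \in Lfun mu p1%:E ->
  (forall y, h y = a * g1 y + g2 y) ->
  {ae mu, forall x, T h x = a * T g1 x + T g2 x}.
Proof.
move=> L1 L2 hE; have [[_ lin _] _ _ _] := T_SCZ.
have -> : h = (fun y => a * g1 y + g2 y) by exact/funext.
exact: lin.
Qed.

(** Hoelder on the ball and the [L^p1]-[L^p2] bound; the powers of [r] add up to
    [n * (1 - 1 / p2 + 1 / p1) = n + gamma]. *)
Lemma T_local_bound : exists2 C, 0 <= C & forall x r M g, 0 < r -> 0 <= M ->
  bounded_in x (4 * r) M g ->
  (\int[mu]_(y in eball x r) `|T g y|%:E <= (C * (M * (r ^+ n * r `^ gamma)))%:E)%E.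
Proof.
have [[TL _ [C0 TC]] _ _ _] := T_SCZ.
pose a := n%:R * (1 - p2^-1); pose b := n%:R * p1^-1.
have th0 : 0 < 1 - p2^-1 by rewrite subr_gt0 invf_lt1.
have n0 : (n%:R : R) != 0 by rewrite pnatr_eq0 -lt0n.
exists (2 `^ a * (`|C0| * 8 `^ b)); first by rewrite !mulr_ge0 ?powR_ge0.
move=> x r M g r0 M0 gb; have gL := bounded_in_Lfun M0 gb.
have mTg := measurable_T gL; have [mg gM g0] := gb.
apply: le_trans (hoelder_set (mB x r) mTg p2_gt1) _.
have r40 : 0 < 4 * r by rewrite mulr_gt0.
have h1 : ((\int[mu]_(y in eball x r) (`|T g y| `^ p2)%:E) `^ p2^-1 <=
    (`|C0| * (M * vol (eball x (4 * r)) `^ p1^-1))%:E)%E.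
  apply: (@le_trans _ _ ('N[mu]_p2%:E[EFin \o T g])%E).
    rewrite unlock; apply: gt0_ler_poweR; first by rewrite invr_ge0 ltW.
    - by rewrite in_itv/= leey andbT integral_ge0// => y _; rewrite lee_fin powR_ge0.
    - by rewrite in_itv/= leey andbT integral_ge0// => y _; rewrite poweR_ge0.
    - apply: ge0_subset_integral => //.
      apply/measurable_EFinP; apply: (measurableT_comp (measurable_powR _)).
      exact: measurableT_comp.
  apply: le_trans (TC g gL) _.
  apply: (@le_trans _ _ (`|C0|%:E * 'N[mu]_p1%:E [EFin \o g])%E).
    by apply: lee_wpmul2r; rewrite ?Lnorm_ge0// lee_fin ler_norm.
  rewrite EFinM; apply: lee_wpmul2l; first by rewrite lee_fin.
  exact: Lnorm_bounded_le.
rewrite volE poweR_EFin.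
apply: le_trans (lee_wpmul2l _ h1) _; first by rewrite lee_fin powR_ge0.
rewrite -EFinM lee_fin.
have pE (u e : R) : 0 <= u -> (u ^+ n) `^ e = u `^ (n%:R * e).
  by move=> u0; rewrite -powR_mulrn// -powRrM.
have h2 : vol (eball x r) `^ (1 - p2^-1) <= 2 `^ a * r `^ a.
  rewrite -powRM ?(ltW r0)// /a -pE ?mulr_ge0 ?(ltW r0)//.
  by apply: powR_ler; [exact: ltW|exact: fine_ge0|exact/vol_le/ltW].
have h3 : vol (eball x (4 * r)) `^ p1^-1 <= 8 `^ b * r `^ b.
  rewrite -powRM ?(ltW r0)// /b -pE ?mulr_ge0 ?(ltW r0)//.
  apply: powR_ler; [by rewrite invr_ge0 ltW|exact: fine_ge0|].
  have -> : 8 * r = 2 * (4 * r) by ring.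
  exact/vol_le/ltW.
have rE : r `^ a * r `^ b = r ^+ n * r `^ gamma.
  rewrite -powRDp// -powR_mulrn ?(ltW r0)// -powRDp//; congr (_ `^ _).
  by rewrite /a /b p2E; field; rewrite gt_eqF ?n0.
have -> : 2 `^ a * (`|C0| * 8 `^ b) * (M * (r ^+ n * r `^ gamma)) =
   (2 `^ a * r `^ a) * (`|C0| * (M * (8 `^ b * r `^ b))).
  by rewrite -rE; ring.
apply: ler_pM => //; first exact: powR_ge0.
  by rewrite !mulr_ge0 ?powR_ge0.
by apply: ler_wpM2l => //; apply: ler_wpM2l.
Qed.

Lemma cutoff_bounded beta f M x s r : 0 <= beta -> 0 <= M -> 0 <= s -> 0 <= r ->
  measurable_fun setT f -> {ae mu, forall y, `|f y| <= M * (s + edist x y) `^ beta} ->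
  bounded_in x r (M * (s + r) `^ beta) (f \* \1_(eball x r)).
Proof.
move=> b0 M0 s0 r0 mf H; split.
- by apply: measurable_funM => //; exact: measurable_indic.
- move: H; apply: filterS => y fy /=; rewrite indicE.
  have [yB|yB] := boolP (y \in eball x r); last by rewrite mulr0 normr0 mulr_ge0// powR_ge0.
  rewrite mulr1; apply: le_trans fy _; apply: ler_wpM2l => //; apply: powR_ler => //.
    by rewrite addr_ge0 ?edist_ge0.
  by rewrite lerD2l ltW//; rewrite inE in yB.
- by move=> y yB /=; rewrite indicE memNset// mulr0.
Qed.

Lemma growth_cutoff_bounded beta f M x r : 0 <= beta -> 0 <= M -> growth V beta M f ->
  0 < r -> exists2 M', 0 <= M' & bounded_in x r M' (f \* \1_(eball x r)).
Proof.
move=> b0 M0 [mf gf] r0; exists (M * (rho x + r) `^ beta).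
  by rewrite mulr_ge0 ?powR_ge0.
by apply: cutoff_bounded; rewrite ?(ltW r0) ?(ltW (rho_gt0 x))//; exact: gf.
Qed.

End operator.

(** * Extension to functions of polynomial growth *)

Section extension.
Context {R : realType} {n : nat}.
Local Notation E := (Rn R n).
Local Notation mu := (@lebesgue_measure_Rn R n).
Variables (V : E -> R) (gamma delta p1 p2 : R) (T : (E -> R) -> (E -> R)) (K : E -> E -> R).
Local Notation rho := (critical_radius V).
Hypothesis rho_gt0 : forall x, 0 < rho x.
Hypothesis delta_gt0 : 0 < delta.
Hypothesis p1_gt1 : 1 < p1.
Hypothesis T_SCZ : SCZ_operator V gamma delta p1 p2 T K.
Implicit Types (x y z : E) (r s t c M beta : R) (f g h : E -> R) (A B D : set E).

Let mB x r := @measurable_eball R n x r.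
Let mC x r : measurable (~` eball x r). Proof. by apply: measurableC; exact: mB. Qed.
Let K_size : kernel_size V gamma K. Proof. by case: T_SCZ. Qed.
Let K_smooth : kernel_smoothness gamma delta K. Proof. by case: T_SCZ. Qed.
Let mK x : measurable_fun setT (K x).
Proof. exact: (measurable_kernel delta_gt0 K_smooth). Qed.

(** The difference of the two cutoffs vanishes on the smaller ball, where its image is
    therefore given by the kernel. *)
Lemma T_cutoff_split g x0 r M1 x1 s M2 : 0 <= M1 -> 0 <= M2 ->
  eball x0 r `<=` eball x1 s ->
  bounded_in x0 r M1 (g \* \1_(eball x0 r)) -> bounded_in x1 s M2 (g \* \1_(eball x1 s)) ->
  {ae mu, forall x, eball x0 r x -> T (g \* \1_(eball x1 s)) x =
    T (g \* \1_(eball x0 r)) x +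
    \int[mu]_(y in ~` eball x0 r) (K x y * (g \* \1_(eball x1 s)) y)}.
Proof.
move=> M10 M20 sub b1 b2.
pose h y := (g \* \1_(eball x1 s)) y * \1_(~` eball x0 r) y.
have bh : bounded_in x1 s M2 h.
  have [m2 f2 z2] := b2; split.
  - apply: measurable_funM => //; exact: measurable_indic.
  - move: f2; apply: filterS => y; apply: le_trans; rewrite normrM ler_piMr//.
    by rewrite indicE; case: (_ \in _); rewrite ?normr1 ?normr0.
  - by move=> y /z2; rewrite /h => ->; rewrite mul0r.
have hz y : eball x0 r y -> h y = 0.
  by move=> yB; rewrite /h [\1_(~` _) y]indicE memNset ?mulr0//; apply.
have L1 := bounded_in_Lfun p1_gt1 M10 b1.
have Lh := bounded_in_Lfun p1_gt1 M20 bh.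
have := T_lin T_SCZ (a := 1) L1 Lh (h := g \* \1_(eball x1 s)) _.
have e y : (g \* \1_(eball x1 s)) y = 1 * (g \* \1_(eball x0 r)) y + h y.
  rewrite mul1r /h /= !indicE in_setC; have [yB|yB] := boolP (y \in eball x0 r) => /=.
    rewrite mulr0 addr0 mem_set//; apply: sub; exact: set_mem.
  by rewrite mulr0 add0r mulr1.
move=> /(_ e); apply: filterS2 (T_off_support p1_gt1 T_SCZ M20 bh hz) => x hx lin xB.
rewrite lin mul1r hx//; congr (_ + _).
rewrite [RHS]Rintegral_mkcond; apply: eq_Rintegral => y _.
rewrite patchE /h [\1_(~` _) y]indicE; case: ifPn => _; first by rewrite mulr1.
by rewrite !mulr0.
Qed.

Variables (beta M : R) (f : E -> R).
Hypotheses (beta_ge0 : 0 <= beta) (bg : beta + gamma < 1) (M_ge0 : 0 <= M).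
Hypothesis gf : growth V beta M f.

Let mf : measurable_fun setT f. Proof. by case: gf. Qed.

Lemma cutoff_cvg x0 r (x1 : E) x : eball x0 r x ->
  (\int[mu]_(y in ~` eball x0 r) (K x y * (f \* \1_(eball x1 j.+1%:R)) y))%R
    @[j --> \oo] --> \int[mu]_(y in ~` eball x0 r) (K x y * f y).
Proof.
move=> xB; have d0 : 0 < r - edist x0 x by rewrite subr_gt0.
have sub : ~` eball x0 r `<=` ~` eball x (r - edist x0 x).
  by apply: subsetC; apply: eballS; rewrite addrC subrK.
have i1 := size_integrable rho_gt0 delta_gt0 K_size K_smooth beta_ge0 bg M_ge0 gf d0 (mC x0 r) sub.
apply: fine_cvg; rewrite fineK; last exact: integrable_fin_num i1.
apply: (@dominated_cvg _ _ _ mu _ (mC x0 r)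
  (fun j y => (K x y * (f \* \1_(eball x1 j.+1%:R)) y)%:E) _ (fun y => `|K x y * f y|%:E)) => //.
- move=> j; apply: measurable_funTS; apply/measurable_EFinP; apply: measurable_funM => //.
  apply: measurable_funM => //; exact: measurable_indic.
- move=> y _; apply: cvg_near_cst.
  have [k yk] := dyadic_cover (edist x1 y) (ltr01 : 0 < (1 : R)).
  exists (2 ^ k)%N => // j /= kj; rewrite indicE mem_set ?mulr1//.
  rewrite /eball/=; apply: lt_le_trans yk _; rewrite mulr1 -natrX ler_nat.
  exact: leq_trans kj (leqnSn j).
- exact: integrable_norm i1.
- move=> j y _; rewrite /= lee_fin !normrM ler_wpM2l// ler_piMr//.
  by rewrite indicE; case: (_ \in _); rewrite ?normr1 ?normr0.
Qed.

(** The extension is the limit of [T] applied to the cutoffs of [f] to the balls of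
    integer radius about the origin. On any ball [T_cutoff_split] identifies this limit,
    a.e., with the defining formula, because the integral of the kernel converges
    absolutely; as the sequence does not depend on the ball, neither does the limit. An upper
    limit is used in order to get a measurable function. *)
Lemma extension_exists : is_extension V T K f (extend V T K f).
Proof.
rewrite /extend; apply: xgetPex.
pose o : E := [tuple (0 : R) | i < n].
pose F j := T (f \* \1_(eball o j.+1%:R)).
have mF j : measurable_fun setT (F j).
  have j0 : (0 : R) < j.+1%:R by [].
  have [M1 M10 b1] := growth_cutoff_bounded rho_gt0 o beta_ge0 M_ge0 gf j0.
  by apply: (measurable_T T_SCZ); exact: bounded_in_Lfun b1.
exists (fun x => fine (limn_esup (fun j => (F j x)%:E))); split.
  apply: measurableT_comp => //.
  by apply: measurable_fun_limn_esup => j; exact/measurable_EFinP.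
move=> x0 r x0r; have r0 : 0 < r := lt_le_trans (rho_gt0 x0) x0r.
have [k ok] := dyadic_cover (edist o x0 + r) (ltr01 : 0 < (1 : R)).
have sub j : eball x0 r `<=` eball o (j + 2 ^ k).+1%:R.
  apply: eballS; apply: ltW; apply: lt_le_trans ok _.
  by rewrite mulr1 -natrX ler_nat leqW// leq_addl.
have split j : {ae mu, forall x, eball x0 r x -> T (f \* \1_(eball o (j + 2 ^ k).+1%:R)) x =
    T (f \* \1_(eball x0 r)) x +
    \int[mu]_(y in ~` eball x0 r) (K x y * (f \* \1_(eball o (j + 2 ^ k).+1%:R)) y)}.
  have [M1 M10 b1] := growth_cutoff_bounded rho_gt0 x0 beta_ge0 M_ge0 gf r0.
  have [M2 M20 b2] := growth_cutoff_bounded rho_gt0 o beta_ge0 M_ge0 gf (ltr0Sn R (j + 2 ^ k)).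
  exact: T_cutoff_split (sub j) b1 b2.
have /ae_foralln := split.
apply: filterS => x hx xB.
have : F j x @[j --> \oo] --> T (f \* \1_(eball x0 r)) x +
    \int[mu]_(y in ~` eball x0 r) (K x y * f y).
  rewrite -(cvg_shiftn (2 ^ k)%N) /=; under eq_fun do rewrite /F hx//.
  apply: cvgD; first exact: cvg_cst.
  by have := @cutoff_cvg x0 r o x xB; rewrite -(cvg_shiftn (2 ^ k)%N).
set l := (X in _ --> X) => cF.
have cE : (F j x)%:E @[j --> \oo] --> l%:E by apply: cvg_EFin => //; exact: nearW.
by rewrite is_cvg_limn_esupE; [rewrite (cvg_lim _ cE)|apply/cvg_ex; exists l%:E].
Qed.

End extension.

(** * Size and oscillation of the extension *)

Section estimates.
Context {R : realType} {n : nat}.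
Local Notation E := (Rn R n).
Local Notation mu := (@lebesgue_measure_Rn R n).
Variables (V : E -> R) (gamma delta p1 p2 : R) (T : (E -> R) -> (E -> R)) (K : E -> E -> R).
Local Notation rho := (critical_radius V).
Hypothesis n_gt0 : (0 < n)%N.
Hypothesis rho_gt0 : forall x, 0 < rho x.
Hypothesis delta_gt0 : 0 < delta.
Hypotheses (p1_gt1 : 1 < p1) (p1_le : p1 <= p2) (p2E : p2^-1 = p1^-1 - gamma / n%:R).
Hypothesis T_SCZ : SCZ_operator V gamma delta p1 p2 T K.
Implicit Types (x y z : E) (r s t c M beta : R) (f g h : E -> R) (A B D : set E).

Let mB x r := @measurable_eball R n x r.
Let mC x r : measurable (~` eball x r). Proof. by apply: measurableC; exact: mB. Qed.
Let K_size : kernel_size V gamma K. Proof. by case: T_SCZ. Qed.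
Let K_smooth : kernel_smoothness gamma delta K. Proof. by case: T_SCZ. Qed.
Let mK x : measurable_fun setT (K x).
Proof. exact: (measurable_kernel delta_gt0 K_smooth). Qed.

(** The estimates of the extension have two parts: the image of a bounded function
    supported near the ball, measured by [T_local_bound], and a constant coming from the
    kernel. *)
Lemma integral_local_const : exists2 C, 0 <= C & forall (u : E -> R) g x r M c, 0 < r -> 0 <= M -> 0 <= c ->
  measurable_fun setT u -> bounded_in x (4 * r) M g ->
  {ae mu, forall y, eball x r y -> `|u y| <= `|T g y| + c} ->
  (\int[mu]_(y in eball x r) `|u y|%:E <= (C * (r ^+ n * (M * r `^ gamma + c)))%:E)%E.
Proof.
have [C C0 loc] := T_local_bound n_gt0 p1_gt1 p1_le p2E T_SCZ.
exists (C + 2 ^+ n); first by rewrite addr_ge0// exprn_ge0.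
move=> u g x r M c r0 M0 c0 mu_ gb uc.
have mT : measurable_fun setT (T g) by apply: (measurable_T T_SCZ); exact: bounded_in_Lfun gb.
apply: (@le_trans _ _ (\int[mu]_(y in eball x r) (`|T g y|%:E + c%:E))%E).
  apply: ae_ge0_le_integral => //.
  - by apply: measurable_funTS; apply/measurable_EFinP; exact: measurableT_comp.
  - by move=> y _; rewrite -EFinD lee_fin addr_ge0.
  - apply: measurable_funTS; apply/measurable_EFinP; apply: measurable_funD => //.
    exact: measurableT_comp.
rewrite ge0_integralD//; last first.
  by apply: measurable_funTS; apply/measurable_EFinP; exact: measurableT_comp.
rewrite integral_cst//.
apply: (@le_trans _ _ ((C * (M * (r ^+ n * r `^ gamma)))%:E + (c * (2 * r) ^+ n)%:E)%E).
  apply: leeD; first exact: loc.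
  rewrite EFinM; apply: lee_wpmul2l; first by rewrite lee_fin.
  by apply: mu_eball_le; exact: ltW.
rewrite -EFinD lee_fin exprMn.
have rn : 0 <= r ^+ n by rewrite exprn_ge0// ltW.
have rg : 0 <= r `^ gamma by exact: powR_ge0.
have k0 : (0 : R) <= 2 ^+ n by rewrite exprn_ge0.
have t1 : 0 <= 2 ^+ n * (r ^+ n * (M * r `^ gamma)) by rewrite !mulr_ge0.
have t2 : 0 <= C * (r ^+ n * c) by rewrite !mulr_ge0.
rewrite [leRHS](_ : _ = C * (M * (r ^+ n * r `^ gamma)) + c * (2 ^+ n * r ^+ n) +
  (2 ^+ n * (r ^+ n * (M * r `^ gamma)) + C * (r ^+ n * c))); last by ring.
by rewrite lerDl addr_ge0.
Qed.

(** Apply the definition on the ball of radius [4 * r]: the far part is bounded by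
    [size_bound] on the ball of radius [r]. *)
Lemma extension_size (Cr : R) beta : 0 <= beta -> beta + gamma < 1 -> 1 <= Cr ->
  (forall x0 x r, rho x0 <= r -> edist x x0 <= r -> rho x <= Cr * r) ->
  exists2 C, 0 <= C & forall f M x r, 0 <= M -> growth V beta M f -> rho x <= r ->
  (\int[mu]_(y in eball x r) `|extend V T K f y|%:E <=
   (C * (M * (r ^+ n * r `^ (beta + gamma))))%:E)%E.
Proof.
move=> b0 bg Cr1 compare.
have [C1 C10 size] := size_bound rho_gt0 delta_gt0 K_size K_smooth b0 bg Cr1 compare.
have [C2 C20 loc] := integral_local_const.
exists (C2 * (5 `^ beta + C1)); first by rewrite mulr_ge0// addr_ge0 ?powR_ge0.
move=> f M x r M0 gf xr; have r0 : 0 < r := lt_le_trans (rho_gt0 x) xr.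
have r40 : 0 < 4 * r by rewrite mulr_gt0.
have rr4 : r <= 4 * r by rewrite ler_peMl ?(ltW r0)// ler1n.
have [mTf ext] := extension_exists rho_gt0 delta_gt0 p1_gt1 T_SCZ b0 bg M0 gf.
have [mf gfx] := gf.
have gb := cutoff_bounded b0 M0 (ltW r0) (ltW r40) mf (gfx x r xr).
have M50 : 0 <= M * (r + 4 * r) `^ beta by rewrite mulr_ge0 ?powR_ge0.
have c0 : 0 <= C1 * (M * r `^ (beta + gamma)) by rewrite !mulr_ge0 ?powR_ge0.
apply: (le_trans (loc _ _ x r _ _ r0 M50 c0 mTf gb _)).
- have := ext x (4 * r) (le_trans xr rr4); apply: filterS => y hy yB.
  rewrite hy; last exact: eball_le yB.
  apply: le_trans (ler_normD _ _) _; rewrite lerD2l.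
  have d0 : 0 < 4 * r - edist x y by rewrite subr_gt0 (lt_le_trans yB).
  have sub : ~` eball x (4 * r) `<=` ~` eball y (4 * r - edist x y).
    by apply: subsetC; apply: eballS; rewrite addrC subrK.
  have i1 := size_integrable rho_gt0 delta_gt0 K_size K_smooth b0 bg M0 gf d0 (mC x _) sub.
  apply: le_trans (le_normr_Rintegral _ i1) _ => //.
  apply: ge0_fine_le; first exact: integral_ge0.
  exact: size.
- rewrite lee_fin.
  have -> : r + 4 * r = 5 * r by ring.
  rewrite powRM ?(ltW r0)// powRDp//.
  apply: le_of_eq; ring.
Qed.

(** Since [f = c + (f - c)], the difference [T f - c T 1] is formally [T (f - c)]: the part
    of [f - c] near the ball is bounded in [L^p], and the far part differs from its value at
    the centre by [smooth_integral]. *)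
Lemma extension_osc beta : 0 <= beta -> beta + gamma < 1 -> beta + gamma < delta ->
  exists2 C, 0 <= C & forall f M M' c x s, 0 < s -> 0 <= M -> 0 <= M' ->
    growth V beta M' f -> growth V 0 1 (cst 1) ->
    {ae mu, forall y, `|f y - c| <= M * (s + edist x y) `^ beta} ->
    exists h0 : R, (\int[mu]_(y in eball x s)
        `|extend V T K f y - c * extend V T K (cst 1) y - h0|%:E <=
      (C * (M * (s ^+ n * s `^ (beta + gamma))))%:E)%E.
Proof.
move=> b0 bg bd.
have [C1 C10 smooth] := smooth_integral delta_gt0 K_smooth b0 bd.
have [C2 C20 loc] := integral_local_const.
exists (C2 * (5 `^ beta + C1)); first by rewrite mulr_ge0// addr_ge0 ?powR_ge0.
move=> f M M' c x s s0 M0 M'0 gf g1 fc.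
have g01 : 0 + gamma < 1 by rewrite add0r (le_lt_trans _ bg)// lerDr.
have s40 : 0 < 4 * s by rewrite mulr_gt0.
have ss4 : s <= 4 * s by rewrite ler_peMl ?(ltW s0)// ler1n.
(* the formula for the extension holds on balls of radius at least rho x only *)
pose r := Num.max (4 * s) (rho x).
have xr : rho x <= r by rewrite le_max lexx orbT.
have s4r : 4 * s <= r by rewrite le_max lexx.
have r0 : 0 < r := lt_le_trans s40 s4r.
have [mTf extf] := extension_exists rho_gt0 delta_gt0 p1_gt1 T_SCZ b0 bg M'0 gf.
have [mT1 ext1] := extension_exists rho_gt0 delta_gt0 p1_gt1 T_SCZ (lexx 0) g01 ler01 g1.
have [mf _] := gf.
pose phi y := f y - c.
have mphi : measurable_fun setT phi by exact: measurable_funB.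
have p1_gt0 : 0 < p1 by exact: lt_trans p1_gt1.
have b4 := cutoff_bounded b0 M0 (ltW s0) (ltW s40) mphi fc.
have br := cutoff_bounded b0 M0 (ltW s0) (ltW r0) mphi fc.
have M40 : 0 <= M * (s + 4 * s) `^ beta by rewrite mulr_ge0 ?powR_ge0.
have Mr0 : 0 <= M * (s + r) `^ beta by rewrite mulr_ge0 ?powR_ge0.
have [N N0 b1] := growth_cutoff_bounded rho_gt0 x (lexx 0) ler01 g1 r0.
have L1 := bounded_in_Lfun p1_gt1 N0 b1.
have Lr := bounded_in_Lfun p1_gt1 Mr0 br.
have sub4 : eball x (4 * s) `<=` eball x r by exact: eball_le.
have split := T_cutoff_split p1_gt1 T_SCZ M40 Mr0 sub4 b4 br.
have lin := T_lin T_SCZ (a := c) (g1 := cst 1 \* \1_(eball x r)) (g2 := phi \* \1_(eball x r))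
  (h := f \* \1_(eball x r)) L1 Lr _.
have linE y : (f \* \1_(eball x r)) y =
    c * (cst 1 \* \1_(eball x r)) y + (phi \* \1_(eball x r)) y.
  by rewrite /phi /=; ring.
have iphi y : eball x (4 * s) y ->
    mu.-integrable (~` eball x (4 * s)) (EFin \o (fun z => K y z * phi z)).
  move=> yB; have d0 : 0 < 4 * s - edist x y by rewrite subr_gt0.
  have sub : ~` eball x (4 * s) `<=` ~` eball y (4 * s - edist x y).
    by apply: subsetC; apply: eballS; rewrite addrC subrK.
  have i1 := size_integrable rho_gt0 delta_gt0 K_size K_smooth b0 bg M'0 gf d0 (mC x _) sub.
  have i2 := size_integrable rho_gt0 delta_gt0 K_size K_smooth (lexx 0) g01 ler01 g1 d0 (mC x _) sub.
  have := integrable_sub (mC x (4 * s)) i1 (integrable_scale c (mC x (4 * s)) i2).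
  congr (mu.-integrable _ _); apply/funext => z /=; congr EFin.
  by rewrite /phi; ring.
pose H y := \int[mu]_(z in ~` eball x (4 * s)) (K y z * phi z).
(* the identity T f - c T 1 = T (f - c), whose right-hand side is split at 4 * s *)
have key : {ae mu, forall y, eball x s y ->
    extend V T K f y - c * extend V T K (cst 1) y = T (phi \* \1_(eball x (4 * s))) y + H y}.
  have [A1 A2] := (ext1 x r xr, extf x r xr).
  apply: filterS2 (filterI A1 A2) (filterI split (lin linE)) => y [e1 ef] [sp li] yB.
  have yB4 : eball x (4 * s) y by exact: eball_le yB.
  have yBr : eball x r y by exact: sub4.
  rewrite (ef yBr) (e1 yBr) li (sp yB4) /H.
  have d0 : 0 < r - edist x y by rewrite subr_gt0.
  have sub : ~` eball x r `<=` ~` eball y (r - edist x y).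
    by apply: subsetC; apply: eballS; rewrite addrC subrK.
  have i1 := size_integrable rho_gt0 delta_gt0 K_size K_smooth b0 bg M'0 gf d0 (mC x _) sub.
  have i2 := size_integrable rho_gt0 delta_gt0 K_size K_smooth (lexx 0) g01 ler01 g1 d0 (mC x _) sub.
  have -> : \int[mu]_(z in ~` eball x (4 * s)) (K y z * phi z) =
     \int[mu]_(z in ~` eball x (4 * s)) (K y z * (phi \* \1_(eball x r)) z) +
     (\int[mu]_(z in ~` eball x r) (K y z * f z) -
      c * \int[mu]_(z in ~` eball x r) (K y z * cst 1 z)).
    have U : ~` eball x (4 * s) = (~` eball x (4 * s) `&` eball x r) `|` ~` eball x r.
      apply/seteqP; split => [z z4|z [[]//|zr z4]]; last exact/zr/sub4.
      by have [zr|zr] := pselect (eball x r z); [left|right].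
    rewrite [in LHS]U Rintegral_setU -?U; last 4 first.
    - exact: measurableI.
    - exact: mC.
    - exact: iphi.
    - by apply/disj_setPS => z [[_ ?]].
    congr (_ + _).
      rewrite Rintegral_mkcondr; apply: eq_Rintegral => z _.
      rewrite patchE /= indicE; case: ifPn => _; first by rewrite mulr1.
      by rewrite !mulr0.
    rewrite -RintegralZl// -RintegralB//; last exact: integrable_scale.
    by apply: eq_Rintegral => z _; rewrite /phi /=; ring.
  by ring.
exists (H x).
have mu_ : measurable_fun setT
    (fun y => extend V T K f y - c * extend V T K (cst 1) y - H x).
  by apply: measurable_funB => //; apply: measurable_funB => //; exact: measurable_funM.
have c0 : 0 <= C1 * (M * s `^ (beta + gamma)) by rewrite !mulr_ge0 ?powR_ge0.
apply: (le_trans (loc _ _ x s _ _ s0 M40 c0 mu_ b4 _)).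
- move: key; apply: filterS => y ky yB; rewrite (ky yB) -addrA.
  apply: le_trans (ler_normD _ _) _; rewrite lerD2l.
  have i1 := iphi y (eball_le ss4 yB).
  have i2 : mu.-integrable (~` eball x (4 * s)) (EFin \o (fun z => K x z * phi z)).
    by apply: iphi; rewrite /eball/= edistxx.
  rewrite /H -RintegralB//; apply: le_trans (le_normr_Rintegral _ (integrable_sub _ i1 i2)) _ => //.
  apply: ge0_fine_le; first exact: integral_ge0.
  apply: le_trans (smooth f c M x y s M0 mf s0 yB fc).
  apply: le_of_eq; apply: eq_integral => z _.
  by rewrite mulrBl.
- rewrite lee_fin.
  have -> : s + 4 * s = 5 * s by ring.
  rewrite powRM ?(ltW s0)// powRDp//.
  apply: le_of_eq; ring.
Qed.

End estimates.

(** * Functions of bounded mean oscillation *)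

Section bmo.
Context {R : realType} {n : nat}.
Local Notation E := (Rn R n).
Local Notation mu := (@lebesgue_measure_Rn R n).
Variable V : E -> R.
Local Notation rho := (critical_radius V).
Hypothesis n_gt0 : (0 < n)%N.
Hypothesis rho_gt0 : forall x, 0 < rho x.
Implicit Types (x y z : E) (r s t c M beta : R) (f g h u : E -> R).

Let mB x r := @measurable_eball R n x r.
Let N : R := n.+1%:R.
Let N1 : 1 <= N. Proof. by rewrite ler1n. Qed.
Let N0 : 0 < N. Proof. exact: lt_le_trans N1. Qed.

Lemma powR_scale_le (a r beta : R) : 1 <= a -> 0 <= r -> beta <= 1 ->
  (a * r) `^ beta <= a * r `^ beta.
Proof.
move=> a1 r0 b1; rewrite powRM//; last by apply: le_trans a1.
by apply: ler_wpM2r; [exact: powR_ge0|exact: ler1_powR].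
Qed.

Lemma powR_invl (a b : R) : 0 <= a -> (a^-1) `^ b = a `^ (- b).
Proof. by move=> a0; rewrite -powR_inv1// -powRrM mulN1r. Qed.

Lemma exprn_powR_div (a beta : R) : 0 <= a -> (a ^+ n) `^ (beta / n%:R) = a `^ beta.
Proof.
move=> a0; rewrite -powR_mulrn// -powRrM mulrCA mulfV ?mulr1//.
by rewrite pnatr_eq0 -lt0n.
Qed.

(** BMO conditions are stated with powers of volumes, the estimates with powers of
    radii. *)
Lemma vol_powR_le x r beta : 0 < r -> 0 <= beta -> beta <= 1 ->
  vol (eball x r) `^ (beta / n%:R) <= 2 * r `^ beta.
Proof.
move=> r0 b0 b1; have bn0 : 0 <= beta / n%:R by rewrite divr_ge0.
apply: le_trans (powR_ler bn0 _ (vol_le x (ltW r0))) _; first exact: fine_ge0.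
rewrite exprn_powR_div ?mulr_ge0 ?(ltW r0)//.
by apply: powR_scale_le; rewrite ?(ltW r0)// ler1n.
Qed.

Lemma vol_powR_ge x r beta : 0 < r -> 0 <= beta -> beta <= 1 ->
  r `^ beta <= N * vol (eball x r) `^ (beta / n%:R).
Proof.
move=> r0 b0 b1; have bn0 : 0 <= beta / n%:R by rewrite divr_ge0.
have rN0 : 0 <= r / N by rewrite divr_ge0 ?(ltW r0) ?(ltW N0).
have h := powR_ler bn0 _ (vol_ge x r0).
apply: le_trans (ler_wpM2l (ltW N0) (h _)); last by rewrite exprn_ge0.
rewrite exprn_powR_div//.
apply: le_trans (powR_scale_le N1 rN0 b1).
by rewrite mulrC divfK// gt_eqF.
Qed.

Lemma avg_le_integral u x r (A b : R) : 0 < r -> 0 <= A -> 0 <= b ->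
  (\int[mu]_(y in eball x r) `|u y|%:E <= (A * (r ^+ n * b))%:E)%E ->
  avg (fun y => `|u y|) (eball x r) <= A * N ^+ n * b.
Proof.
move=> r0 A0 b0 /(ge0_fine_le (integral_ge0 _ _)) h.
rewrite /avg ler_pdivrMl ?vol_gt0//.
apply: (le_trans (h _)) => //.
apply: (@le_trans _ _ ((r / N) ^+ n * (A * N ^+ n * b))); last first.
  by apply: ler_wpM2r; [rewrite !mulr_ge0 ?exprn_ge0 ?(ltW N0)|exact: vol_ge].
rewrite expr_div_n; apply: le_of_eq; field.
by rewrite expf_neq0// gt_eqF.
Qed.

Lemma integral_lty_integrable u x r c : measurable_fun setT u ->
  (\int[mu]_(y in eball x r) `|u y|%:E <= c%:E)%E -> mu.-integrable (eball x r) (EFin \o u).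
Proof.
move=> mu_ h; apply/integrableP; split; first exact/measurable_EFinP/measurable_funTS.
by apply: le_lt_trans h _; rewrite ltry.
Qed.

Lemma growth_one : growth V 0 1 (cst 1).
Proof.
split=> // x r _; apply: aeW => y /=.
by rewrite powRr0 mulr1 normr1.
Qed.

(** By [campanato], [f] is close to its average over a ball; if the radius is at least
    the critical one, the size condition bounds this average. *)
Lemma BMO_growth (alpha : R) : 0 < alpha -> alpha <= 1 -> exists2 C, 0 < C &
  forall f c, loc_integrable f -> BMO_bound V alpha f c ->
  [/\ growth V alpha (C * c) f,
    forall x s, 0 < s ->
      {ae mu, forall y, `|f y - avg f (eball x s)| <= C * c * (s + edist x y) `^ alpha}
    & forall x s, 0 < s -> s <= rho x -> `|avg f (eball x s)| <= C * c * rho x `^ alpha].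
Proof.
move=> a0 a1; have [C1 C10 camp] := campanato a0 (R := R) (n := n).
pose D := C1 * 2 + 2.
have D0 : 0 < D by rewrite addr_gt0// mulr_gt0.
have C1D : C1 * 2 <= 2 * D by rewrite /D; lra.
exists (2 * D); first by rewrite mulr_gt0.
move=> f c lf [c0 osc size]; have [mf fi] := lf.
have c20 : 0 < 2 * c by rewrite mulr_gt0.
have H : osc_bound alpha f (2 * c).
  move=> x r r0; apply: le_trans (osc x r r0) _.
  rewrite (mulrC 2) -mulrA ler_pM2l//; exact: vol_powR_le (ltW a0) a1.
have cb x s : 0 < s ->
    {ae mu, forall y, `|f y - avg f (eball x s)| <= C1 * (2 * c * (s + edist x y) `^ alpha)}.
  by move=> s0; exact: camp.
have gb x r : rho x <= r -> {ae mu, forall y, `|f y| <= D * c * (r + edist x y) `^ alpha}.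
  move=> xr; have r0 : 0 < r := lt_le_trans (rho_gt0 x) xr.
  move: (cb x r r0); apply: filterS => y hy.
  have ha : `|avg f (eball x r)| <= 2 * c * r `^ alpha.
    have := avg_dist_le 0 r0 (fi x r r0); rewrite subr0.
    under eq_fun do rewrite subr0.
    move=> /le_trans; apply; apply: le_trans (size x r xr) _.
    rewrite (mulrC 2) -mulrA ler_pM2l//; exact: vol_powR_le (ltW a0) a1.
  rewrite -[f y](subrK (avg f (eball x r))); apply: le_trans (ler_normD _ _) _.
  apply: le_trans (lerD hy ha) _.
  rewrite [leRHS](_ : _ = C1 * (2 * c * (r + edist x y) `^ alpha) +
    2 * c * (r + edist x y) `^ alpha); last by rewrite /D; ring.
  rewrite lerD2l ler_pM2l//; apply: powR_ler; rewrite ?(ltW a0) ?(ltW r0)//.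
  by rewrite lerDl edist_ge0.
have Dc0 : 0 <= D * c by rewrite mulr_ge0 ?(ltW D0) ?(ltW c0).
split.
- split=> // x r xr; move: (gb x r xr); apply: filterS => y /le_trans; apply.
  by apply: ler_wpM2r; [exact: powR_ge0|rewrite -mulrA ler_peMl// ler1n].
- move=> x s s0; move: (cb x s s0); apply: filterS => y /le_trans; apply.
  rewrite mulrA; apply: ler_wpM2r; first exact: powR_ge0.
  rewrite mulrA; apply: ler_wpM2r; first exact: ltW.
  exact: C1D.
- move=> x s s0 sx; have h := gb x (rho x) (lexx _).
  have := avg_dist_le 0 s0 (fi x s s0); rewrite subr0.
  under eq_fun do rewrite subr0.
  move=> /le_trans; apply; rewrite /avg ler_pdivrMl ?vol_gt0// mulrC.
  apply: ge0_Rintegral_le_cst => //.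
  - exact: mu_eball_lty.
  - by apply: measurable_funTS; exact: measurableT_comp.
  - move: h; apply: filterS => y hy yB; apply: (le_trans hy).
    rewrite [leRHS](_ : _ = D * c * (2 * rho x `^ alpha)); last by ring.
    apply: ler_wpM2l => //.
    apply: le_trans (powR_scale_le _ (ltW (rho_gt0 x)) a1); last by rewrite ler1n.
    apply: powR_ler; first exact: ltW.
      by rewrite addr_ge0 ?edist_ge0// ltW.
    by rewrite mulr_natl mulr2n lerD2l (le_trans (ltW yB)).
  - by rewrite !mulr_ge0 ?powR_ge0 ?(ltW D0) ?(ltW c0).
Qed.

End bmo.

(** * A universal test function *)

Section universal_function.
Context {R : realType} {n : nat}.
Local Notation E := (Rn R n).
Local Notation mu := (@lebesgue_measure_Rn R n).
Variable V : E -> R.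
Local Notation rho := (critical_radius V).
Hypothesis n_gt0 : (0 < n)%N.
Hypothesis rho_gt0 : forall x, 0 < rho x.
Variable Cr : R.
Hypothesis Cr1 : 1 <= Cr.
Hypothesis compare : forall x0 x r, rho x0 <= r -> edist x x0 <= r -> rho x <= Cr * r.
Implicit Types (x y z : E) (r s t c M beta : R) (f g h u : E -> R).

Let Cr0 : 0 < Cr. Proof. exact: lt_le_trans Cr1. Qed.

Lemma powR_subadd (a b alpha : R) : 0 <= a -> 0 <= b -> 0 < alpha -> alpha <= 1 ->
  (a + b) `^ alpha <= a `^ alpha + b `^ alpha.
Proof.
move=> a0 b0 al0 al1; have [ab0|ab0] := eqVneq (a + b) 0.
  by rewrite ab0 powR0 ?gt_eqF// addr_ge0// powR_ge0.
have s0 : 0 < a + b by rewrite lt0r ab0 addr_ge0.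
have frac (c : R) : 0 <= c -> c <= a + b -> c / (a + b) * (a + b) `^ alpha <= c `^ alpha.
  move=> c0 cs; have -> : c `^ alpha = (c / (a + b)) `^ alpha * (a + b) `^ alpha.
    by rewrite -powRM ?divr_ge0 ?(ltW s0)// divfK.
  apply: ler_wpM2r; first exact: powR_ge0.
  have [->|cn0] := eqVneq c 0; first by rewrite mul0r powR_ge0.
  apply: ger1_powR => //; apply/andP; split.
    by rewrite divr_gt0// lt0r cn0.
  by rewrite ler_pdivrMr// mul1r.
apply: le_trans (lerD (frac a a0 _) (frac b b0 _)); rewrite ?lerDl ?lerDr//.
by rewrite -mulrDl -mulrDl mulfV// mul1r.
Qed.

Lemma powR_dist (a b alpha : R) : 0 <= a -> 0 <= b -> 0 < alpha -> alpha <= 1 ->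
  `|a `^ alpha - b `^ alpha| <= `|a - b| `^ alpha.
Proof.
move=> a0 b0 al0 al1.
wlog ab : a b a0 b0 / b <= a => [h|].
  have [/h|/ltW /h] := leP b a; first exact.
  by rewrite distrC (distrC a); exact.
have hp : b `^ alpha <= a `^ alpha by exact: powR_ler (ltW al0) b0 ab.
rewrite !ger0_norm ?subr_ge0// lerBlDr.
have := @powR_subadd (a - b) b alpha; rewrite subr_ge0 subrK.
exact.
Qed.

(** The largest 1-Lipschitz minorant of the critical radius. It is comparable to the
    critical radius by [compare], and being Lipschitz it yields one function of
    BMO^alpha that tests the T1 condition on all balls at once. *)
Definition rho_lip x : R := inf [set rho z + edist x z | z in [set: E]].

Let has_inf_lip x : has_inf [set rho z + edist x z | z in [set: E]].
Proof.
split; first by exists (rho x + edist x x), x.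
by exists 0 => _ [z _ <-]; rewrite addr_ge0 ?edist_ge0// ltW.
Qed.

Lemma rho_lip_le x z : rho_lip x <= rho z + edist x z.
Proof. by apply: ge_inf; [exact: (has_inf_lip x).2|exists z]. Qed.

Lemma le_rho_lip x c : (forall z, c <= rho z + edist x z) -> c <= rho_lip x.
Proof.
move=> h; apply: lb_le_inf; first exact: (has_inf_lip x).1.
by move=> _ [z _ <-]; exact: h.
Qed.

Lemma rho_lip_ge0 x : 0 <= rho_lip x.
Proof. by apply: le_rho_lip => z; rewrite addr_ge0 ?edist_ge0// ltW. Qed.

Lemma rho_le_lip x : rho x / Cr <= rho_lip x.
Proof.
apply: le_rho_lip => z; rewrite ler_pdivrMr// mulrC.
apply: (@compare z); first by rewrite lerDl edist_ge0.
by rewrite lerDr ltW.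
Qed.

Lemma rho_lip_lipschitz x y : rho_lip x <= rho_lip y + edist x y.
Proof.
rewrite -lerBlDr; apply: le_rho_lip => z; rewrite lerBlDr.
apply: le_trans (rho_lip_le x z) _; rewrite -addrA lerD2l addrC.
exact: edist_triangle.
Qed.

Lemma rho_lip_dist x y : `|rho_lip x - rho_lip y| <= edist x y.
Proof.
rewrite ler_norml lerBlDl rho_lip_lipschitz andbT.
by rewrite lerNl opprB lerBlDl edistC rho_lip_lipschitz.
Qed.

Lemma measurable_rho_lip : measurable_fun setT rho_lip.
Proof.
apply: econtinuous_measurable; first by move=> x _; exists 1.
by move=> x e _ e0; exists e => // y; exact: le_lt_trans (rho_lip_dist x y).
Qed.

Definition rho_lip_pow (alpha : R) x : R := rho_lip x `^ alpha.

(** Hoelder continuity of exponent [alpha] gives the oscillation condition; the size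
    condition holds since [rho_lip] is at most [rho x + r <= 2 * r] on a ball of radius
    [r >= rho x]. *)
Lemma rho_lip_pow_BMO (alpha : R) : 0 < alpha -> alpha <= 1 ->
  BMO V alpha (rho_lip_pow alpha).
Proof.
move=> a0 a1; pose N : R := n.+1%:R.
have N1 : 1 <= N by rewrite ler1n.
have mf : measurable_fun setT (rho_lip_pow alpha).
  exact: (measurableT_comp (measurable_powR _) measurable_rho_lip).
have fb x r y : 0 < r -> eball x r y -> rho_lip_pow alpha y <= (rho x + r) `^ alpha.
  move=> r0 yB; apply: powR_ler; [exact: ltW|exact: rho_lip_ge0|].
  by apply: le_trans (rho_lip_le y x) _; rewrite lerD2l edistC ltW.
have fi x r : 0 < r -> mu.-integrable (eball x r) (EFin \o rho_lip_pow alpha).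
  move=> r0; apply: (@ae_bounded_integrable _ _ _ _ ((rho x + r) `^ alpha)).
  - exact: measurable_eball.
  - exact: mu_eball_lty.
  - exact: measurable_funTS.
  - by apply: aeW => y yB; rewrite ger0_norm ?powR_ge0// fb.
split=> //; exists (2 * N); split.
- by rewrite mulr_gt0// (lt_le_trans _ N1).
- move=> x r r0; apply: le_trans (avg_osc_le (rho_lip_pow alpha x) r0 (fi x r r0)) _.
  rewrite -mulrA ler_pM2l//; apply: le_trans _ (vol_powR_ge n_gt0 x r0 (ltW a0) a1).
  rewrite /avg ler_pdivrMl ?vol_gt0// mulrC.
  apply: ge0_Rintegral_le_cst; [exact: measurable_eball|exact: mu_eball_lty| | | |exact: powR_ge0].
  + by apply: measurable_funTS; exact: (measurable_dist _ mf).
  + by move=> y _.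
  + apply: aeW => y yB; apply: le_trans (powR_dist _ _ a0 a1) _; rewrite ?rho_lip_ge0//.
    apply: powR_ler => //; first exact: ltW.
    by apply: le_trans (rho_lip_dist y x) _; rewrite edistC ltW.
- move=> x r xr; have r0 : 0 < r := lt_le_trans (rho_gt0 x) xr.
  apply: (@le_trans _ _ (2 * r `^ alpha)); last first.
    by rewrite -mulrA ler_pM2l//; exact: vol_powR_ge (ltW a0) a1.
  rewrite /avg ler_pdivrMl ?vol_gt0// mulrC.
  apply: ge0_Rintegral_le_cst; [exact: measurable_eball|exact: mu_eball_lty| | | |].
  + by apply: measurable_funTS; exact: measurableT_comp.
  + by move=> y _.
  + apply: aeW => y yB; rewrite ger0_norm ?powR_ge0//; apply: le_trans (fb x r y r0 yB) _.
    apply: le_trans _ (powR_scale_le _ (ltW r0) a1); last by rewrite ler1n.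
    apply: powR_ler; rewrite ?(ltW a0) ?addr_ge0 ?(ltW r0) ?(ltW (rho_gt0 x))//.
    by rewrite mulr_natl mulr2n lerD2r.
  + by rewrite mulr_ge0 ?powR_ge0.
Qed.

(** On a ball of radius at most half the lower bound [rho x / Cr] for [rho_lip x], the
    function [rho_lip] stays above the other half. *)
Lemma rho_lip_pow_avg (alpha : R) x s : 0 < alpha -> alpha <= 1 -> 0 < s ->
  s <= rho x / (2 * Cr) ->
  (2 * Cr) `^ (- alpha) * rho x `^ alpha <= avg (rho_lip_pow alpha) (eball x s).
Proof.
move=> a0 a1 s0 sx; set c := _ * _.
have [[_ fi] _] := rho_lip_pow_BMO a0 a1.
rewrite -[leLHS](avg_cst x c s0); apply: avg_le => //.
- by apply: integrable_finite_cst; [exact: measurable_eball|exact: mu_eball_lty].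
- exact: fi.
- move=> y yB.
  have C20 : 0 < 2 * Cr by rewrite mulr_gt0.
  have -> : c = (rho x / (2 * Cr)) `^ alpha.
    rewrite [RHS]powRM ?invr_ge0 ?(ltW C20) ?(ltW (rho_gt0 x))//.
    by rewrite powR_invl ?(ltW C20)// mulrC.
  apply: powR_ler; first exact: ltW.
    by rewrite divr_ge0 ?(ltW C20) ?(ltW (rho_gt0 x)).
  have h1 := rho_lip_lipschitz x y; have h2 := rho_le_lip x.
  have h3 : edist x y <= rho x / (2 * Cr) by rewrite (le_trans (ltW yB)).
  have hE : rho x / Cr = rho x / (2 * Cr) + rho x / (2 * Cr) by field; rewrite gt_eqF.
  by rewrite -(lerD2r (edist x y)) (le_trans _ h1)// (le_trans _ h2)// hE lerD2l.
Qed.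

End universal_function.

(** * The T1 criterion *)

Section t1_theorem.
Context {R : realType} {n : nat}.
Local Notation E := (Rn R n).
Local Notation mu := (@lebesgue_measure_Rn R n).
Variables (V : E -> R) (alpha gamma delta p1 p2 : R) (T : (E -> R) -> (E -> R)) (K : E -> E -> R).
Local Notation rho := (critical_radius V).
Local Notation T1 := (extend V T K (cst 1)).
Hypothesis n_gt0 : (0 < n)%N.
Hypothesis rho_gt0 : forall x, 0 < rho x.
Variable Cr : R.
Hypothesis Cr1 : 1 <= Cr.
Hypothesis compare : forall x0 x r, rho x0 <= r -> edist x x0 <= r -> rho x <= Cr * r.
Hypotheses (gamma_ge0 : 0 <= gamma) (delta_gt0 : 0 < delta).
Hypotheses (p1_gt1 : 1 < p1) (p1_le : p1 <= p2) (p2E : p2^-1 = p1^-1 - gamma / n%:R).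
Hypothesis T_SCZ : SCZ_operator V gamma delta p1 p2 T K.
Hypotheses (alpha_gt0 : 0 < alpha) (alpha_le1 : alpha <= 1).
Hypotheses (ag1 : alpha + gamma < 1) (agd : alpha + gamma < delta).
Implicit Types (x y z : E) (r s t c M beta : R) (f g h u : E -> R).

Let mB x r := @measurable_eball R n x r.
Let fB x r := @mu_eball_lty R n x r.
Let N : R := n.+1%:R.
Let N1 : 1 <= N. Proof. by rewrite ler1n. Qed.
Let N0 : 0 < N. Proof. exact: lt_le_trans N1. Qed.
Let tau := alpha + gamma.
Let tau_ge0 : 0 <= tau. Proof. by rewrite addr_ge0// ltW. Qed.
Let g1 : 0 + gamma < 1. Proof. by rewrite add0r (le_lt_trans _ ag1)// lerDr ltW. Qed.
Let gamma_le1 : gamma <= 1. Proof. by have := g1; rewrite add0r => /ltW. Qed.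

Lemma size_avg beta : 0 <= beta -> beta + gamma < 1 -> exists2 C, 0 <= C &
  forall f M, 0 <= M -> growth V beta M f ->
  [/\ measurable_fun setT (extend V T K f),
    forall x r, 0 < r -> mu.-integrable (eball x r) (EFin \o extend V T K f) &
    forall x r, rho x <= r ->
      avg (fun y => `|extend V T K f y|) (eball x r) <= C * M * r `^ (beta + gamma)].
Proof.
move=> b0 bg.
have [C C0 size] := extension_size n_gt0 rho_gt0 delta_gt0 p1_gt1 p1_le p2E T_SCZ b0 bg Cr1 compare.
exists (C * N ^+ n); first by rewrite mulr_ge0// exprn_ge0// ltW.
move=> f M M0 gf.
have [mTf _] := extension_exists rho_gt0 delta_gt0 p1_gt1 T_SCZ b0 bg M0 gf.
split=> //.
- move=> x r r0; have r' : rho x <= Num.max r (rho x) by rewrite le_max lexx orbT.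
  apply: (integrableS (mB x (Num.max r (rho x))) (mB x r)).
    by apply: eball_le; rewrite le_max lexx.
  exact: integral_lty_integrable mTf (size f M x _ M0 gf r').
- move=> x r xr; have r0 : 0 < r := lt_le_trans (rho_gt0 x) xr.
  have := size f M x r M0 gf xr.
  rewrite [X in (X%:E)%E](_ : _ = C * (r ^+ n * (M * r `^ (beta + gamma)))); last by ring.
  move=> /(avg_le_integral r0 C0 _) h; apply: le_trans (h _) _.
    by rewrite mulr_ge0 ?powR_ge0.
  by rewrite mulrA.
Qed.

Lemma T1_integrable x r : 0 < r -> mu.-integrable (eball x r) (EFin \o T1).
Proof.
move=> r0; have [C C0 size] := size_avg (lexx 0) g1.
by have [_ + _] := size _ _ ler01 (growth_one V); exact.
Qed.

Lemma osc_avg : exists2 C, 0 <= C & forall f M c x s, 0 < s -> 0 <= M ->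
    growth V alpha M f ->
    {ae mu, forall y, `|f y - c| <= M * (s + edist x y) `^ alpha} ->
    exists h0 : R, avg (fun y => `|extend V T K f y - c * T1 y - h0|) (eball x s) <=
      C * M * s `^ tau.
Proof.
have [C C0 osc] := extension_osc n_gt0 rho_gt0 delta_gt0 p1_gt1 p1_le p2E T_SCZ
  (ltW alpha_gt0) ag1 agd.
exists (C * N ^+ n); first by rewrite mulr_ge0// exprn_ge0// ltW.
move=> f M c x s s0 M0 gf fc; have [h0 h] := osc f M M c x s s0 M0 M0 gf (growth_one V) fc.
exists h0; move: h.
rewrite [X in (X%:E)%E](_ : _ = C * (s ^+ n * (M * s `^ tau))); last by rewrite /tau; ring.
move=> /(avg_le_integral s0 C0 _) h; apply: le_trans (h _) _.
  by rewrite mulr_ge0 ?powR_ge0.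
by rewrite mulrA.
Qed.

Lemma T1_quantityE x s : 0 < s ->
  (rho x / s) `^ alpha * (vol (eball x s) `^ (1 + gamma / n%:R))^-1
    * (\int[mu]_(y in eball x s) `|T1 y - avg T1 (eball x s)|) =
  (rho x / s) `^ alpha * (vol (eball x s) `^ (gamma / n%:R))^-1 *
    avg (fun y => `|T1 y - avg T1 (eball x s)|) (eball x s).
Proof.
move=> s0; have v0 := vol_gt0 x s0.
rewrite powRDp// powRr1 ?(ltW v0)// invfM /avg.
by rewrite -!mulrA; congr (_ * _); rewrite mulrCA mulrA.
Qed.

Lemma T1_avg_le C x s : 0 < s -> 0 <= C ->
  (rho x / s) `^ alpha * (vol (eball x s) `^ (1 + gamma / n%:R))^-1
    * (\int[mu]_(y in eball x s) `|T1 y - avg T1 (eball x s)|) <= C ->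
  rho x `^ alpha * avg (fun y => `|T1 y - avg T1 (eball x s)|) (eball x s) <= 2 * C * s `^ tau.
Proof.
move=> s0 C0; rewrite T1_quantityE//; set a := avg _ _.
have v0 := vol_gt0 x s0.
have vg0 : 0 < vol (eball x s) `^ (gamma / n%:R) by rewrite powR_gt0.
have sa0 : 0 < s `^ alpha by rewrite powR_gt0.
have -> : (rho x / s) `^ alpha = rho x `^ alpha * (s `^ alpha)^-1.
  rewrite powRM ?invr_ge0 ?(ltW s0) ?(ltW (rho_gt0 x))//; congr (_ * _).
  by rewrite powR_invl ?(ltW s0)// powRN.
have vle := vol_powR_le n_gt0 x s0 gamma_ge0 gamma_le1.
move=> h; have : rho x `^ alpha * a <= C * (s `^ alpha * vol (eball x s) `^ (gamma / n%:R)).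
  rewrite -ler_pdivrMr ?mulr_gt0// invfM; apply: le_trans h.
  by apply: le_of_eq; ring.
move=> /le_trans; apply; rewrite (mulrC 2) -mulrA ler_wpM2l//.
rewrite /tau powRDp// mulrCA ler_pM2l//.
Qed.

Lemma T1_avg_ge C x s : 0 < s -> 0 <= C ->
  rho x `^ alpha * avg (fun y => `|T1 y - avg T1 (eball x s)|) (eball x s) <= C * s `^ tau ->
  (rho x / s) `^ alpha * (vol (eball x s) `^ (1 + gamma / n%:R))^-1
    * (\int[mu]_(y in eball x s) `|T1 y - avg T1 (eball x s)|) <= C * N.
Proof.
move=> s0 C0; rewrite T1_quantityE//; set a := avg _ _.
have v0 := vol_gt0 x s0.
have vg0 : 0 < vol (eball x s) `^ (gamma / n%:R) by rewrite powR_gt0.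
have sa0 : 0 < s `^ alpha by rewrite powR_gt0.
have -> : (rho x / s) `^ alpha = rho x `^ alpha * (s `^ alpha)^-1.
  rewrite powRM ?invr_ge0 ?(ltW s0) ?(ltW (rho_gt0 x))//; congr (_ * _).
  by rewrite powR_invl ?(ltW s0)// powRN.
have vge := vol_powR_ge n_gt0 x s0 gamma_ge0 gamma_le1.
move=> h; rewrite [leLHS](_ : _ = (rho x `^ alpha * a) / (s `^ alpha * vol (eball x s) `^ (gamma / n%:R))); last first.
  by rewrite invfM; ring.
rewrite ler_pdivrMr ?mulr_gt0//; apply: le_trans h _.
rewrite -mulrA ler_wpM2l// /tau powRDp// mulrCA ler_pM2l//.
Qed.

Lemma avg_le_comb x r u v w c : 0 < r -> mu.-integrable (eball x r) (EFin \o u) ->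
  mu.-integrable (eball x r) (EFin \o v) -> mu.-integrable (eball x r) (EFin \o w) ->
  (forall y, u y <= v y + c * w y) ->
  avg u (eball x r) <= avg v (eball x r) + c * avg w (eball x r).
Proof.
move=> r0 ui vi wi h.
have cwi : mu.-integrable (eball x r) (EFin \o (fun y => c * w y)).
  exact: integrable_scale.
apply: (@le_trans _ _ (avg (fun y => v y + c * w y) (eball x r))).
  by apply: avg_le => //; exact: integrable_add.
by rewrite /avg RintegralD// RintegralZl// mulrDr (mulrCA c).
Qed.

Lemma avg_scale x r u c : mu.-integrable (eball x r) (EFin \o u) ->
  avg (fun y => c * u y) (eball x r) = c * avg u (eball x r).
Proof. by move=> ui; rewrite /avg RintegralZl// mulrCA. Qed.

(** On balls of radius at least [rho x / 2] everything follows from [size_avg]. On smaller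
    ones [T f] is, up to a constant and the error of [osc_avg], the multiple [a T 1] with [a]
    the average of [f]; as [a] is of order [rho x `^ alpha], the T1 condition bounds the
    oscillation of this multiple by [s `^ tau]. *)
Lemma T1_condition_bounded :
  (exists C : R, forall x s, 0 < s -> s <= rho x / 2 ->
    (rho x / s) `^ alpha * (vol (eball x s) `^ (1 + gamma / n%:R))^-1
    * (\int[mu]_(y in eball x s) `|T1 y - avg T1 (eball x s)|) <= C) ->
  bounded_BMO V alpha tau (extend V T K).
Proof.
move=> [C0 T1C].
have [Cg Cg0 bmo] := BMO_growth n_gt0 rho_gt0 alpha_gt0 alpha_le1.
have [C1 C10 size] := size_avg (ltW alpha_gt0) ag1.
have [C2 C20 osc] := osc_avg.
(* the summands serve the radii above and below rho x / 2, and the size condition *)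
pose A := 2 * (4 * N) ^+ n * C1 * Cg * 2 + 2 * (C2 * Cg + Cg * (2 * `|C0|)) + C1 * Cg + 1.
have N40 : 0 <= (4 * N) ^+ n by rewrite exprn_ge0// mulr_ge0// ltW.
have Cg0' := ltW Cg0.
have T1' : 0 <= 2 * (4 * N) ^+ n * C1 * Cg * 2 by rewrite !mulr_ge0.
have T2' : 0 <= 2 * (C2 * Cg + Cg * (2 * `|C0|)) by rewrite mulr_ge0// addr_ge0// !mulr_ge0.
have T3' : 0 <= C1 * Cg by rewrite mulr_ge0.
have A0 : 0 < A by rewrite /A ltr_wpDl// !addr_ge0.
have A1 : 2 * (4 * N) ^+ n * C1 * Cg * 2 <= A by rewrite /A -!addrA lerDl !addr_ge0.
have A2 : 2 * (C2 * Cg + Cg * (2 * `|C0|)) <= A.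
  by rewrite /A -!addrA addrCA lerDl !addr_ge0.
have A3 : C1 * Cg <= A by rewrite /A -addrA addrCA lerDl !addr_ge0.
have AN0 : 0 < A * N by rewrite mulr_gt0.
have conv c x r : 0 < c -> 0 < r ->
    A * c * r `^ tau <= A * N * c * vol (eball x r) `^ (tau / n%:R).
  move=> c0 r0.
  rewrite [leRHS](_ : _ = A * c * (N * vol (eball x r) `^ (tau / n%:R))); last by ring.
  apply: ler_wpM2l; first by rewrite mulr_ge0// ltW.
  by apply: vol_powR_ge => //; exact: ltW.
have main f c : loc_integrable f -> BMO_bound V alpha f c ->
    loc_integrable (extend V T K f) /\ BMO_bound V tau (extend V T K f) (A * N * c).
  move=> lf fb; have c0 : 0 < c by case: fb.
  have [gf fosc favg] := bmo f c lf fb.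
  have Cc0 : 0 <= Cg * c by rewrite mulr_ge0 ?ltW.
  have [mTf Tfi Tavg] := size f (Cg * c) Cc0 gf.
  split=> //; split; first by rewrite mulr_gt0.
    move=> x r r0.
    apply: le_trans (conv c x r c0 r0).
    have rt0 : 0 <= r `^ tau by exact: powR_ge0.
    have [rs|rs] := leP r (rho x / 2).
      have [h0 h] := osc f (Cg * c) (avg f (eball x r)) x r r0 Cc0 gf (fosc x r r0).
      have rx : r <= rho x.
        by apply: (le_trans rs); rewrite ler_pdivrMr// ler_peMr ?ler1n// ltW.
      have fa := favg x r r0 rx.
      have T1a := T1_avg_le r0 (normr_ge0 C0) (le_trans (T1C x r r0 rs) (ler_norm _)).
      set a := avg f (eball x r) in h fa.
      set m := avg T1 (eball x r) in T1a.
      have Ti := Tfi x r r0; have T1i := T1_integrable x r0.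
      apply: le_trans (avg_osc_le (h0 + a * m) r0 Ti) _.
      have step : avg (fun y => `|extend V T K f y - (h0 + a * m)|) (eball x r) <=
          avg (fun y => `|extend V T K f y - a * T1 y - h0|) (eball x r) +
          `|a| * avg (fun y => `|T1 y - m|) (eball x r).
        apply: avg_le_comb => //.
        - by apply: (integrable_dist _ (mB x r) (fB x r)).
        - apply: (integrable_dist _ (mB x r) (fB x r)); apply: (integrable_sub (mB x r) Ti).
          exact: (integrable_scale a (mB x r) T1i).
        - by apply: (integrable_dist _ (mB x r) (fB x r)).
        - move=> y; rewrite -normrM; apply: le_trans (ler_normD _ _).
          by apply: le_of_eq; congr (`|_|); ring.
      have w0 : 0 <= avg (fun y => `|T1 y - m|) (eball x r).
        by rewrite mulr_ge0 ?invr_ge0 ?fine_ge0// integral_ge0.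
      have aw : `|a| * avg (fun y => `|T1 y - m|) (eball x r) <= Cg * c * (2 * `|C0| * r `^ tau).
        apply: le_trans (ler_wpM2r w0 fa) _; rewrite -[leLHS]mulrA.
        exact: ler_wpM2l.
      have := le_trans step (lerD h aw); rewrite -(@ler_pM2l _ 2)// => /le_trans; apply.
      rewrite [leLHS](_ : _ = 2 * (C2 * Cg + Cg * (2 * `|C0|)) * (c * r `^ tau)); last by ring.
      rewrite -[leRHS]mulrA; apply: ler_wpM2r => //.
      by rewrite mulr_ge0// ltW.
    have Ti := Tfi x r r0.
    apply: le_trans (avg_osc_le 0 r0 Ti) _.
    under eq_fun do rewrite subr0.
    have r20 : 0 < 2 * r by rewrite mulr_gt0.
    have xr2 : rho x <= 2 * r by rewrite ltW// mulrC -ltr_pdivrMr.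
    have sub : eball x r `<=` eball x (2 * r).
      by apply: eball_le; rewrite ler_peMl ?(ltW r0)// ler1n.
    have Ti2 : mu.-integrable (eball x (2 * r)) (EFin \o (fun y => `|extend V T K f y|)).
      by have := integrable_norm (Tfi x (2 * r) r20).
    have := avg_subset_le r0 r20 sub Ti2 (fun z => normr_ge0 _).
    rewrite mulfK ?gt_eqF// (_ : 2 * n.+1%:R * 2 = 4 * N); last by rewrite /N; ring.
    move=> h; rewrite -[leRHS]mulrA.
    apply: le_trans _ (ler_wpM2r _ A1); last by rewrite mulr_ge0// ltW.
    rewrite [leRHS](_ : _ = 2 * ((4 * N) ^+ n * (C1 * (Cg * c) * (2 * r `^ tau)))); last by ring.
    rewrite ler_pM2l//; apply: le_trans h _; apply: ler_wpM2l => //.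
    apply: le_trans (Tavg x (2 * r) xr2) _; apply: ler_wpM2l; first by rewrite mulr_ge0.
    by apply: powR_scale_le; rewrite ?ler1n ?(ltW r0)// ltW.
  move=> x r xr; have r0 : 0 < r := lt_le_trans (rho_gt0 x) xr.
  apply: le_trans (Tavg x r xr) _; apply: le_trans (conv c x r c0 r0).
  by apply: ler_wpM2r; [exact: powR_ge0|rewrite mulrA ler_pM2r].
exists (A * N) => f [lf [c fb]]; have [lTf Tfb] := main f c lf fb.
split; first by split => //; exists (A * N * c).
rewrite -ler_pdivrMl//; apply: lb_le_inf; first by exists c.
move=> d fd; rewrite ler_pdivrMl//; have [_ Tfd] := main f d lf fd.
by apply: ge_inf => //; exists 0 => e [/ltW].
Qed.

(** Read the same identity backwards for the universal function: [a T 1] oscillates like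
    [T f] up to the error of [osc_avg], and [a] is at least [k * rho x `^ alpha]. When the
    radius is comparable to [rho x] there is no cancellation to prove, and the size of [T 1]
    suffices. *)
Lemma bounded_T1_condition : bounded_BMO V alpha tau (extend V T K) ->
  exists C : R, forall x s, 0 < s -> s <= rho x / 2 ->
    (rho x / s) `^ alpha * (vol (eball x s) `^ (1 + gamma / n%:R))^-1
    * (\int[mu]_(y in eball x s) `|T1 y - avg T1 (eball x s)|) <= C.
Proof.
move=> [C0 bounded].
have [Cg Cg0 bmo] := BMO_growth n_gt0 rho_gt0 alpha_gt0 alpha_le1.
have [C1 C10 size] := size_avg (lexx 0) g1.
have [C2 C20 osc] := osc_avg.
have [_ T1i T1avg] := size _ _ ler01 (growth_one V).
set f := rho_lip_pow V alpha.
have fBMO : BMO V alpha f by exact: rho_lip_pow_BMO.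
have [lf [c fb]] := fBMO; have c0 : 0 < c by case: fb.
have [gf fosc _] := bmo f c lf fb.
have Cc0 : 0 <= Cg * c by rewrite mulr_ge0 ?ltW.
have [[lTf [c' Tfb]] _] := bounded f fBMO.
have [c'0 Tfosc _] := Tfb.
have Cr0 : 0 < 2 * Cr by rewrite mulr_gt0// (lt_le_trans _ Cr1).
pose k := (2 * Cr) `^ (- alpha).
have k0 : 0 < k by rewrite powR_gt0.
(* D1 serves the radii up to rho x / (2 * Cr), and D2 those from there to rho x / 2 *)
pose D1 := 2 / k * (c' * 2 + C2 * (Cg * c)).
pose D2 := 2 * ((4 * N * Cr) ^+ n * (C1 * (2 * Cr))).
have D10 : 0 <= D1 by rewrite mulr_ge0 ?divr_ge0 ?(ltW k0)// addr_ge0// !mulr_ge0// ltW.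
have P0 : 0 <= (4 * N * Cr) ^+ n.
  apply: exprn_ge0; apply: mulr_ge0; last exact: le_trans Cr1.
  by rewrite mulr_ge0// ltW.
have D20 : 0 <= D2.
  by apply: mulr_ge0 => //; apply: mulr_ge0 => //; apply: mulr_ge0 => //; exact: ltW.
exists ((D1 + D2) * N) => x s s0 sx; apply: T1_avg_ge => //; first exact: addr_ge0.
have Bi := T1i x s s0; set m := avg T1 _.
have st0 : 0 <= s `^ tau by exact: powR_ge0.
have ra0 : 0 < rho x `^ alpha by rewrite powR_gt0.
have [ss|ss] := leP s (rho x / (2 * Cr)).
  apply: (@le_trans _ _ (D1 * s `^ tau)); last first.
    by apply: ler_wpM2r => //; rewrite lerDl.
  have [h0 h] := osc f (Cg * c) (avg f (eball x s)) x s s0 Cc0 gf (fosc x s s0).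
  have ak := rho_lip_pow_avg n_gt0 rho_gt0 Cr1 compare alpha_gt0 alpha_le1 s0 ss.
  set a := avg f (eball x s) in h; rewrite -/k -/f -/a in ak.
  have a0 : 0 < a by apply: lt_le_trans ak; rewrite mulr_gt0.
  have [mTf Tfi] := lTf; have Ti := Tfi x s s0.
  set b := avg (extend V T K f) (eball x s).
  have hb : avg (fun y => `|extend V T K f y - b|) (eball x s) <= c' * (2 * s `^ tau).
    apply: le_trans (Tfosc x s s0) _; apply: ler_wpM2l; first exact: ltW.
    by apply: vol_powR_le => //; exact: ltW.
  (* the constant matching b in a T1 = T f - h0 - error *)
  pose l := (b - h0) / a.
  have d1 : mu.-integrable (eball x s) (EFin \o (fun y => `|T1 y - l|)).
    by apply: (integrable_dist _ (mB x s) (fB x s)).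
  have step : a * avg (fun y => `|T1 y - l|) (eball x s) <=
      c' * (2 * s `^ tau) + C2 * (Cg * c) * s `^ tau.
    apply: le_trans (lerD hb h); rewrite -avg_scale// -[X in _ + X]mul1r.
    apply: avg_le_comb => //.
    - exact: (integrable_scale a (mB x s) d1).
    - by apply: (integrable_dist _ (mB x s) (fB x s)).
    - apply: (integrable_dist _ (mB x s) (fB x s)); apply: (integrable_sub (mB x s) Ti).
      exact: (integrable_scale a (mB x s) Bi).
    - move=> y; rewrite mul1r.
      have -> : a * `|T1 y - l| =
          `|(extend V T K f y - b) - (extend V T K f y - a * T1 y - h0)|.
        rewrite -{1}(gtr0_norm a0) -normrM; congr (`|_|).
        by rewrite /l; field; rewrite gt_eqF.
      exact: ler_normB.
  apply: le_trans (ler_wpM2l (ltW ra0) (avg_osc_le l s0 Bi)) _.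
  have w0 : 0 <= avg (fun y => `|T1 y - l|) (eball x s).
    by rewrite mulr_ge0 ?invr_ge0 ?fine_ge0// integral_ge0.
  have := le_trans (ler_wpM2r w0 ak) step.
  move: (avg _ _) => w kw.
  rewrite [leLHS](_ : _ = 2 / k * (k * rho x `^ alpha * w)); last by field; rewrite gt_eqF.
  rewrite [leRHS](_ : _ = 2 / k * (c' * (2 * s `^ tau) + C2 * (Cg * c) * s `^ tau)); last first.
    by rewrite /D1; ring.
  by apply: ler_wpM2l => //; rewrite divr_ge0// ltW.
have xs : rho x < 2 * Cr * s by rewrite mulrC -ltr_pdivrMr.
have sub : eball x s `<=` eball x (rho x).
  apply: eball_le; apply: (le_trans sx).
  by rewrite ler_pdivrMr// ler_peMr ?ler1n// ltW.
have x0 := rho_gt0 x.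
have h1 : avg (fun y => `|T1 y - m|) (eball x s) <=
    2 * ((4 * N * Cr) ^+ n * (C1 * rho x `^ gamma)).
  apply: le_trans (avg_osc_le 0 s0 Bi) _; under eq_fun do rewrite subr0.
  rewrite ler_pM2l//.
  have Ti2 : mu.-integrable (eball x (rho x)) (EFin \o (fun y => `|T1 y|)).
    by have := integrable_norm (T1i x (rho x) x0).
  have w0 : 0 <= avg (fun y => `|T1 y|) (eball x (rho x)).
    by rewrite mulr_ge0 ?invr_ge0 ?fine_ge0// integral_ge0.
  apply: le_trans (avg_subset_le s0 x0 sub Ti2 (fun z => normr_ge0 _)) _.
  have := T1avg x (rho x) (lexx _); rewrite mulr1 add0r => h2.
  apply: ler_pM => //.
    by rewrite exprn_ge0// mulr_ge0 ?divr_ge0 ?(ltW x0) ?(ltW s0).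
  rewrite -/N; apply: lerXn2r; rewrite ?nnegrE.
  - by rewrite !mulr_ge0 ?invr_ge0 ?(ltW x0) ?(ltW s0) ?(ltW N0).
  - by apply: mulr_ge0; [rewrite mulr_ge0// ltW|exact: le_trans Cr1].
  - rewrite (_ : 4 * N * Cr = 2 * N * (2 * Cr)); last by ring.
    by rewrite ler_pM2l ?mulr_gt0// ler_pdivrMr//; exact: ltW.
apply: (@le_trans _ _ (D2 * s `^ tau)); last first.
  by rewrite mulrDl lerDr; exact: mulr_ge0.
apply: le_trans (ler_wpM2l (ltW ra0) h1) _.
rewrite [leLHS](_ : _ = 2 * ((4 * N * Cr) ^+ n * (C1 * rho x `^ tau))); last first.
  by rewrite /tau powRDp//; ring.
rewrite [leRHS](_ : _ = 2 * ((4 * N * Cr) ^+ n * (C1 * (2 * Cr * s `^ tau)))); last first.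
  by rewrite /D2; ring.
rewrite ler_pM2l//; apply: ler_wpM2l => //.
apply: ler_wpM2l => //.
apply: le_trans (powR_ler tau_ge0 (ltW x0) (ltW xs)) _.
apply: powR_scale_le; rewrite ?(ltW s0)//; last exact: ltW.
by rewrite mulr_ege1// ler1n.
Qed.

End t1_theorem.

Theorem theorem1p1 (R : realType) (n : nat) (V : Rn R n -> R)
    (q alpha gamma delta p1 p2 : R)
    (T : (Rn R n -> R) -> (Rn R n -> R)) (K : Rn R n -> Rn R n -> R)
    (n_ge3 : (3 <= n)%N)
    (V_ge0 : forall x, 0 <= V x)
    (V_loc : loc_integrable V)
    (V_neq0 : ~ {ae lebesgue_measure_Rn n, forall x, V x = 0})
    (q_ge : n%:R / 2 <= q)
    (V_RH : reverse_hoelder q V)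
    (gamma_ge0 : 0 <= gamma) (gamma_lt : gamma < n%:R)
    (p1_gt1 : 1 < p1) (p1_le : p1 <= p2)
    (p2E : p2^-1 = p1^-1 - gamma / n%:R)
    (delta_gt0 : 0 < delta)
    (T_SCZ : SCZ_operator V gamma delta p1 p2 T K)
    (alpha_gt0 : 0 < alpha) (alpha_lt1 : alpha < 1)
    (alpha_gamma : alpha + gamma < Num.min 1 delta) :
  bounded_BMO V alpha (alpha + gamma) (extend V T K) <->
  exists C : R, forall (x : Rn R n) (s : R),
    0 < s -> s <= critical_radius V x / 2 ->
    let B := eball x s in
    let T1 := extend V T K (cst 1) in
    (critical_radius V x / s) `^ alpha
      * (vol B `^ (1 + gamma / n%:R))^-1
      * (\int[lebesgue_measure_Rn n]_(y in B) `|T1 y - avg T1 B|)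
    <= C.
Proof.
have n_gt0 : (0 < n)%N by exact: leq_trans n_ge3.
have rho_gt0 := critical_radius_gt0 V_ge0 V_loc V_neq0 n_ge3 q_ge V_RH.
have [Cr Cr1 compare] := critical_radius_compare V_ge0 V_loc V_neq0 n_ge3 q_ge V_RH.
move: alpha_gamma; rewrite lt_min => /andP[ag1 agd].
split.
  exact: (bounded_T1_condition n_gt0 rho_gt0 Cr1 compare gamma_ge0 delta_gt0 p1_gt1 p1_le p2E
    T_SCZ alpha_gt0 (ltW alpha_lt1) ag1 agd).
exact: (T1_condition_bounded n_gt0 rho_gt0 Cr1 compare gamma_ge0 delta_gt0 p1_gt1 p1_le p2E
  T_SCZ alpha_gt0 (ltW alpha_lt1) ag1 agd).
Qed.
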